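(* Let $d\ge1$, $\rho>0$, and let $C:\mathbb{R}^d\to\mathbb{R}$ be a symmetric continuous function in $L^2(\mathbb{R}^d)$ with $C(0)=\rho$ and $0\le\mathcal{F}(C)\le1$. Let $\mathbf{X}$ be a stationary determinantal point process with kernel $C$, let $\{D_n\}_{n\in\mathbb{N}}$ be a regular sequence of subsets of $\mathbb{R}^d$, and define for all $n\in\mathbb{N}$ $$\widehat\rho_n=\frac1{|D_n|}\sum_{x\in\mathbf{X}}\mathbf{1}_{\{x\in D_n\}}.$$ Then $$\sqrt{|D_n|}\left(\widehat\rho_n-\rho\right)\longrightarrow\mathcal{N}(0,\sigma^2)\quad\text{in distribution as }n\to+\infty,$$ where $\sigma^2=\lim_{n\to+\infty}\mathrm{Var}\left(\sqrt{|D_n|}\,\widehat\rho_n\right)=\rho-\int_{\mathbb{R}^d}C(x)^2\,dx$.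
   Context: $|D|$ denotes Lebesgue measure. The Fourier transform is $\mathcal{F}(h)(t)=\int_{\mathbb{R}^d}h(x)e^{2i\pi x\cdot t}\,dx$, extended to $L^2(\mathbb{R}^d)$ by Plancherel's theorem. A sequence $\{D_n\}_{n\in\mathbb{N}}$ of subsets of $\mathbb{R}^d$ is regular if for all $n$, $D_n\subset D_{n+1}$, $D_n$ is compact and convex, and there are (positive) constants $\alpha_1,\alpha_2$ with $\alpha_1n^d\le|D_n|\le\alpha_2n^d$ and $\alpha_1n^{d-1}\le\mathcal{H}_{d-1}(\partial D_n)\le\alpha_2n^{d-1}$ for all $n$, where $\mathcal{H}_{d-1}$ is the $(d-1)$-dimensional Hausdorff measure. A point process is a random locally finite subset $\mathbf{X}$ of $\mathbb{R}^d$ (points never coincide, almost surely). Its joint intensity $\rho^{(k)}$ is the Lebesgue density on $\mathbb{R}^{dk}$ of the measure $D_1\times\dots\times D_k\mapsto\mathbb{E}\big(\sum^{\neq}_{(x_1,\dots,x_k)\in\mathbf{X}^k}\mathbf{1}_{\{x_1\in D_1,\dots,x_k\in D_k\}}\big)$ (sum over $k$-tuples of pairwise distinct points). $\mathbf{X}$ is a stationary determinantal point process with kernel $C$ if for all $k\ge1$, $\rho^{(k)}(x_1,\dots,x_k)=\det(C(x_i-x_j))_{1\le i,j\le k}$ for almost every $(x_1,\dots,x_k)$. $\mathcal{N}(0,\sigma^2)$ is the centered normal distribution with variance $\sigma^2$ (the Dirac mass at $0$ if $\sigma^2=0$). *)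

(* Defs.v *)
(* Points of R^d are row vectors over an abstract [R : realType]. *)
From HB Require Import structures.
From mathcomp Require Import all_boot all_order all_algebra.
From mathcomp Require Import complex.
From mathcomp Require Import all_classical all_reals all_analysis.
From mathcomp Require Import measurable_realfun.
Set Implicit Arguments.
Unset Strict Implicit.
Unset Printing Implicit Defensive.
Import Order.TTheory GRing.Theory Num.Theory.
Import numFieldNormedType.Exports.

Local Open Scope classical_set_scope.
Local Open Scope ring_scope.

(* The sigma-algebra on R^n is generated by the coordinate maps, as the library
   does for [n.-tuple T]. Since R is second countable, it is the Borel
   sigma-algebra of the topology the library puts on matrices. *)
Definition rowvec_display : measure_display. Proof. exact. Qed.

Section rowvec_measurable.
Context {R : realType}.
Variable n : nat.

Definition rowvec_coord (i : 'I_n) (x : 'rV[R]_n) : measurableTypeR R := x 0 i.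

Let rowvec0 : g_sigma_preimage rowvec_coord set0.
Proof. exact: sigma_algebra0. Qed.

Let rowvecC A : g_sigma_preimage rowvec_coord A ->
  g_sigma_preimage rowvec_coord (~` A).
Proof. exact: sigma_algebraC. Qed.

Let rowvec_bigcup (F : (set 'rV[R]_n)^nat) :
  (forall i, g_sigma_preimage rowvec_coord (F i)) ->
  g_sigma_preimage rowvec_coord (\bigcup_i (F i)).
Proof. exact: sigma_algebra_bigcup. Qed.

HB.instance Definition _ := @isMeasurable.Build rowvec_display
  'rV[R]_n (g_sigma_preimage rowvec_coord) rowvec0 rowvecC rowvec_bigcup.

End rowvec_measurable.

Section measurable_rowvec.
Context d (T : measurableType d) (R : realType).

Lemma measurable_rowvec_coord n (i : 'I_n) :
  measurable_fun [set: 'rV[R]_n] (fun x : 'rV[R]_n => x 0 i).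
Proof.
move=> _ A mA; rewrite setTI; apply: sub_sigma_algebra.
case: n i => [[] //|n i]; rewrite -bigcup_mkord_ord.
exists i; first exact: ltn_ord.
by exists A => //; rewrite inord_val setTI.
Qed.

Lemma measurable_rowvecP n (f : T -> 'rV[R]_n) :
  (forall i, measurable_fun [set: T] (fun t => f t 0 i)) ->
  measurable_fun [set: T] f.
Proof.
move=> mf _ A mA.
suff : g_sigma_preimage (@rowvec_coord R n) `<=`
       image_set_system [set: T] f measurable by apply.
apply: smallest_sub.
  exact/sigma_algebra_image/sigma_algebra_measurable.
case: n f mf {A mA} => [|n] f mf; first by rewrite big_ord0.
rewrite -bigcup_mkord_ord; apply: bigcup_sub => i Ii B [C mC <-].
rewrite /image_set_system/=.
by have := mf (inord i) measurableT C mC; rewrite !setTI.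
Qed.

End measurable_rowvec.

Section rowvec_cons_measure.
Context {R : realType}.
Variable n : nat.

Definition rowvec_cons (p : measurableTypeR R * 'rV[R]_n) : 'rV[R]_n.+1 :=
  row_mx (p.1)%:M p.2 : 'rV[R]_(1 + n).

Definition rowvec_uncons (x : 'rV[R]_n.+1) : measurableTypeR R * 'rV[R]_n :=
  ((x : 'rV[R]_(1 + n)) 0 0, rsubmx (x : 'rV[R]_(1 + n))).

Lemma rowvec_consK : cancel rowvec_cons rowvec_uncons.
Proof.
move=> [x y]; rewrite /rowvec_cons /rowvec_uncons /=; congr pair; last first.
  by rewrite row_mxKr.
rewrite (_ : 0 = lshift n (0 : 'I_1)); last exact/val_inj.
by rewrite row_mxEl mxE eqxx mulr1n.
Qed.

Lemma measurable_rowvec_cons : measurable_fun setT rowvec_cons.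
Proof.
apply: measurable_rowvecP => i.
case: (@split_ordP 1 n i) => j ->.
  rewrite (_ : (fun _ => _) = fst); first exact: measurable_fst.
  apply/funext => -[x y]; apply: etrans (row_mxEl _ _ _ _) _.
  by rewrite mxE !ord1 eqxx mulr1n.
rewrite (_ : (fun _ => _) = (fun y : 'rV[R]_n => y 0 j) \o snd).
  apply: measurableT_comp; first exact: measurable_rowvec_coord.
  exact: measurable_snd.
by apply/funext => -[x y]; exact: row_mxEr.
Qed.

Lemma measurable_rowvec_uncons : measurable_fun setT rowvec_uncons.
Proof.
apply/measurable_fun_pair; first exact: measurable_rowvec_coord.
apply: measurable_rowvecP => i.
rewrite (_ : (fun _ => _) = (fun x : 'rV[R]_n.+1 => x 0 (rshift 1 i))).
  exact: measurable_rowvec_coord.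
by apply/funext => x; rewrite mxE.
Qed.

End rowvec_cons_measure.

Section lebesgue_succ.
Context {R : realType} {n : nat}.
Variable mu : {sigma_finite_measure set 'rV[R]_n -> \bar R}.

Definition lebesgue_succ : set 'rV[R]_n.+1 -> \bar R :=
  pushforward (@lebesgue_measure R \x mu)%E (@rowvec_cons R n).

Let lebesgue_succ0 : lebesgue_succ set0 = 0%E.
Proof. by rewrite /lebesgue_succ /pushforward preimage_set0 measure0. Qed.

Let lebesgue_succ_ge0 A : (0 <= lebesgue_succ A)%E.
Proof.
by rewrite /lebesgue_succ /pushforward measure_ge0.
Qed.

Let lebesgue_succ_sigma_additive : semi_sigma_additive lebesgue_succ.
Proof.
have mc B : measurable B -> measurable (@rowvec_cons R n @^-1` B).
  by move=> mB; rewrite -[X in measurable X]setTI; exact: measurable_rowvec_cons.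
move=> F mF tF mUF; rewrite /lebesgue_succ /pushforward preimage_bigcup.
apply: measure_semi_sigma_additive.
- by move=> i; exact: mc.
- apply/trivIsetP => /= i j _ _ ij; rewrite -preimage_setI.
  by move/trivIsetP : tF => /(_ _ _ _ _ ij) ->//; rewrite preimage_set0.
- by rewrite -preimage_bigcup; exact: mc.
Qed.

HB.instance Definition _ := isMeasure.Build _ _ _ lebesgue_succ
  lebesgue_succ0 lebesgue_succ_ge0 lebesgue_succ_sigma_additive.

Let lebesgue_succ_sigma_finite : sigma_finite setT lebesgue_succ.
Proof.
have /sigma_finiteP[F [TF ndF Foo]] := sigma_finiteT (@lebesgue_measure R).
have /sigma_finiteP[G [TG ndG Goo]] := sigma_finiteT mu.
exists (fun k => @rowvec_uncons R n @^-1` (F k `*` G k)).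
  apply/esym/seteqP; split=> // x _.
  have [i _ Fi] : (\bigcup_i F i) (rowvec_uncons x).1 by rewrite -TF.
  have [j _ Gj] : (\bigcup_i G i) (rowvec_uncons x).2 by rewrite -TG.
  exists (maxn i j) => //; split.
  - by move: Fi; exact/subsetPset/ndF/leq_maxl.
  - by move: Gj; exact/subsetPset/ndG/leq_maxr.
move=> k; have [mF Fk] := Foo k; have [mG Gk] := Goo k; split.
  rewrite -[X in measurable X]setTI; apply: measurable_rowvec_uncons => //.
  exact: measurableX.
rewrite /lebesgue_succ /pushforward -comp_preimage.
rewrite (_ : _ \o _ = id) ?preimage_id; last first.
  by apply/funext => x /=; rewrite rowvec_consK.
by rewrite product_measure1E// lte_mul_pinfty// ge0_fin_numE.
Qed.

HB.instance Definition _ := Measure_isSigmaFinite.Build _ _ _ lebesgue_succ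
  lebesgue_succ_sigma_finite.

End lebesgue_succ.

(* Lebesgue measure on R^n (on Borel sets): the n-fold product of the
   one-dimensional one, R^(n+1) being identified with R * R^n. *)
Fixpoint lebesgue_rV {R : realType} (n : nat) :
    {sigma_finite_measure set 'rV[R]_n -> \bar R} :=
  match n with
  | 0 => dirac (0 : 'rV[R]_0)
  | m.+1 => lebesgue_succ (lebesgue_rV m)
  end.

Section euclidean.
Context {R : realType} {d : nat}.
Implicit Types (x y t : 'rV[R]_d) (A : set 'rV[R]_d).

Definition dotv x y : R := \sum_(i < d) x 0 i * y 0 i.

(* The library's norm on row vectors is the sup norm, hence this one. *)
Definition enorm x : R := Num.sqrt (dotv x x).

(* -oo for the empty set. *)
Definition diameter A : \bar R :=
  ereal_sup [set (enorm (p.1 - p.2))%:E | p in A `*` A].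

Definition boundary A : set 'rV[R]_d := closure A `\` interior A.

(* diam(A)^s, with 0^0 = 1 for nonempty A, and 0 for empty A whatever s, so that
   for s = 0 one obtains the counting measure. *)
Definition diameter_pow (s : nat) A : \bar R :=
  if `[< A = set0 >] then 0%E else (fine (diameter A) ^+ s)%:E.

Definition hausdorff_pre (s : nat) (delta : R) A : \bar R :=
  ereal_inf [set (\sum_(0 <= i <oo) diameter_pow s (U i))%E
    | U in [set U : nat -> set 'rV[R]_d | A `<=` \bigcup_i U i /\
                              forall i, (diameter (U i) <= delta%:E)%E]].

(* s-dimensional Hausdorff measure, without the normalising factor (volume of
   the unit ball of R^s over 2^s) that some authors include; it is only used in
   bounds up to arbitrary positive constants. *)
Definition hausdorff_measure (s : nat) A : \bar R :=
  ereal_sup [set hausdorff_pre s delta A | delta in [set delta : R | 0 < delta]].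

End euclidean.

(* Sequences are indexed by the positive integers: the value at 0 is ignored,
   since the bounds at n = 0 would force |D_0| = 0. *)
Definition regular_sequence {R : realType} {d : nat} (D : nat -> set 'rV[R]_d) :=
  (forall n, (0 < n)%N ->
    [/\ D n `<=` D n.+1, compact (D n)
      & convex_set (D n : set (convex_lmodType 'rV[R]_d))]) /\
  exists a1 a2 : R, [/\ 0 < a1, 0 < a2 & forall n, (0 < n)%N ->
    ((a1 * n%:R ^+ d)%:E <= lebesgue_rV d (D n) <= (a2 * n%:R ^+ d)%:E)%E /\
    ((a1 * n%:R ^+ d.-1)%:E <= hausdorff_measure d.-1 (boundary (D n))
                            <= (a2 * n%:R ^+ d.-1)%:E)%E].

Section fourier.
Context {R : realType} {d : nat}.
Local Notation mu := (@lebesgue_rV R d).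

(* The integral of h(x) e^(2 i pi x.t), for integrable real-valued h. *)
Definition fourier (h : 'rV[R]_d -> R) (t : 'rV[R]_d) : R[i] :=
  Complex (\int[mu]_x (h x * cos (2 * pi * dotv x t)))
          (\int[mu]_x (h x * sin (2 * pi * dotv x t))).

(* g is (a version of) the Plancherel extension of the Fourier transform at h in
   L^2: the L^2 limit of the transforms of some sequence in the intersection of
   L^1 and L^2 that tends to h in L^2. *)
Definition is_fourier_L2 (h : 'rV[R]_d -> R) (g : 'rV[R]_d -> R[i]) :=
  [/\ (fun t => complex.Re (g t)) \in Lfun mu 2%:E,
      (fun t => complex.Im (g t)) \in Lfun mu 2%:E
    & exists hk : nat -> 'rV[R]_d -> R,
      [/\ forall k, hk k \in Lfun mu 1%E,
          forall k, hk k \in Lfun mu 2%:E,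
          'N[mu]_2%:E[EFin \o (hk k \- h)%R]%E @[k --> \oo] --> 0%E
        & 'N[mu]_2%:E[(fun t => (ComplexField.Normc.normc (fourier (hk k) t - g t))%R%:E)]%E
            @[k --> \oo] --> 0%E]].

End fourier.

Section point_process.
Context {R : realType} {d : nat} {disp : measure_display}
  {T : measurableType disp} (P : probability T R) (X : T -> set 'rV[R]_d).

Definition point_process :=
  (forall w B, bounded_set B -> finite_set (X w `&` B)) /\
  (forall B : set 'rV[R]_d, measurable B -> bounded_set B ->
    measurable_fun [set: T] (fun w => counting (X w `&` B) : \bar R)).

(* k-tuples of pairwise distinct points of A, as the rows of a k * d matrix. *)
Definition distinct_tuples (k : nat) (A : set 'rV[R]_d) : set 'M[R]_(k, d) :=
  [set x | (forall i, A (row i x)) /\ injective (fun i => row i x)].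

(* R^(dk) is ['rV[R]_(k * d)], which [vec_mx] splits into k vectors of R^d. *)
Definition joint_intensity (k : nat) (rhok : 'M[R]_(k, d) -> R) :=
  [/\ forall x, 0 <= rhok x,
      measurable_fun [set: 'rV[R]_(k * d)] (fun z => rhok (vec_mx z))
    & forall D : 'I_k -> set 'rV[R]_d, (forall i, measurable (D i)) ->
      (\int[P]_w (\esum_(x in distinct_tuples (X w))
                    (\prod_(i < k) \1_(D i) (row i x))%:E))%E =
      (\int[lebesgue_rV (k * d)]_(z in [set z | forall i, D i (row i (vec_mx z))])
         (rhok (vec_mx z))%:E)%E].

Definition stationary_dpp (C : 'rV[R]_d -> R) :=
  point_process /\
  forall k : nat, (0 < k)%N -> exists rhok : 'M[R]_(k, d) -> R,
    joint_intensity rhok /\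
    {ae lebesgue_rV (k * d), forall z, let x := vec_mx z in
      rhok x = \det (\matrix_(i < k, j < k) C (row i x - row j x))}.

Definition intensity_estimator (D : set 'rV[R]_d) (w : T) : R :=
  (fine (lebesgue_rV d D))^-1 * \sum_(x \in X w) (\1_D x : R).

Definition cvg_in_distribution (Z : nat -> T -> R)
    (nu : probability (measurableTypeR R) R) :=
  forall f : R -> R, continuous f -> bounded_fun f ->
    ('E_P[f \o Z n])%E @[n --> \oo] --> (\int[nu]_x (f x)%:E)%E.

End point_process.

(* [normal_prob m 0] is not the Dirac mass in the library. *)
Definition centered_normal {R : realType} (sigma2 : R) :
    probability (measurableTypeR R) R :=
  if sigma2 == 0
  then dirac (0 : measurableTypeR R) : probability (measurableTypeR R) R
  else normal_prob 0 (Num.sqrt sigma2) : probability (measurableTypeR R) R.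

(* Main.v *)
(* Restrict the kernel to a window: K(x, y) = C(x - y) for x, y in D, let V = |D|,
   let N be the number of points in D and p_j the trace of the j-th iterated
   kernel. The factorial moments of N are Fredholm determinants, so that the
   numbers e_k = E binom(N, k) and p_j satisfy Newton's identities. In terms of
   finite differences this is a Stein identity
     E[N h(N - 1)] = sum_j (-1)^j p_(j+1) E[(Delta^j h)(N)],
   valid as soon as Delta^k h(0) decreases geometrically at a suitable rate.
   With h(n) = (1 - w)^n and (1 + w)^n it bounds 2 sum_i p_(2i) w^(2i-1) by
   E[N (1 - w)^(N - 1)] / E[(1 - w)^N], which forces |p_j| <= p_2 for all j >= 2:
   if the log-convex sequence p_2, p_4, ... increased somewhere, it would grow
   geometrically and the sum would blow up at some w < 1, where the quotient is
   bounded. With h a cosine of frequency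
   u / sqrt V it yields, up to O(1 / sqrt V), the differential equation of the
   Gaussian characteristic function for (N - p_1) / sqrt V, with variance
   (p_1 - p_2) / V. Here p_1 = rho V, and p_2 / V tends to the integral of C^2
   because |{x in D | x + v notin D}| is at most c(v) (H_(d-1)(boundary D) + 1). *)

From HB Require Import structures.
Require Import Defs.
From mathcomp Require Import all_boot all_order all_fingroup all_algebra.
From mathcomp Require Import complex finmap.
From mathcomp Require Import all_classical all_reals all_analysis.
From mathcomp Require Import measurable_realfun.
From mathcomp Require Import ring lra zify.
Set Implicit Arguments.
Unset Strict Implicit.
Unset Printing Implicit Defensive.
Import Order.TTheory GRing.Theory Num.Theory.
Import numFieldNormedType.Exports.
Local Open Scope classical_set_scope.
Local Open Scope ring_scope.

(** * Bounded measurable functions and iterated integrals *)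

Section bounded_measurable.
Context {R : realType}.

(** If the kernel had eigenvalues l_i, N would be a sum of independent Bernoulli(l_i) variables, p_j
    the power sums of the l_i and e_k their elementary symmetric functions. This picture guides the
    formulas, but only traces and determinants are handled: the quotient E[N (1 - w)^(N - 1)] /
    E[(1 - w)^N], for instance, is formally sum_i l_i / (1 - w l_i), the generating function of the
    p_j. The obstacle is convergence. Series in the factorial moments require exponential moments of
    N, and these require a geometric bound on the p_j. The Stein identity is therefore used twice:
    with the crude rate supplied by the growth argument, to reach |p_j| <= p_2 by contradiction, and
    then with rate 1, for the cosine. Complex exponentials are replaced by sin (u x + b) with all
    phases b, and Levy's theorem by Bernstein polynomials in sin (c x), bounded second moments
    giving the tightness. *)

Definition bmeas {d} {T : measurableType d} (f : T -> R) :=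
  measurable_fun setT f /\ exists M : R, forall x, `|f x| <= M.

Lemma bmeas_cst d (T : measurableType d) (c : R) : bmeas (fun _ : T => c).
Proof. by split; [exact: measurable_cst|exists `|c|]. Qed.

Lemma bmeasD d (T : measurableType d) (f g : T -> R) :
  bmeas f -> bmeas g -> bmeas (fun x => f x + g x).
Proof.
move=> [mf [M fM]] [mg [N gN]]; split; first exact: measurable_funD.
by exists (M + N) => x; rewrite (le_trans (ler_normD _ _))// lerD.
Qed.

Lemma bmeasM d (T : measurableType d) (f g : T -> R) :
  bmeas f -> bmeas g -> bmeas (fun x => f x * g x).
Proof.
move=> [mf [M fM]] [mg [N gN]]; split; first exact: measurable_funM.
by exists (M * N) => x; rewrite normrM ler_pM.
Qed.

Lemma bmeasZ d (T : measurableType d) (c : R) (f : T -> R) :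
  bmeas f -> bmeas (fun x => c * f x).
Proof. by move=> bf; apply: bmeasM => //; exact: bmeas_cst. Qed.

Lemma bmeasN d (T : measurableType d) (f : T -> R) :
  bmeas f -> bmeas (fun x => - f x).
Proof.
move=> bf; rewrite (_ : (fun _ => _) = fun x => (-1) * f x); first exact: bmeasZ.
by apply/funext => x; rewrite mulN1r.
Qed.

Lemma bmeasB d (T : measurableType d) (f g : T -> R) :
  bmeas f -> bmeas g -> bmeas (fun x => f x - g x).
Proof. by move=> bf bg; apply: bmeasD => //; exact: bmeasN. Qed.

Lemma bmeas_sum d (T : measurableType d) (I : Type) (r : seq I) (P : pred I)
    (f : I -> T -> R) :
  (forall i, bmeas (f i)) -> bmeas (fun x => \sum_(i <- r | P i) f i x).
Proof.
move=> bf; elim: r => [|a r IH].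
  by under eq_fun do rewrite big_nil; exact: bmeas_cst.
under eq_fun do rewrite big_cons; case: (P a) => //; exact: bmeasD.
Qed.

Lemma bmeas_prod d (T : measurableType d) (I : Type) (r : seq I) (P : pred I)
    (f : I -> T -> R) :
  (forall i, bmeas (f i)) -> bmeas (fun x => \prod_(i <- r | P i) f i x).
Proof.
move=> bf; elim: r => [|a r IH].
  by under eq_fun do rewrite big_nil; exact: bmeas_cst.
under eq_fun do rewrite big_cons; case: (P a) => //; exact: bmeasM.
Qed.

Lemma bmeas_comp d (T : measurableType d) d' (T' : measurableType d')
    (f : T -> R) (h : T' -> T) :
  bmeas f -> measurable_fun setT h -> bmeas (fun x => f (h x)).
Proof.
move=> [mf [M fM]] mh; split; first exact: measurableT_comp.
by exists M => x.
Qed.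

End bounded_measurable.

Section bounded_integral.
Context {R : realType} d (E : measurableType d)
  (mu : {finite_measure set E -> \bar R}).

Lemma bmeas_integrable (f : E -> R) : bmeas f -> mu.-integrable setT (EFin \o f).
Proof.
move=> [mf [M fM]]; apply: measurable_bounded_integrable => //.
  by rewrite ltey_eq fin_num_measure.
exists M; split; first exact: num_real.
by move=> N MN x _; rewrite /= (le_trans (fM x))// ltW.
Qed.

Lemma bmeas_intD (f g : E -> R) : bmeas f -> bmeas g ->
  \int[mu]_x (f x + g x) = \int[mu]_x f x + \int[mu]_x g x.
Proof. by move=> bf bg; rewrite RintegralD//; exact: bmeas_integrable. Qed.

Lemma bmeas_intB (f g : E -> R) : bmeas f -> bmeas g ->
  \int[mu]_x (f x - g x) = \int[mu]_x f x - \int[mu]_x g x.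
Proof. by move=> bf bg; rewrite RintegralB//; exact: bmeas_integrable. Qed.

Lemma bmeas_intZ (c : R) (f : E -> R) : bmeas f ->
  \int[mu]_x (c * f x) = c * \int[mu]_x f x.
Proof. by move=> bf; rewrite RintegralZl//; exact: bmeas_integrable. Qed.

Lemma bmeas_int_sum (I : Type) (r : seq I) (P : pred I) (f : I -> E -> R) :
  (forall i, bmeas (f i)) ->
  \int[mu]_x (\sum_(i <- r | P i) f i x) = \sum_(i <- r | P i) \int[mu]_x f i x.
Proof.
move=> bf; elim: r => [|a r IH].
  by under eq_Rintegral do rewrite big_nil; rewrite big_nil Rintegral_cst// mul0r.
under eq_Rintegral do rewrite big_cons; rewrite big_cons; case: (P a) => //.
by rewrite bmeas_intD ?IH//; exact: bmeas_sum.
Qed.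

Lemma bmeas_int_param d' (O : measurableType d') (F : O * E -> R) :
  bmeas F -> bmeas (fun o => \int[mu]_x F (o, x)).
Proof.
move=> [mF [M FM]].
have bF o : bmeas (fun x => F (o, x)).
  split; last by exists M.
  exact: (measurableT_comp mF (measurable_pair1 o)).
split; last first.
  exists (M * fine (mu setT)) => o.
  apply: le_trans (le_normr_Rintegral _ _) _ => //; first exact: bmeas_integrable.
  rewrite -Rintegral_cst//; apply: le_Rintegral => //.
  - apply/bmeas_integrable; split; last by exists M => x; rewrite normr_id.
    exact: (measurableT_comp (@normr_measurable R setT) (bF o).1).
  - exact: bmeas_integrable (bmeas_cst _ _).
(* Tonelli's measurability statement wants a nonnegative integrand, hence the shift by the bound
   [M], whose contribution is subtracted again. *)
rewrite (_ : (fun _ => _) = fun o =>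
    fine (\int[mu]_x (F (o, x) + M)%:E) - M * fine (mu setT)).
  apply: measurable_funB => //; apply: measurableT_comp => //.
  apply: (@measurable_fun_fubini_tonelli_F _ _ _ _ _ _ (fun z => (F z + M)%:E)).
    by apply/measurable_EFinP; exact: measurable_funD.
  move=> z; rewrite lee_fin -lerBlDr sub0r.
  by have := FM z; rewrite ler_norml => /andP[].
apply/funext => o; rewrite -[fine _]/(\int[mu]_x (F (o, x) + M)).
rewrite bmeas_intD ?Rintegral_cst// ?addrK//; exact: bmeas_cst.
Qed.

End bounded_integral.

Section bounded_fubini.
Context {R : realType} d1 d2 (E1 : measurableType d1) (E2 : measurableType d2)
  (m1 : {finite_measure set E1 -> \bar R}) (m2 : {finite_measure set E2 -> \bar R}).

Lemma bmeas_fubini (F : E1 * E2 -> R) : bmeas F ->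
  \int[m1]_x \int[m2]_y F (x, y) = \int[m2]_y \int[m1]_x F (x, y).
Proof.
move=> bF; have [mF [M FM]] := bF.
have b1 x : bmeas (fun y => F (x, y)).
  by split; [exact: (measurableT_comp mF (measurable_pair1 x))|exists M].
have b2 y : bmeas (fun x => F (x, y)).
  by split; [exact: (measurableT_comp mF (measurable_pair2 y))|exists M].
have iF : (m1 \x m2)%E.-integrable setT (EFin \o F).
  apply: measurable_bounded_integrable => //.
    rewrite -setXTT [ltLHS](product_measure1E m1 m2 measurableT measurableT).
    by rewrite lte_mul_pinfty ?fin_num_measure// ltey_eq fin_num_measure.
  exists M; split; first exact: num_real.
  by move=> N MN x _; rewrite /= (le_trans (FM x))// ltW.
transitivity (fine (\int[m1]_x \int[m2]_y (EFin \o F) (x, y))%E).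
  congr fine; apply: eq_integral => x _.
  by rewrite fineK// integrable_fin_num//; exact: (bmeas_integrable m2 (b1 x)).
rewrite Fubini//; congr fine; apply: eq_integral => y _.
by rewrite fineK// integrable_fin_num//; exact: (bmeas_integrable m1 (b2 y)).
Qed.

End bounded_fubini.

(* A bounded function of k points is "nice" if composing it with any k
   measurable maps gives a measurable function: no sigma-algebra on E^k is
   needed, and parameters can be carried along in O. *)
Section iterated_integral.
Context {R : realType} d (E : measurableType d)
  (mu : {finite_measure set E -> \bar R}).

Definition consf k (x : E) (g : 'I_k -> E) : 'I_k.+1 -> E :=
  fun i => oapp g x (unlift ord0 i).

Lemma consf0 k x (g : 'I_k -> E) : consf x g ord0 = x.
Proof. by rewrite /consf unlift_none. Qed.

Lemma consf_lift k x (g : 'I_k -> E) i : consf x g (lift ord0 i) = g i.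
Proof. by rewrite /consf liftK. Qed.

Lemma consfP k (g g' : 'I_k.+1 -> E) :
  g ord0 = g' ord0 -> (forall i, g (lift ord0 i) = g' (lift ord0 i)) -> g = g'.
Proof.
by move=> g0 gl; apply/funext => i; case: (unliftP ord0 i) => [j|] ->.
Qed.

Fixpoint iint (k : nat) : (('I_k -> E) -> R) -> R :=
  match k with
  | 0 => fun f => f (fun i => match i with Ordinal m p => match notF p with end end)
  | k'.+1 => fun f => \int[mu]_x iint (fun g => f (consf x g))
  end.

Definition nice d' (O : measurableType d') k (F : O -> ('I_k -> E) -> R) :=
  forall d'' (O' : measurableType d'') (p : O' -> O) (h : O' -> 'I_k -> E),
    measurable_fun setT p -> (forall i, measurable_fun setT (fun o => h o i)) ->
    bmeas (fun o => F (p o) (h o)).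

Lemma measurable_consf d' (O : measurableType d') k (x : O -> E)
    (h : O -> 'I_k -> E) :
  measurable_fun setT x -> (forall i, measurable_fun setT (fun o => h o i)) ->
  forall i, measurable_fun setT (fun o => consf (x o) (h o) i).
Proof.
move=> mx mh i; case: (unliftP ord0 i) => [j|] ->.
  rewrite (_ : (fun _ => _) = h^~ j) //.
  by apply/funext => o; rewrite consf_lift.
by rewrite (_ : (fun _ => _) = x)//; apply/funext => o; rewrite consf0.
Qed.

(** The first of the k + 1 points moves into the parameter space. This drives the inductions on
    [iint], where the outer variable is a parameter for the inner ones. *)
Lemma nice_cons d' (O : measurableType d') k (F : O -> ('I_k.+1 -> E) -> R) :
  nice F -> nice (fun (z : O * E) g => F z.1 (consf z.2 g)).
Proof.
move=> mF d'' O' p h mp mh.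
apply: (mF _ _ (fun o => (p o).1) (fun o => consf (p o).2 (h o))).
  exact: (measurableT_comp measurable_fst mp).
apply: measurable_consf => //.
exact: (measurableT_comp measurable_snd mp).
Qed.

Lemma nice_at d' (O : measurableType d') k (F : O -> ('I_k -> E) -> R) d''
    (O' : measurableType d'') (p : O' -> O) :
  measurable_fun setT p -> nice F -> nice (fun o' => F (p o')).
Proof.
move=> mp mF d3 O3 q h mq mh; apply: (mF _ _ (p \o q) h) => //.
exact: measurableT_comp.
Qed.

Lemma bmeas_iint d' (O : measurableType d') k (F : O -> ('I_k -> E) -> R) :
  nice F -> bmeas (fun o => iint (F o)).
Proof.
elim: k => [|k IH] in d' O F *.
  by move=> mF; apply: (mF _ _ id (fun _ => _)) => // -[].
move=> nF; have := IH _ _ _ (nice_cons nF).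
by move=> /(bmeas_int_param mu).
Qed.

Lemma bmeas_iint_cons k (f : ('I_k.+1 -> E) -> R) :
  nice (fun _ : unit => f) -> bmeas (fun x => iint (fun g => f (consf x g))).
Proof.
move=> nf; apply: bmeas_iint.
apply: (nice_at (p := fun x : E => (tt, x)) _ (nice_cons nf)).
exact: measurable_pair1.
Qed.

Definition nice1 k (f : ('I_k -> E) -> R) := nice (fun _ : unit => f).

Lemma nice_nice1 d' (O : measurableType d') k (F : O -> ('I_k -> E) -> R) o :
  nice F -> nice1 (F o).
Proof. by move=> nF; exact: (nice_at (p := fun _ : unit => o)). Qed.

Lemma nice1_cons k (f : ('I_k.+1 -> E) -> R) x :
  nice1 f -> nice1 (fun g => f (consf x g)).
Proof. by move=> /nice_cons /(nice_nice1 (tt, x)). Qed.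

Lemma nice1_comp k k' (f : ('I_k -> E) -> R) (s : 'I_k -> 'I_k') :
  nice1 f -> nice1 (fun g => f (g \o s)).
Proof.
move=> nf d'' O' p h mp mh.
by apply: (nf _ _ p (fun o => h o \o s)) => // i; exact: mh.
Qed.

Lemma nice1Z k c (f : ('I_k -> E) -> R) : nice1 f -> nice1 (fun g => c * f g).
Proof.
move=> nf d'' O' p h mp mh; apply: bmeasZ.
exact: (nf _ _ p h mp mh).
Qed.

Lemma nice_det d' (O : measurableType d') k n
    (A : O -> ('I_k -> E) -> 'M[R]_n) :
  (forall i j, nice (fun o g => A o g i j)) -> nice (fun o g => \det (A o g)).
Proof.
move=> nA d'' O' p h mp mh; apply: bmeas_sum => s; apply: bmeasZ.
apply: bmeas_prod => i; exact: (nA _ _ _ _ p h).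
Qed.

Lemma iint_sum k (I : Type) (r : seq I) (f : I -> ('I_k -> E) -> R) :
  (forall i, nice1 (f i)) ->
  iint (fun g => \sum_(i <- r) f i g) = \sum_(i <- r) iint (f i).
Proof.
elim: k => [//|k IH] in f * => nf /=.
under eq_Rintegral => x _ do rewrite (IH _ (fun i => nice1_cons x (nf i))).
by rewrite bmeas_int_sum// => i; exact: (bmeas_iint_cons (nf i)).
Qed.

Lemma iintD k (f h : ('I_k -> E) -> R) : nice1 f -> nice1 h ->
  iint (fun g => f g + h g) = iint f + iint h.
Proof.
elim: k => [//|k IH] in f h * => nf nh /=.
under eq_Rintegral => x _ do rewrite (IH _ _ (nice1_cons x nf) (nice1_cons x nh)).
by rewrite bmeas_intD//; [exact: (bmeas_iint_cons nf)|exact: (bmeas_iint_cons nh)].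
Qed.

Lemma iintZ k c (f : ('I_k -> E) -> R) : nice1 f ->
  iint (fun g => c * f g) = c * iint f.
Proof.
elim: k => [//|k IH] in f * => nf /=.
under eq_Rintegral => x _ do rewrite (IH _ (nice1_cons x nf)).
by rewrite bmeas_intZ//; exact: (bmeas_iint_cons nf).
Qed.

(** Fubini for the two outermost variables; the other transpositions are built from this one. *)
Lemma iint_swap01 k (f : ('I_k.+2 -> E) -> R) : nice1 f ->
  iint (fun g => f (g \o tperm ord0 (lift ord0 ord0))) = iint f.
Proof.
move=> nf /=.
have sw x y (g : 'I_k -> E) :
    consf x (consf y g) \o tperm ord0 (lift ord0 ord0) = consf y (consf x g).
  apply: consfP => [|i]; first by rewrite /= tpermL consf_lift !consf0.
  move: i => /= i; case: (unliftP ord0 i) => [j|] -> /=.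
    by rewrite tpermD// !consf_lift.
  by rewrite tpermR consf_lift !consf0.
under eq_Rintegral => x _ do under eq_Rintegral => y _ do under eq_fun => g do rewrite sw.
pose G (z : E * E) := iint (fun g => f (consf z.2 (consf z.1 g))).
apply: (@bmeas_fubini _ _ _ _ _ mu mu G).
have /nice_cons /nice_cons /bmeas_iint bf := nf.
apply: (bmeas_comp (h := fun z : E * E => ((tt, z.2), z.1)) bf).
by do 2?[apply/measurable_fun_pair => //].
Qed.

Definition lift_fun k (s : 'I_k -> 'I_k) (i : 'I_k.+1) : 'I_k.+1 :=
  oapp (fun j => lift ord0 (s j)) ord0 (unlift ord0 i).

Definition iint_inv k (s : 'I_k -> 'I_k) :=
  forall f : ('I_k -> E) -> R, nice1 f -> iint (fun g => f (g \o s)) = iint f.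

Lemma iint_inv_comp k (s t : 'I_k -> 'I_k) :
  iint_inv s -> iint_inv t -> iint_inv (s \o t).
Proof.
move=> Hs Ht f nf; rewrite -(Ht _ nf).
by rewrite -(Hs _ (nice1_comp t nf)).
Qed.

Lemma iint_inv_lift k (s : 'I_k -> 'I_k) : iint_inv s -> iint_inv (lift_fun s).
Proof.
move=> Hs f nf /=; apply: eq_Rintegral => x _.
rewrite -(Hs _ (nice1_cons x nf)); congr iint; apply/funext => g; congr f.
apply: consfP => [|i]; first by rewrite /= /lift_fun unlift_none !consf0.
by rewrite /= /lift_fun liftK /= !consf_lift.
Qed.

Lemma lift_fun_tperm k (i j : 'I_k) :
  lift_fun (tperm i j) =1 tperm (lift ord0 i) (lift ord0 j).
Proof.
move=> l; rewrite /lift_fun; case: (unliftP ord0 l) => [m|] -> /=.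
  case: (tpermP i j m) => [->|->|/eqP mi /eqP mj].
  - by rewrite tpermL.
  - by rewrite tpermR.
  - by rewrite tpermD// eq_sym (inj_eq lift_inj).
by rewrite tpermD// -lift0.
Qed.

(** Transpositions of nonzero indices come from the induction hypothesis, with the outer variable
    left alone. For (0 b) with b > 1, conjugate (0 1) by (1 b). *)
Lemma iint_inv_tperm k (i j : 'I_k) : iint_inv (tperm i j).
Proof.
elim: k => [|k IH] in i j *; first by case: i.
have Hl (a b : 'I_k) : iint_inv (tperm (lift ord0 a) (lift ord0 b)).
  by rewrite -(funext (lift_fun_tperm a b)); exact/iint_inv_lift/IH.
have H0 (b : 'I_k) : iint_inv (tperm ord0 (lift ord0 b)).
  clear i j IH; case: k => [|k] in b Hl *; first by case: b.
  have H01 : iint_inv (tperm (ord0 : 'I_k.+2) (lift ord0 ord0)).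
    by move=> f; exact: iint_swap01.
  have [->//|b0] := eqVneq b ord0.
  have := iint_inv_comp (iint_inv_comp (Hl ord0 b) H01) (Hl ord0 b).
  congr iint_inv; apply/funext => l /=.
  set t := tperm (lift ord0 ord0) _.
  have := congr1 (fun s : 'S_k.+2 => s l) (tpermJ ord0 (lift ord0 ord0) t).
  have t0 : t ord0 = ord0 by rewrite tpermD.
  have t1 : t (lift ord0 ord0) = lift ord0 b by rewrite tpermL.
  by rewrite /conjg tpermV !permM t0 t1.
case: (unliftP ord0 i) (unliftP ord0 j) => [a|] -> [b|] ->.
- exact: Hl.
- by rewrite tpermC; exact: H0.
- exact: H0.
- move=> f _; congr iint; apply/funext => g; congr f; apply/funext => l /=.
  by rewrite tperm1 perm1.
Qed.

End iterated_integral.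

(** A cofactor is the determinant of the matrix whose row i is replaced by the j-th basis vector
    ([U]), which absorbs the sign (-1)^(i + j). Permuting rows and columns alike multiplies this
    determinant by the square of a sign. *)
Lemma cofactor_perm (F : comNzRingType) n (A : 'M[F]_n) (s : 'S_n) i j :
  cofactor A (s i) (s j) = cofactor (\matrix_(a, b) A (s a) (s b)) i j.
Proof.
pose U (B : 'M[F]_n) i j :=
  \matrix_(a < n, b < n) if a == i then (b == j)%:R else B a b.
have UE (B : 'M[F]_n) a b : cofactor B a b = \det (U B a b).
  rewrite (expand_det_row _ a) (bigD1 b)//= big1 => [|c cb]; last first.
    by rewrite mxE eqxx (negbTE cb) mul0r.
  rewrite mxE !eqxx mul1r addr0 /cofactor; congr (_ * \det _).
  by apply/matrixP => u v; rewrite !mxE eq_sym (negbTE (neq_lift _ _)).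
rewrite !UE; set B := U A _ _.
have -> : U (\matrix_(a, b) A (s a) (s b)) i j = row_perm s (col_perm s B).
  by apply/matrixP => a b; rewrite !mxE !(inj_eq perm_inj).
rewrite row_permE col_permE !det_mulmx !det_perm odd_permV mulrCA.
by rewrite -signr_addb addbb expr0 mulr1.
Qed.

(** * Fredholm determinants and traces *)

Section fredholm.
Context {R : realType} d (E : measurableType d)
  (mu : {finite_measure set E -> \bar R}) (K : E -> E -> R).
Hypothesis bK : bmeas (fun z : E * E => K z.1 z.2).

Definition kmx k (x y : 'I_k -> E) : 'M[R]_k := \matrix_(i, j) K (x i) (y j).

(** Up to sign and the factor k!, the coefficient of degree k in Fredholm's first minor; [kdet]
    plays this role for the Fredholm determinant itself. *)
Definition fredholm_minor k (x y : E) : R :=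
  iint mu (fun g : 'I_k -> E => \det (kmx (consf x g) (consf y g))).

Definition kdet k : R := iint mu (fun g : 'I_k -> E => \det (kmx g g)).

(* [kiter j] is the (j + 1)-fold iterated kernel; in the notation of the header,
   [ktrace j] is p_(j+1). *)
Fixpoint kiter (j : nat) (x y : E) : R :=
  if j is j'.+1 then \int[mu]_t (K x t * kiter j' t y) else K x y.

Definition ktrace j : R := \int[mu]_x kiter j x x.

Lemma nice_kmx d' (O : measurableType d') k k' (x y : O -> ('I_k -> E) -> 'I_k' -> E) :
  (forall d'' (O' : measurableType d'') (p : O' -> O) (h : O' -> 'I_k -> E),
    measurable_fun setT p -> (forall i, measurable_fun setT (fun o => h o i)) ->
    forall i, measurable_fun setT (fun o => x (p o) (h o) i) /\
              measurable_fun setT (fun o => y (p o) (h o) i)) ->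
  nice (fun o g => \det (kmx (x o g) (y o g))).
Proof.
move=> mxy; apply: nice_det => i j d'' O' p h mp mh.
have [mx _] := mxy _ _ _ _ mp mh i; have [_ my] := mxy _ _ _ _ mp mh j.
rewrite (_ : (fun o => _) = fun o => K (x (p o) (h o) i) (y (p o) (h o) j)).
  by apply: (bmeas_comp bK (h := fun o => (_, _))); exact/measurable_fun_pair.
by apply/funext => o; rewrite mxE.
Qed.

Lemma bmeas_kiter j : bmeas (fun z : E * E => kiter j z.1 z.2).
Proof.
elim: j => [//|j IH] /=.
apply: (bmeas_int_param mu (F := fun w : (E * E) * E => K w.1.1 w.2 * kiter j w.2 w.1.2)).
apply: bmeasM.
  apply: (bmeas_comp bK (h := fun w : (E * E) * E => (w.1.1, w.2))).
  apply/measurable_fun_pair => //.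
  exact: (measurableT_comp measurable_fst measurable_fst).
apply: (bmeas_comp IH (h := fun w : (E * E) * E => (w.2, w.1.2))).
apply/measurable_fun_pair => //.
exact: (measurableT_comp measurable_snd measurable_fst).
Qed.

Lemma bmeas_kiterl j y : bmeas (fun x => kiter j x y).
Proof.
apply: (bmeas_comp (bmeas_kiter j) (h := fun x => (x, y))).
exact: measurable_pair2.
Qed.

Lemma bmeas_kiterr j x : bmeas (kiter j x).
Proof.
apply: (bmeas_comp (bmeas_kiter j) (h := fun y => (x, y))).
exact: measurable_pair1.
Qed.

(* Row 0 of the expansion reads K(x, y) det + sum_j K(x, g_j) cofactor_j; the
   simultaneous exchange of the variables g_0 and g_j turns the j-th term into
   the 0-th one. *)
Lemma det_row0_expand k (x y : E) (g : 'I_k.+1 -> E) :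
  \det (kmx (consf x g) (consf y g)) =
  K x y * \det (kmx g g) -
  \sum_(j < k.+1) K x (g j) *
     \det (kmx (g \o tperm ord0 j)
        (consf y (fun i => (g \o tperm ord0 j) (lift ord0 i)))).
Proof.
rewrite (expand_det_row _ ord0) big_ord_recl /cofactor /=.
rewrite mxE !consf0 expr0 mul1r; congr (_ * \det _ + _).
  by apply/matrixP => i j; rewrite !mxE !consf_lift.
rewrite -sumrN; apply: eq_bigr => j _.
rewrite mxE consf0 consf_lift -mulrN; congr (_ * _).
have tE : lift_fun (tperm ord0 j) =1 tperm (lift ord0 ord0) (lift ord0 j).
  exact: lift_fun_tperm.
pose t := tperm (lift ord0 ord0) (lift ord0 j : 'I_k.+2).
have := cofactor_perm (kmx (consf x g) (consf y g)) t ord0 (lift ord0 ord0).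
rewrite {1}/t tpermD// {1}/t tpermL /cofactor /= => ->.
rewrite (_ : (0 + bump 0 0)%N = 1%N)// expr1 mulN1r; congr (- \det _).
have cE z a : consf z g (t a) = consf z (g \o tperm ord0 j) a.
  rewrite -tE /lift_fun; case: (unliftP ord0 a) => [b|] -> /=.
    by rewrite !consf_lift.
  by rewrite !consf0.
apply/matrixP => a b; rewrite !mxE !cE consf_lift; congr K.
case: (unliftP ord0 b) => [c|] ->; last first.
  by rewrite consf0 (_ : lift _ _ = ord0) ?consf0//; exact/val_inj.
rewrite consf_lift (_ : lift _ _ = lift ord0 (lift ord0 c)) ?consf_lift//.
exact/val_inj.
Qed.

(** Fredholm's recursion. After integration over g the k + 1 terms of [det_row0_expand] agree, since
    [iint] is invariant under exchanging g_0 and g_j; the common value is the integral of [H], with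
    g_0 as the new intermediate point. *)
Lemma fredholm_minorS k x y :
  fredholm_minor k.+1 x y = K x y * kdet k.+1 -
    k.+1%:R * \int[mu]_t (K x t * fredholm_minor k t y).
Proof.
pose H (g : 'I_k.+1 -> E) :=
  K x (g ord0) * \det (kmx g (consf y (fun i => g (lift ord0 i)))).
have nD : nice1 (fun g : 'I_k.+1 -> E => \det (kmx g g)).
  by apply: (nice_kmx (x := fun _ g => g) (y := fun _ g => g)).
have nF : nice (fun (z : E) (g : 'I_k -> E) => \det (kmx (consf z g) (consf y g))).
  apply: (nice_kmx (x := fun z g => consf z g) (y := fun _ g => consf y g)).
  by move=> *; split; apply: measurable_consf => //; exact: measurable_cst.
have HE t (g : 'I_k -> E) :
    H (consf t g) = K x t * \det (kmx (consf t g) (consf y g)).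
  rewrite /H consf0; congr (_ * \det (kmx _ (consf _ _))).
  by apply/funext => i; rewrite consf_lift.
have nH : nice1 H.
  move=> d'' O' p h mp mh; apply: bmeasM.
    apply: (bmeas_comp (bmeas_kiterr 0 x) (h := fun o => h o ord0)).
    exact: mh.
  apply: (@nice_kmx _ unit k.+1 k.+1 (fun _ g => g)
    (fun _ g => consf y (fun i => g (lift ord0 i))) _ _ _ p h) => //.
  move=> d3 O3 q h' mq mh' i; split; first exact: mh'.
  by apply: measurable_consf => //; exact: measurable_cst.
transitivity (iint mu (fun g : 'I_k.+1 -> E => K x y * \det (kmx g g) +
   (-1) * \sum_(j < k.+1) H (g \o tperm ord0 j))).
  congr iint; apply/funext => g; rewrite det_row0_expand mulN1r; congr (_ - _).
  by apply: eq_bigr => j _; rewrite /H /= tpermL.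
have nHt j : nice1 (fun g => H (g \o tperm ord0 j)) := nice1_comp _ nH.
have nS : nice1 (fun g => \sum_(j < k.+1) H (g \o tperm ord0 j)).
  move=> d'' O' p h mp mh; apply: bmeas_sum => j; exact: (nHt j _ _ p h).
rewrite iintD; [|exact: nice1Z|exact: nice1Z].
rewrite (iintZ _ _ nD) (iintZ _ _ nS) mulN1r (iint_sum _ _ nHt); congr (_ - _).
under eq_bigr => j _ do rewrite (iint_inv_tperm _ ord0 j nH).
rewrite sumr_const card_ord -[LHS]mulr_natl; congr (_ * _) => /=.
apply: eq_Rintegral => t _; rewrite -iintZ; last exact: nice_nice1 nF.
by congr iint; apply/funext => g; rewrite HE.
Qed.

(** The e_k of the header, before any random variable is involved: formally the k-th elementary
    symmetric function of the eigenvalues of K. *)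
Definition kdetf k : R := kdet k / k`!%:R.

(** The recursion unrolled: each step trades one integration variable of the minor for one more
    composition with K. *)
Lemma fredholm_minor_kiter k x y : fredholm_minor k x y =
  k`!%:R * \sum_(j < k.+1) (-1) ^+ j * kdetf (k - j) * kiter j x y.
Proof.
elim: k => [|k IH] in x y *.
  rewrite big_ord1 /= /kdetf /kdet /fredholm_minor /= det_mx00 divr1 !mul1r.
  by rewrite det_mx11 mxE !consf0.
rewrite fredholm_minorS big_ord_recl mulrDr; congr (_ + _).
  rewrite expr0 mul1r subn0 /kdetf mulrA mulrCA divff ?mulr1 1?mulrC//.
rewrite factS natrM -!mulrA -mulrN; congr (_ * _).
transitivity (- \int[mu]_t (k`!%:R * \sum_(j < k.+1)
    ((-1) ^+ j * kdetf (k - j)) * (K x t * kiter j t y))).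
  congr (- _); apply: eq_Rintegral => t _; rewrite IH mulrCA; congr (_ * _).
  by rewrite mulr_sumr; apply: eq_bigr => j _; rewrite mulrCA.
have bT j : bmeas (fun t => K x t * kiter j t y).
  apply: bmeasM; [exact: (bmeas_kiterr 0)|exact: bmeas_kiterl].
have bT' j : bmeas (fun t => (-1) ^+ j * kdetf (k - j) * (K x t * kiter j t y)).
  exact: bmeasZ.
rewrite bmeas_intZ; last by apply: bmeas_sum => j; exact: bT'.
rewrite bmeas_int_sum; last by move=> j; exact: bT'.
rewrite -mulrN -sumrN; congr (_ * _); apply: eq_bigr => j _.
by rewrite bmeas_intZ// lift0 subSS exprS !mulN1r !mulNr.
Qed.

(** On the diagonal x = y the minor of order k integrates to [kdet k.+1], so integrating the
    previous formula gives Newton's identities with the traces as power sums. *)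
Lemma kdetf_newton k :
  k.+1%:R * kdetf k.+1 = \sum_(j < k.+1) (-1) ^+ j * kdetf (k - j) * ktrace j.
Proof.
have kfN0 n : n`!%:R != 0 :> R by rewrite pnatr_eq0 -lt0n fact_gt0.
have bT j : bmeas (fun x => kiter j x x).
  apply: (bmeas_comp (bmeas_kiter j) (h := fun x => (x, x))).
  exact/measurable_fun_pair.
have bT' j : bmeas (fun t => (-1) ^+ j * kdetf (k - j) * kiter j t t).
  exact: bmeasZ.
transitivity (kdet k.+1 / k`!%:R).
  by rewrite /kdetf factS natrM invfM mulrCA mulVKf ?pnatr_eq0.
apply: (canLR (mulfK (kfN0 k))); rewrite mulrC.
transitivity (\int[mu]_x fredholm_minor k x x) => //.
under eq_Rintegral => x _ do rewrite fredholm_minor_kiter.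
rewrite bmeas_intZ; last by apply: bmeas_sum => j; exact: bT'.
rewrite bmeas_int_sum; last by move=> j; exact: bT'.
by congr (_ * _); apply: eq_bigr => j _; rewrite bmeas_intZ.
Qed.

(** Associativity of kernel composition, by Fubini. Since [kiter j] has j + 1 factors, the index of
    the composition is i + j + 1. *)
Lemma kiter_comp i j x y :
  kiter (i + j).+1 x y = \int[mu]_t (kiter i x t * kiter j t y).
Proof.
elim: i => [//|i IH] in x *.
rewrite addSn -[LHS]/(\int[mu]_t (K x t * kiter (i + j).+1 t y)).
under eq_Rintegral => t _ do rewrite IH.
have bi t : bmeas (fun s => kiter i t s * kiter j s y).
  apply: bmeasM; [exact: bmeas_kiterr|exact: bmeas_kiterl].
under eq_Rintegral => t _ do rewrite -(bmeas_intZ _ _ (bi t)).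
pose F (z : E * E) := K x z.1 * (kiter i z.1 z.2 * kiter j z.2 y).
rewrite (@bmeas_fubini _ _ _ _ _ mu mu F); last first.
  apply: bmeasM.
    exact: (bmeas_comp (bmeas_kiterr 0 x) measurable_fst).
  apply: bmeasM; first exact: bmeas_kiter.
  exact: (bmeas_comp (bmeas_kiterl j y) measurable_snd).
apply: eq_Rintegral => s _ /=.
rewrite mulrC -bmeas_intZ; last first.
  apply: bmeasM; [exact: (bmeas_kiterr 0)|exact: bmeas_kiterl].
by apply: eq_Rintegral => t _; rewrite /F/= mulrA mulrC.
Qed.

Hypothesis K_sym : forall x y, K x y = K y x.

Lemma kiter_sym j x y : kiter j x y = kiter j y x.
Proof.
elim: j => [|j IH] in x y *; first exact: K_sym.
have := kiter_comp j 0 y x; rewrite addn0 => ->.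
by apply: eq_Rintegral => t _; rewrite IH K_sym mulrC.
Qed.

Lemma bmeas_kiterM i j :
  bmeas (fun z : E * E => kiter i z.1 z.2 * kiter j z.1 z.2).
Proof. by apply: bmeasM; exact: bmeas_kiter. Qed.

(** By symmetry, the trace of a product of powers of K is a Hilbert-Schmidt inner product;
    positivity, Cauchy-Schwarz and submultiplicativity of the traces rest on this. *)
Lemma ktrace_comp i j :
  ktrace (i + j).+1 = \int[mu]_x \int[mu]_t (kiter i x t * kiter j x t).
Proof.
apply: eq_Rintegral => x _; rewrite kiter_comp; apply: eq_Rintegral => t _.
by rewrite (kiter_sym j).
Qed.

Lemma ktrace_ge0 i : 0 <= ktrace (i + i).+1.
Proof.
by rewrite ktrace_comp; do 2 apply: Rintegral_ge0 => ? _; exact: sqr_ge0.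
Qed.

Lemma discriminant_le (A B C : R) : 0 <= A -> 0 <= C ->
  (forall t, 0 <= t ^+ 2 * A - 2 * t * B + C) -> B ^+ 2 <= A * C.
Proof.
move=> A0 C0 H; have [A_eq0|An0] := eqVneq A 0.
  have [->|Bn0] := eqVneq B 0; first by rewrite expr0n mulr_ge0.
  (* With A = 0 this t makes the quadratic equal to -1. *)
  have := H ((C + 1) / (2 * B)); rewrite A_eq0 mulr0 add0r.
  rewrite (_ : _ * _ * B = C + 1); first by lra.
  by field.
have Ap : 0 < A by rewrite lt_neqAle eq_sym An0.
have := H (B / A); rewrite (_ : _ + C = (A * C - B ^+ 2) / A); last by field.
by rewrite pmulr_lge0 ?invr_gt0// subr_ge0.
Qed.

Lemma bmeas_int2_ge0 d' (F : measurableType d') (m : {finite_measure set F -> \bar R})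
  (f : F -> R) : 0 <= \int[m]_x (f x) ^+ 2.
Proof. by apply: Rintegral_ge0 => x _; exact: sqr_ge0. Qed.

Lemma bmeas_cauchy_schwarz (f g : E -> R) : bmeas f -> bmeas g ->
  (\int[mu]_x (f x * g x)) ^+ 2 <=
  (\int[mu]_x (f x) ^+ 2) * \int[mu]_x (g x) ^+ 2.
Proof.
move=> bf bg; apply: discriminant_le; do ?exact: bmeas_int2_ge0.
have bff : bmeas (fun x => f x ^+ 2) by exact: bmeasM.
have bgg : bmeas (fun x => g x ^+ 2) by exact: bmeasM.
have bfg : bmeas (fun x => f x * g x) by exact: bmeasM.
move=> t; rewrite -bmeas_intZ// -bmeas_intZ//.
rewrite -bmeas_intB; [|exact: bmeasZ|exact: bmeasZ].
rewrite -bmeas_intD//; last by apply: bmeasB; exact: bmeasZ.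
apply: Rintegral_ge0 => x _.
by rewrite (_ : _ + _ = (t * f x - g x) ^+ 2) ?sqr_ge0//; ring.
Qed.

Lemma ktrace_cauchy_schwarz i j :
  ktrace (i + j).+1 ^+ 2 <= ktrace (i + i).+1 * ktrace (j + j).+1.
Proof.
pose I (F : E -> E -> R) := \int[mu]_x \int[mu]_t F x t.
have Ige (F : E -> E -> R) : (forall x y, 0 <= F x y) -> 0 <= I F.
  by move=> F0; do 2 apply: Rintegral_ge0 => ? _.
have bint (F : E -> E -> R) : bmeas (fun z : E * E => F z.1 z.2) -> bmeas (fun x => \int[mu]_t F x t).
  by move=> bF; exact: (bmeas_int_param mu (F := fun z => F z.1 z.2)).
have bsec (F : E -> E -> R) x : bmeas (fun z : E * E => F z.1 z.2) -> bmeas (F x).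
  move=> bF; apply: (bmeas_comp bF (h := fun y => (x, y))).
  exact: measurable_pair1.
rewrite !ktrace_comp; apply: discriminant_le.
- by apply: Ige => x y; exact: sqr_ge0.
- by apply: Ige => x y; exact: sqr_ge0.
move=> t; have bM := bmeas_kiterM.
have bZ c a b : bmeas (fun z : E * E => c * (kiter a z.1 z.2 * kiter b z.1 z.2)).
  exact: bmeasZ.
have IZ c a b : c * I (fun x y => kiter a x y * kiter b x y) =
    I (fun x y => c * (kiter a x y * kiter b x y)).
  rewrite /I -bmeas_intZ; last first.
    exact: (bint (fun x y => kiter a x y * kiter b x y)).
  apply: eq_Rintegral => x _; rewrite bmeas_intZ//.
  exact: (bsec (fun x y => kiter a x y * kiter b x y)).
have ID (F G : E -> E -> R) : bmeas (fun z : E * E => F z.1 z.2) ->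
    bmeas (fun z : E * E => G z.1 z.2) -> I F + I G = I (fun x y => F x y + G x y).
  move=> bF bG; rewrite /I -bmeas_intD; [|exact: bint|exact: bint].
  by apply: eq_Rintegral => x _; rewrite bmeas_intD//; exact: bsec.
rewrite -!/(I _) -mulNr !IZ ID// ID//; last exact: bmeasD.
apply: Ige => x y.
rewrite (_ : _ + _ = (t * kiter i x y - kiter j x y) ^+ 2) ?sqr_ge0//; ring.
Qed.

(** The square of ||S T|| <= ||S|| ||T|| for the Hilbert-Schmidt norm, S and T being powers of K:
    Cauchy-Schwarz in the intermediate variable at each (x, y), then integration. *)
Lemma ktrace_submul i j :
  ktrace ((i + j).+1 + (i + j).+1).+1 <= ktrace (i + i).+1 * ktrace (j + j).+1.
Proof.
have bk2 a x : bmeas (fun t => kiter a x t ^+ 2).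
  by apply: bmeasM; exact: bmeas_kiterr.
have bi a : bmeas (fun x => \int[mu]_t kiter a x t ^+ 2).
  exact: (bmeas_int_param mu (F := fun z => kiter a z.1 z.2 ^+ 2) (bmeas_kiterM a a)).
rewrite !ktrace_comp.
have sq a x : \int[mu]_t (kiter a x t * kiter a x t) = \int[mu]_t kiter a x t ^+ 2 by [].
under eq_Rintegral => x _ do rewrite sq.
under [X in _ <= X * _]eq_Rintegral => x _ do rewrite sq.
under [X in _ <= _ * X]eq_Rintegral => x _ do rewrite sq.
rewrite mulrC -bmeas_intZ//; apply: le_Rintegral => //.
- by apply: bmeas_integrable; exact: bi.
- by apply: bmeas_integrable; exact: bmeasZ.
move=> x _; rewrite mulrC -bmeas_intZ//; apply: le_Rintegral => //.
- by apply: bmeas_integrable; exact: bk2.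
- by apply: bmeas_integrable; exact: bmeasZ.
move=> y _; rewrite kiter_comp.
apply: le_trans (bmeas_cauchy_schwarz (bmeas_kiterr _ _) (bmeas_kiterl _ _)) _.
rewrite le_eqVlt; apply/orP; left; apply/eqP; congr (_ * _).
by apply: eq_Rintegral => t _; rewrite kiter_sym.
Qed.

End fredholm.

(** * The Stein identity *)

Section forward_difference.
Context {R : realType}.
Implicit Types h : nat -> R.

Definition fdiff h n : R := h n.+1 - h n.

Lemma newton_forward h n :
  h n = \sum_(k < n.+1) iter k fdiff h 0 * 'C(n, k)%:R.
Proof.
elim: n h => [|n IH] h; first by rewrite big_ord1 bin0 mulr1.
have -> : h n.+1 = h n + fdiff h n by rewrite /fdiff addrC subrK.
rewrite (IH h) (IH (fdiff h)).
have -> : \sum_(k < n.+1) iter k fdiff h 0 * 'C(n, k)%:R =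
    h 0 + \sum_(k < n.+1) iter k.+1 fdiff h 0 * 'C(n, k.+1)%:R.
  transitivity (\sum_(k < n.+2) iter k fdiff h 0 * 'C(n, k)%:R).
    by rewrite [RHS]big_ord_recr/= bin_small ?mulr0 ?addr0.
  by rewrite big_ord_recl bin0 mulr1.
rewrite -addrA -big_split [RHS]big_ord_recl bin0 mulr1; congr (_ + _).
by apply: eq_bigr => k _; rewrite -iterSr lift0 binS natrD mulrDr.
Qed.

Lemma iter_fdiff_exp (z : R) k n :
  iter k fdiff (fun n => (1 + z) ^+ n) n = z ^+ k * (1 + z) ^+ n.
Proof.
elim: k n => [|k IH] n; first by rewrite mul1r.
by rewrite iterS /fdiff !IH !exprS; ring.
Qed.

(** Around the midpoint u, one difference is cos (u + s/2) - cos (u - s/2) = 2 sin (s/2) cos (u +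
    pi/2): the amplitude gains a factor and the phase moves by (s + pi) / 2. This yields the decay
    at rate |s| that the Stein identity asks for. *)
Lemma iter_fdiff_cos (s b : R) k n :
  iter k fdiff (fun n => cos (s * n%:R + b)) n =
  (2 * sin (s / 2)) ^+ k * cos (s * n%:R + b + k%:R * ((s + pi) / 2)).
Proof.
elim: k n => [|k IH] n; first by rewrite mul1r mul0r addr0.
rewrite iterS /fdiff !IH exprSr -mulrBr -mulrA; congr (_ * _).
set t := k%:R * _.
pose u := s * n%:R + b + t + s / 2.
rewrite (_ : s * n.+1%:R + b + t = u + s / 2); last first.
  by rewrite /u -natr1; field.
rewrite (_ : s * n%:R + b + t = u - s / 2); last by rewrite /u; ring.
rewrite (_ : _ + k.+1%:R * _ = u + pi / 2); last first.
  by rewrite /u /t -natr1; field.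
rewrite cosB !cosD sin_pihalf cos_pihalf; ring.
Qed.

Lemma derive_bound (f f' : R -> R) (a b M : R) :
  (forall x : R, is_derive x (1 : R) f (f' x)) ->
  (forall x, Num.min a b <= x <= Num.max a b -> `|f' x| <= M) ->
  `|f b - f a| <= M * `|b - a|.
Proof.
move=> df.
have key (u v : R) : u <= v -> (forall x, u <= x <= v -> `|f' x| <= M) ->
    `|f v - f u| <= M * `|v - u|.
  move=> uv f'M.
  have cf : {within `[u, v], continuous f}.
    apply: derivable_within_continuous => x _; exact: ex_derive.
  have [c] := MVT_segment uv (fun x _ => df x) cf.
  rewrite in_itv/= => cuv ->.
  by rewrite normrM ler_wpM2r// f'M.
case: (leP a b) => [|/ltW]; first exact: key.
by rewrite (distrC (f b)) (distrC b); exact: key.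
Qed.

Lemma sin_lipschitz (a b : R) : `|sin b - sin a| <= `|b - a|.
Proof.
rewrite -[leRHS]mul1r; apply: (derive_bound (f' := cos)) => x.
by move=> _; rewrite ler_norml cos_geN1 cos_le1.
Qed.

Lemma cos_lipschitz (a b : R) : `|cos b - cos a| <= `|b - a|.
Proof.
rewrite -[leRHS]mul1r; apply: (derive_bound (f' := fun x => - sin x)) => x.
by move=> _; rewrite normrN ler_norml sin_geN1 sin_le1.
Qed.

Lemma sin_taylor (a h : R) : `|sin (a + h) - sin a - h * cos a| <= h ^+ 2.
Proof.
pose f x := sin (a + x) - x * cos a.
have -> : sin (a + h) - sin a - h * cos a = f h - f 0 by rewrite /f addr0; ring.
have -> : h ^+ 2 = `|h| * `|h - 0| by rewrite subr0 -expr2 real_normK ?num_real.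
apply: (derive_bound (f' := fun x => cos (a + x) - cos a)) => x.
  rewrite /f; apply: is_derive_eq.
  by rewrite add0r mulr1 scaler0 add0r; congr (_ - _); exact: mulr1.
move=> xh; apply: le_trans (cos_lipschitz _ _) _.
rewrite addrAC subrr add0r; move: xh; rewrite ge_min le_max.
by case: (ger0P h); case: (ger0P x); lra.
Qed.

Lemma sin_abs_le (x : R) : `|sin x| <= `|x|.
Proof. by have := sin_lipschitz 0 x; rewrite sin0 !subr0. Qed.

Lemma iter_fdiff_cos_le (s b : R) k n :
  `|iter k fdiff (fun n => cos (s * n%:R + b)) n| <= `|s| ^+ k.
Proof.
rewrite iter_fdiff_cos normrM normrX -[leRHS]mulr1.
apply: ler_pM => //; last by rewrite ler_norml cos_geN1 cos_le1.
apply: lerXn2r; rewrite ?nnegrE// normrM (ger0_norm (ler0n _ 2)).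
have := sin_abs_le (s / 2); rewrite normrM normfV (ger0_norm (ler0n _ 2)); lra.
Qed.

End forward_difference.

(** * Expectations of functions of a counting variable *)

Section counting_variable.
Context {R : realType} d (T : measurableType d) (P : probability T R)
  (N : T -> nat).
Hypothesis mN : forall n, measurable [set w | N w = n].

Lemma measurable_natcomp (f : nat -> R) : measurable_fun setT (fun w => f (N w)).
Proof.
move=> _ A mA; rewrite setTI.
rewrite (_ : _ @^-1` _ = \bigcup_(n in [set n | A (f n)]) [set w | N w = n]).
  by apply: bigcup_measurable.
by apply/seteqP; split=> w /=; [move=> Aw; exists (N w)|case=> n /= An ->].
Qed.

Definition nint (f : nat -> R) := P.-integrable setT (fun w => (f (N w))%:E).
Definition nexp (f : nat -> R) : R := \int[P]_w f (N w).

Lemma nint_le (f g : nat -> R) : (forall n, `|f n| <= g n) -> nint g -> nint f.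
Proof.
move=> fg; apply: le_integrable => //.
  by apply/measurable_EFinP; exact: measurable_natcomp.
by move=> w _; rewrite /= lee_fin (le_trans (fg _))// ler_norm.
Qed.

Lemma nint_cst c : nint (fun _ => c).
Proof. exact: finite_measure_integrable_cst. Qed.

Lemma nintD (f g : nat -> R) : nint f -> nint g -> nint (fun n => f n + g n).
Proof. by move=> nf ng; have := integrableD measurableT nf ng. Qed.

Lemma nintZ c (f : nat -> R) : nint f -> nint (fun n => c * f n).
Proof. by move=> nf; have := integrableZl measurableT c nf. Qed.

Lemma nint_sum (I : Type) (r : seq I) (f : I -> nat -> R) :
  (forall i, nint (f i)) -> nint (fun n => \sum_(i <- r) f i n).
Proof.
move=> nf; elim: r => [|a r IH].
  by under [fun _ => _]eq_fun do rewrite big_nil; exact: nint_cst.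
by under [fun _ => _]eq_fun do rewrite big_cons; exact: nintD.
Qed.

Lemma nexpD (f g : nat -> R) : nint f -> nint g ->
  nexp (fun n => f n + g n) = nexp f + nexp g.
Proof. by move=> nf ng; rewrite /nexp RintegralD. Qed.

Lemma nexpZ c (f : nat -> R) : nint f -> nexp (fun n => c * f n) = c * nexp f.
Proof. by move=> nf; rewrite /nexp RintegralZl. Qed.

Lemma nexpB (f g : nat -> R) : nint f -> nint g ->
  nexp (fun n => f n - g n) = nexp f - nexp g.
Proof. by move=> nf ng; rewrite /nexp RintegralB. Qed.

Lemma nexp_cst c : nexp (fun _ => c) = c.
Proof. rewrite /nexp Rintegral_cst//.
by rewrite -[RHS]mulr1; congr (_ * _); exact: (congr1 fine (probability_setT P)). Qed.

Lemma nexp_sum (I : Type) (r : seq I) (f : I -> nat -> R) :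
  (forall i, nint (f i)) ->
  nexp (fun n => \sum_(i <- r) f i n) = \sum_(i <- r) nexp (f i).
Proof.
move=> nf; elim: r => [|a r IH].
  rewrite big_nil -[RHS](nexp_cst 0); congr nexp.
  by apply/funext => n; rewrite big_nil.
rewrite big_cons -IH -nexpD//; last exact: nint_sum.
by congr nexp; apply/funext => n; rewrite big_cons.
Qed.

Lemma le_nexp (f g : nat -> R) : nint f -> nint g -> (forall n, f n <= g n) ->
  nexp f <= nexp g.
Proof. by move=> nf ng fg; apply: le_Rintegral => // w _; exact: fg. Qed.

Lemma nexp_ge0 (f : nat -> R) : (forall n, 0 <= f n) -> 0 <= nexp f.
Proof. by move=> f0; apply: Rintegral_ge0. Qed.

Lemma nexp_norm_le (f : nat -> R) (g : nat -> R) : nint g ->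
  (forall n, `|f n| <= g n) -> `|nexp f| <= nexp g.
Proof.
move=> ng fg; have nf := nint_le fg ng.
apply: le_trans (le_normr_Rintegral _ _) _ => //.
apply: (le_nexp (f := fun n => `|f n|)) => //; apply: nint_le ng => n.
by rewrite normr_id.
Qed.

Lemma nexp_gt0 (f : nat -> R) : nint f -> (forall n, 0 < f n) -> 0 < nexp f.
Proof.
move=> nf f0; rewrite lt_neqAle eq_sym nexp_ge0 ?andbT; last first.
  by move=> n; exact: ltW.
apply/negP => /eqP E0.
have I0 : (\int[P]_w `|(f (N w))%:E| = 0)%E.
  rewrite -[RHS]/(0%:E) -E0 /nexp fineK ?integrable_fin_num//.
  by apply: eq_integral => w _; rewrite /= gtr0_norm.
have mf : measurable_fun setT (fun w => (f (N w))%:E).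
  by apply/measurable_EFinP; exact: measurable_natcomp.
have [A [mA A0 sA]] := (ae_eq_integral_abs P measurableT mf).1 I0.
have : (P setT <= P A)%E.
  apply: le_measure; rewrite ?inE// => w _; apply: sA => /= /(_ I) [/eqP].
  by rewrite gt_eqF.
by rewrite probability_setT A0 lee_fin ler10.
Qed.

(** Monotone convergence for truncations that are exact as soon as K exceeds n, as partial sums of
    binomial expansions are. *)
Lemma nint_mono (F : nat -> nat -> R) (f : nat -> R) B :
  (forall K n, 0 <= F K n) -> (forall n, nondecreasing_seq (F^~ n)) ->
  (forall n K, (n < K)%N -> F K n = f n) -> (forall K, nint (F K)) ->
  (forall K, nexp (F K) <= B) -> nint f.
Proof.
move=> F0 ndF Ff nF FB.
have f0 n : 0 <= f n by rewrite -(Ff n n.+1).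
have mf : measurable_fun setT (fun w => (f (N w))%:E).
  by apply/measurable_EFinP; exact: measurable_natcomp.
apply/integrableP; split => //.
rewrite (eq_integral (fun w => (f (N w))%:E)); last first.
  by move=> w _; rewrite gee0_abs ?lee_fin.
have Flim w : limn (fun K => (F K (N w))%:E) = (f (N w))%:E.
  apply: lim_near_cst => //; exists (N w).+1 => // K /= NK.
  by rewrite Ff.
have := @cvg_monotone_convergence _ _ _ P setT measurableT
  (fun K w => (F K (N w))%:E).
under eq_integral => w _ do rewrite Flim.
move=> cv; apply: (@le_lt_trans _ _ B%:E); last exact: ltry.
apply: (cvge_le _ (cv _ _ _)); last first.
- by move=> w _ K K' KK'; rewrite lee_fin; exact: ndF.
- by move=> K w _; rewrite lee_fin.
- by move=> K; apply/measurable_EFinP; exact: measurable_natcomp.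
apply: nearW => K.
rewrite -(fineK (integrable_fin_num measurableT (nF K))) lee_fin.
exact: FB.
Qed.

End counting_variable.

Section newton_sums.
Context {R : realType}.

Lemma cvg_of_dist_le (u v : nat -> R) (l : R) : (forall n, `|u n - l| <= v n) ->
  v @ \oo --> (0 : R) -> u @ \oo --> l.
Proof.
move=> uv /cvgrPdist_le v0; apply/cvgrPdist_le => eps eps0.
have := v0 _ eps0; apply: filterS => n; rewrite sub0r normrN distrC => vn.
exact: le_trans (uv n) (le_trans (ler_norm _) vn).
Qed.

Lemma le_of_eq (x y : R) : x = y -> x <= y.
Proof. by move->. Qed.

Lemma cvg_divr (u : nat -> R) (F G : R) : F != 0 ->
  u n * F @[n --> \oo] --> G -> u n @[n --> \oo] --> G / F.
Proof.
move=> F0 uF; have -> : u = (fun n => u n * F * F^-1).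
  by apply/funext => n /=; rewrite mulfK.
exact: cvgM uF (cvg_cst F^-1).
Qed.

Lemma sum_triangle (F : nat -> nat -> R) K :
  \sum_(k < K) \sum_(j < k.+1) F j (k - j)%N =
  \sum_(j < K) \sum_(l < K - j) F j l.
Proof.
elim: K => [|K IH]; first by rewrite !big_ord0.
rewrite big_ord_recr IH [RHS]big_ord_recr/= subSnn big_ord1.
rewrite [X in _ + X]big_ord_recr/= subnn addrA; congr (_ + _).
rewrite -big_split; apply: eq_bigr => j _ /=.
by rewrite subSn 1?ltnW// big_ord_recr.
Qed.

Lemma geometric_sum_le (x : R) K : 0 <= x < 1 -> \sum_(j < K) x ^+ j <= (1 - x)^-1.
Proof.
move=> /andP[x0 x1]; have x1' : 0 < 1 - x by rewrite subr_gt0.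
rewrite -[leRHS]mul1r ler_pdivlMr// mulrC -opprB mulNr -subrX1 opprB.
by rewrite gerBl exprn_ge0.
Qed.

(** Markov's inequality for the weights a_k: a mean index at most B leaves at most half of the mass
    on k >= 2 B, so the total is at most twice the mass of a fixed initial block. *)
Lemma sum_bounded_of_moment (a : nat -> R) (B : R) : 0 < B -> (forall k, 0 <= a k) ->
  (forall K, \sum_(k < K) k%:R * a k <= B * \sum_(k < K) a k) ->
  exists C, forall K, \sum_(k < K) a k <= C.
Proof.
move=> B0 a0 aB.
pose k0 := (Num.truncn (2 * B)).+1.
have k0B : 2 * B <= k0%:R by rewrite ltW// truncnS_gt.
pose S K := \sum_(k < K) a k; pose U K := \sum_(k < K) k%:R * a k.
have SS K : S K.+1 = S K + a K by rewrite /S big_ord_recr.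
have US K : U K.+1 = U K + K%:R * a K by rewrite /U big_ord_recr.
clearbody k0.
have S_nd : {homo S : m n / (m <= n)%N >-> m <= n}.
  by apply/nondecreasing_seqP => K; rewrite SS lerDl.
have S0 : 0 <= S k0 by rewrite sumr_ge0.
exists (2 * S k0) => K; rewrite -/(S K).
have [/S_nd|/ltnW kK] := leqP K k0; first lra.
have : 2 * B * (S K - S k0) <= U K - U k0.
  rewrite -(subnKC kK); elim: (K - k0)%N => [|m IH].
    by rewrite addn0 !subrr mulr0.
  rewrite addnS SS US.
  have : 2 * B * a (k0 + m)%N <= (k0 + m)%:R * a (k0 + m)%N.
    by rewrite ler_wpM2r// (le_trans k0B)// ler_nat leq_addr.
  by lra.
have U0 : 0 <= U k0 by apply: sumr_ge0 => i _; rewrite mulr_ge0.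
have UK : U K <= B * S K := aB K.
move=> H; have : B * S K <= B * (2 * S k0) by lra.
by rewrite ler_pM2l.
Qed.

End newton_sums.

Section stein.
Context {R : realType} d (T : measurableType d) (P : probability T R)
  (N : T -> nat).
Hypothesis mN : forall n, measurable [set w | N w = n].
Variables (e p : nat -> R).
Hypothesis iC : forall k, nint P N (fun n => 'C(n, k)%:R).
Hypothesis eC : forall k, nexp P N (fun n => 'C(n, k)%:R) = e k.
Hypothesis newton : forall k,
  k.+1%:R * e k.+1 = \sum_(j < k.+1) (-1) ^+ j * e (k - j)%N * p j.

Local Notation nint := (nint P N).
Local Notation nexp := (nexp P N).

Lemma e_ge0 k : 0 <= e k.
Proof. by rewrite -eC; exact: nexp_ge0. Qed.

Lemma sum_bin_widen (c : nat -> R) n K : (n < K)%N ->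
  \sum_(k < K) c k * 'C(n, k)%:R = \sum_(k < n.+1) c k * 'C(n, k)%:R.
Proof.
move=> nK; rewrite (big_ord_widen K (fun k => c k * 'C(n, k)%:R) nK).
rewrite [RHS]big_mkcond; apply: eq_bigr => k _; case: ifPn => //.
by rewrite -leqNgt => /bin_small ->; rewrite mulr0.
Qed.

Lemma exp_sum_bin (z : R) n : (1 + z) ^+ n = \sum_(k < n.+1) z ^+ k * 'C(n, k)%:R.
Proof.
rewrite (newton_forward (fun n => (1 + z) ^+ n)); apply: eq_bigr => k _.
by rewrite iter_fdiff_exp expr0 mulr1.
Qed.

Lemma nint_sum_bin (c : nat -> R) K : nint (fun n => \sum_(k < K) c k * 'C(n, k)%:R).
Proof. by apply: nint_sum => k; exact: nintZ. Qed.

Lemma nexp_sum_bin (c : nat -> R) K :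
  nexp (fun n => \sum_(k < K) c k * 'C(n, k)%:R) = \sum_(k < K) c k * e k.
Proof.
rewrite nexp_sum; last by move=> k; exact: nintZ.
by apply: eq_bigr => k _; rewrite nexpZ// eC.
Qed.

(** With a_k = t^k e_k, Newton's identities and the geometric bound on p give sum k a_k <= (M t / (1
    - r t)) sum a_k, which bounds sum a_k. This sum is E (1 + t)^N expanded in factorial moments. *)
Lemma nint_exp (t M r : R) : 0 < t -> 0 <= r -> 0 < M -> r * t < 1 ->
  (forall j, `|p j| <= M * r ^+ j) -> nint (fun n => (1 + t) ^+ n).
Proof.
move=> t0 r0 M0 rt1 pM.
have rt0 : 0 <= r * t by rewrite mulr_ge0// ltW.
have B0 : 0 < M * t / (1 - r * t) by rewrite divr_gt0 ?mulr_gt0// subr_gt0.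
pose a k := t ^+ k * e k.
have a0 k : 0 <= a k by rewrite mulr_ge0 ?e_ge0// exprn_ge0// ltW.
have [|C aC] := sum_bounded_of_moment B0 a0.
  case=> [|K]; first by rewrite !big_ord0 mulr0.
  rewrite big_ord_recl mul0r add0r.
  apply: (@le_trans _ _ (M * t * \sum_(k < K) \sum_(j < k.+1) (r * t) ^+ j * a (k - j)%N)).
    rewrite mulr_sumr; apply: ler_sum => k _; rewrite lift0 /a mulrCA newton.
    rewrite !mulr_sumr; apply: ler_sum => j _.
    have jk : (j <= k)%N by rewrite -ltnS.
    have H : (-1) ^+ j * e (k - j)%N * p j <= M * r ^+ j * e (k - j)%N.
      apply: le_trans (ler_norm _) _.
      by rewrite -mulrA normrMsign normrM (ger0_norm (e_ge0 _)) mulrC ler_wpM2r ?e_ge0.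
    have tE : t ^+ k.+1 = t * (t ^+ j * t ^+ (k - j)).
      by rewrite -exprD subnKC// exprS.
    apply: le_trans (ler_wpM2l (exprn_ge0 k.+1 (ltW t0)) H) _.
    by apply: le_of_eq; rewrite tE exprMn; ring.
  rewrite -[leRHS]mulrA (ler_pM2l (mulr_gt0 M0 t0)).
  rewrite (sum_triangle (fun j l => (r * t) ^+ j * a l)).
  apply: (@le_trans _ _ (\sum_(j < K) (r * t) ^+ j * \sum_(k < K.+1) a k)).
    apply: ler_sum => j _; rewrite -mulr_sumr ler_wpM2l ?exprn_ge0//.
    have jK : (K - j <= K.+1)%N by rewrite (leq_trans (leq_subr _ _)).
    rewrite (big_ord_widen _ a jK) [leRHS](bigID (fun k : 'I_K.+1 => (k < K - j)%N))/=.
    by rewrite lerDl sumr_ge0.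
  rewrite -mulr_suml ler_wpM2r ?sumr_ge0// geometric_sum_le// rt0 rt1//.
apply: (nint_mono mN (F := fun K n => \sum_(k < K) t ^+ k * 'C(n, k)%:R) (B := C)).
- by move=> K n; apply: sumr_ge0 => k _; rewrite mulr_ge0// exprn_ge0// ltW.
- move=> n; apply/nondecreasing_seqP => K; rewrite big_ord_recr/= lerDl.
  by rewrite mulr_ge0// exprn_ge0// ltW.
- by move=> n K nK; rewrite sum_bin_widen// exp_sum_bin.
- by move=> K; exact: nint_sum_bin.
- by move=> K; rewrite nexp_sum_bin.
Qed.

(** Termwise integration of a Newton series: for k >= L, w^k <= (w / t)^L t^k, so the tail is
    dominated by (w / t)^L (1 + t)^n. The case L = 0 gives integrability. *)
Lemma nexp_trunc (c : nat -> R) (A w t : R) L : 0 < w -> w <= t ->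
  (forall k, `|c k| <= A * w ^+ k) -> nint (fun n => (1 + t) ^+ n) ->
  nint (fun n => \sum_(k < n.+1) c k * 'C(n, k)%:R) /\
  `|nexp (fun n => \sum_(k < n.+1) c k * 'C(n, k)%:R) - \sum_(k < L) c k * e k| <=
    A * (w / t) ^+ L * nexp (fun n => (1 + t) ^+ n).
Proof.
move=> w0 wt cA it; have t0 : 0 < t by exact: lt_le_trans wt.
have A0 : 0 <= A by have := cA 0; rewrite expr0 mulr1; exact: le_trans.
have w0' := ltW w0; have t0' := ltW t0.
have key L' n : `|\sum_(k < n.+1) c k * 'C(n, k)%:R - \sum_(k < L') c k * 'C(n, k)%:R|
    <= A * (w / t) ^+ L' * (1 + t) ^+ n.
  pose K := maxn n.+1 L'.
  have nK : (n < K)%N by exact: leq_maxl.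
  have LK : (L' <= K)%N by exact: leq_maxr.
  rewrite exp_sum_bin -!(sum_bin_widen _ nK).
  rewrite (big_ord_widen K (fun k => c k * 'C(n, k)%:R) LK) [X in _ - X]big_mkcond.
  rewrite -sumrB mulr_sumr; apply: le_trans (ler_norm_sum _ _ _) _.
  apply: ler_sum => k _; case: ifPn => kL.
    rewrite subrr normr0 !mulr_ge0// ?exprn_ge0// ?divr_ge0// ltW//.
  rewrite subr0 normrM (ger0_norm (ler0n _ _)) mulrA ler_wpM2r//.
  apply: le_trans (cA k) _; rewrite -mulrA ler_wpM2l//.
  rewrite -leqNgt in kL; rewrite -(subnKC kL) !exprD exprMn exprVn.
  rewrite [leRHS](_ : _ = w ^+ L' * t ^+ (k - L')); last first.
    by field; rewrite expf_neq0// gt_eqF.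
  by rewrite ler_wpM2l ?exprn_ge0// lerXn2r.
have iH : nint (fun n => \sum_(k < n.+1) c k * 'C(n, k)%:R).
  apply: (nint_le mN (g := fun n => A * (1 + t) ^+ n)); last exact: nintZ.
  by move=> n; have := key 0 n; rewrite big_ord0 subr0 expr0 mulr1.
split=> //; rewrite -nexp_sum_bin -nexpB//; last exact: nint_sum_bin.
by rewrite -nexpZ//; apply: nexp_norm_le => //; exact: nintZ.
Qed.

Lemma bernoulli_le (x : R) k : 0 <= x -> k%:R * x <= (1 + x) ^+ k.
Proof.
move=> x0; apply: (@le_trans _ _ (1 + k%:R * x)); first by rewrite lerDr.
elim: k => [|k IH]; first by rewrite mul0r addr0.
rewrite exprS -natr1; apply: (@le_trans _ _ ((1 + x) * (1 + k%:R * x))).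
  have : 0 <= k%:R * x * x by rewrite !mulr_ge0.
  by lra.
by rewrite ler_wpM2l// addr_ge0.
Qed.

(** The function n h(n - 1) has Newton coefficients k c_(k-1), where c_k is the k-th difference of h
    at 0. Replace k e_k by Newton's identity and sum over the triangle by columns: the j-th column
    is (-1)^j [p j] times a truncation of E[(Delta^j h)(N)]. *)
Lemma stein (h : nat -> R) (A M r w t : R) :
  0 < w -> w < t -> 0 <= r -> 0 < M -> r * t < 1 ->
  (forall j, `|p j| <= M * r ^+ j) ->
  (forall k, `|iter k fdiff h 0| <= A * w ^+ k) ->
  [/\ forall j, nint (iter j fdiff h), nint (fun n => n%:R * h n.-1) &
  \sum_(j < K) (-1) ^+ j * p j * nexp (iter j fdiff h) @[K --> \oo] -->
    nexp (fun n => n%:R * h n.-1)].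
Proof.
move=> w0 wt r0 M0 rt1 pM hA; have t0 : 0 < t by exact: lt_trans wt.
have it := nint_exp t0 r0 M0 rt1 pM.
pose G := nexp (fun n => (1 + t) ^+ n).
have G0 : 0 <= G by apply: nexp_ge0 => n; rewrite exprn_ge0// addr_ge0// ltW.
have A0 : 0 <= A by have := hA 0; rewrite expr0 mulr1; exact: le_trans.
pose c k := iter k fdiff h 0.
(* The factor k in k c_(k-1) spoils the rate w. Any w' above w absorbs it, with a constant [D] that
   comes from Bernoulli's inequality for (w' / w)^k. *)
pose w' := (w + t) / 2.
have ww' : w < w' by rewrite /w'; lra.
have w't : w' < t by rewrite /w'; lra.
have w'0 : 0 < w' by exact: lt_trans ww'.
clearbody w'.
have w0' := ltW w0; have t0' := ltW t0; have w'0' := ltW w'0; have M0' := ltW M0.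
pose D := A / ((w' / w - 1) * w).
have D0 : 0 < (w' / w - 1) * w.
  by rewrite mulr_gt0// subr_gt0 ltr_pdivlMr// mul1r.
have hE n : n%:R * h n.-1 = \sum_(k < n.+1) (k%:R * c k.-1) * 'C(n, k)%:R.
  rewrite big_ord_recl !mul0r add0r; case: n => [|n]; first by rewrite big_ord0 mul0r.
  rewrite [n.+1.-1]/= (newton_forward h n) mulr_sumr; apply: eq_bigr => k _.
  by rewrite lift0/= mulrCA -natrM mul_bin_diag natrM mulrCA mulrA.
have dA k : `|k%:R * c k.-1| <= D * w' ^+ k.
  case: k => [|k]; first by rewrite mul0r normr0 expr0 mulr1 divr_ge0// ltW.
  rewrite normrM (ger0_norm (ler0n _ _)) /D.
  apply: (@le_trans _ _ (k.+1%:R * (A * w ^+ k))); first by rewrite ler_wpM2l// hA.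
  have B1 : k.+1%:R * (w' / w - 1) * w ^+ k.+1 <= w' ^+ k.+1.
    have := @bernoulli_le (w' / w - 1) k.+1; rewrite (addrC 1) subrK.
    rewrite subr_ge0 ler_pdivlMr// mul1r => /(_ (ltW ww')).
    by rewrite -(ler_pM2r (exprn_gt0 k.+1 w0)) -exprMn mulfVK ?gt_eqF.
  rewrite mulrAC ler_pdivlMr//; apply: le_trans (ler_wpM2l A0 B1).
  by apply: le_of_eq; rewrite exprSr; ring.
have cE j n : iter j fdiff h n = \sum_(k < n.+1) c (k + j)%N * 'C(n, k)%:R.
  by rewrite newton_forward; apply: eq_bigr => k _; rewrite /c iterD.
have cA j k : `|c (k + j)%N| <= A * w ^+ j * w ^+ k.
  by apply: le_trans (hA _) _; rewrite -mulrA -exprD addnC.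
have Tj j L := nexp_trunc L w0 (ltW wt) (cA j) it.
have Td L := nexp_trunc L w'0 (ltW w't) dA it.
have ih j : nint (iter j fdiff h).
  have [+ _] := Tj j 0; congr nint.
  by apply/funext => n; rewrite cE.
have iN : nint (fun n => n%:R * h n.-1).
  have [+ _] := Td 0; congr nint.
  by apply/funext => n; rewrite hE.
split=> //.
pose q := w' / t.
have q0 : 0 <= q by rewrite divr_ge0.
have q1 : `|q| < 1 by rewrite ger0_norm// ltr_pdivrMr// mul1r.
pose B := M * A * G / (1 - r * t) + D * G * q.
have bound K : `|\sum_(j < K) (-1) ^+ j * p j * nexp (iter j fdiff h) -
    nexp (fun n => n%:R * h n.-1)| <= B * q ^+ K.
  have [_] := Td K.+1; rewrite -/G -/q distrC.
  rewrite -(funext hE).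
  rewrite big_ord_recl !mul0r add0r.
  set X := nexp _; set Y := \sum_(_ < K) _ => YX.
  have YE : Y = \sum_(j < K) (-1) ^+ j * p j * \sum_(l < K - j) c (l + j)%N * e l.
    transitivity (\sum_(k < K) \sum_(j < k.+1) (-1) ^+ j * p j * (c (k - j + j)%N * e (k - j)%N)).
      apply: eq_bigr => k _; rewrite lift0/= mulrAC newton mulr_suml.
      apply: eq_bigr => j _; rewrite subnK -1?ltnS//; ring.
    rewrite (sum_triangle (fun j l => (-1) ^+ j * p j * (c (l + j)%N * e l))).
    by apply: eq_bigr => j _; rewrite mulr_sumr.
  (* The j-th expectation is truncated at K - j terms, an error of order w^j (w / t)^(K - j). Times
     r^j from [p j], this is at most a constant times (r t)^j q^K, which is summable in j. *)
  have ZY : `|\sum_(j < K) (-1) ^+ j * p j * nexp (iter j fdiff h) - Y| <=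
      M * A * G / (1 - r * t) * q ^+ K.
    rewrite YE -sumrB; apply: le_trans (ler_norm_sum _ _ _) _.
    apply: (@le_trans _ _ (\sum_(j < K) (M * A * G) * (r * t) ^+ j * q ^+ K)); last first.
      rewrite -mulr_suml -mulr_sumr ler_wpM2r ?exprn_ge0// ler_wpM2l//.
        by rewrite !mulr_ge0.
      by apply: geometric_sum_le; rewrite rt1 mulr_ge0.
    apply: ler_sum => j _; rewrite -mulrBr normrM normrMsign.
    have [_] := Tj j (K - j)%N; rewrite -/G.
    rewrite -(funext (cE j)).
    move=> H; apply: le_trans (ler_pM _ _ (pM j) H) _ => //.
    have jK : (j <= K)%N by rewrite ltnW.
    have wq : (w / t) ^+ (K - j) <= q ^+ (K - j).
      apply: lerXn2r; rewrite ?nnegrE ?divr_ge0//.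
      by rewrite /q ler_pM2r ?invr_gt0// ltW.
    have wq' : w ^+ j <= t ^+ j * q ^+ j.
      by rewrite -exprMn /q mulrC mulfVK ?gt_eqF//; apply: lerXn2r; rewrite ?nnegrE// ltW.
    have -> : q ^+ K = q ^+ j * q ^+ (K - j) by rewrite -exprD subnKC.
    rewrite [(r * t) ^+ j]exprMn.
    have := ler_pM (exprn_ge0 _ (ltW w0)) (exprn_ge0 _ _) wq' wq.
    rewrite divr_ge0// => /(_ isT).
    have B0 : 0 <= M * A * G * r ^+ j by rewrite !mulr_ge0// exprn_ge0.
    move=> /(ler_wpM2l B0) {}H.
    by apply: le_trans (le_trans _ H) _; apply: le_of_eq; ring.
  have -> : forall Z, Z - X = (Z - Y) + (Y - X) by move=> Z; ring.
  apply: le_trans (ler_normD _ _) _; rewrite /B mulrDl lerD//.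
  by rewrite -mulrA -exprS; apply: le_trans YX _; rewrite mulrAC.
apply: (cvg_of_dist_le bound).
by rewrite -(mulr0 B); apply: cvgMr; exact: cvg_expr.
Qed.

End stein.

(** * The bound on the traces *)

Section geometric_growth.
Context {R : realType}.

Lemma continuous_le_left (f : R -> R) (a b B : R) : a < b -> {for b, continuous f} ->
  (forall x, a < x < b -> f x <= B) -> f b <= B.
Proof.
move=> ab cf fB.
have : f x @[x --> b^'-] --> f b by exact: cvg_at_left_filter cf.
move=> cv; apply: (closed_cvg (fun y => y <= B) (@closed_le R B) _ _ cv).
near=> x; apply: fB; apply/andP; split; near: x.
- exact: nbhs_left_gt.
- exact: nbhs_left_lt.
Unshelve. all: end_near. Qed.

Variable q : nat -> R.
Hypothesis q_ge0 : forall i, 0 <= q i.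
Hypothesis q_logconvex : forall i, q i.+1 ^+ 2 <= q i * q i.+2.
Hypothesis q_submul : forall i j, q (i + j).+1 <= q i * q j.

Let index_step n j : (n.+1 * j.+1 + j)%N = ((n * j.+1 + j) + j).+1.
Proof. by rewrite mulSn; lia. Qed.

Let index_mul n j : (j.+1 * n.+1)%N = (n * j.+1 + j).+1.
Proof. by rewrite mulnS mulnC; lia. Qed.

(** With a_(i+1) = q_i, submultiplicativity reads a_(m+n) <= a_m a_n. From an i with q i < q i.+1
    on, q is positive, log-convexity makes the ratios nondecreasing, and they are at most q 0; mu is
    their limit. The lower bound on every q j is of Fekete type: a value below nu^(j+1) with nu < mu
    would persist along the multiples of j + 1 and contradict growth at rate nu. *)
Lemma geometric_growth m0 : q 0 < q m0 -> exists mu C : R,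
  [/\ 1 < mu, 0 < C, forall j, q j <= C * mu ^+ j & forall j, mu ^+ j.+1 <= q j].
Proof.
move=> qm0.
have [i qi] : exists i, q i < q i.+1.
  apply/not_existsP => H; move: qm0; rewrite ltNge => /negP; apply.
  elim: m0 => // m; apply: le_trans; rewrite leNgt; apply/negP; exact: H.
pose Q k := q (i + k)%N.
have QS k : 0 < Q k /\ Q k < Q k.+1.
  elim: k => [|k [Qk QSk]].
    rewrite /Q addn0 addn1; split=> //.
    rewrite lt_neqAle q_ge0 andbT eq_sym; apply/negP => /eqP qi0.
    rewrite qi0 in qi; have := q_logconvex i; rewrite qi0 mul0r leNgt => /negP.
    by apply; rewrite exprn_gt0.
  have QS0 : 0 < Q k.+1 by exact: lt_trans QSk.
  split=> //; have := q_logconvex (i + k)%N; rewrite -!addnS -!/(Q _) => lc.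
  rewrite -(ltr_pM2l Qk); apply: lt_le_trans lc.
  by rewrite expr2 ltr_pM2r.
have Q0 k : 0 < Q k by case: (QS k).
pose rr k := Q k.+1 / Q k.
have rr_nd : nondecreasing_seq rr.
  apply/nondecreasing_seqP => k; rewrite /rr ler_pdivlMr// mulrAC ler_pdivrMr//.
  by rewrite -expr2 mulrC; have := q_logconvex (i + k)%N; rewrite -!addnS.
have rr_ub k : rr k <= q 0.
  by rewrite /rr ler_pdivrMr// mulrC; have := q_submul (i + k) 0; rewrite addn0 -addnS.
have rr_bd : has_ubound (range rr) by exists (q 0) => _ [k _ <-].
have cvr := nondecreasing_cvgn rr_nd rr_bd.
set mu := sup (range rr) in cvr.
have rr_mu k : rr k <= mu by apply: ub_le_sup => //; exists k.
have mu1 : 1 < mu.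
  apply: lt_le_trans (rr_mu 0); rewrite /rr ltr_pdivlMr// mul1r.
  by case: (QS 0).
have mu0 : 0 < mu by exact: lt_trans mu1.
exists mu, (\sum_(j < i) q j + q i); split=> //.
- rewrite ltr_wpDl// ?sumr_ge0//.
  by have := Q0 0; rewrite /Q addn0.
- move=> j; have S0 : 0 <= \sum_(j < i) q j by rewrite sumr_ge0.
  have mu1j n : 1 <= mu ^+ n by rewrite exprn_ege1// ltW.
  have [ji|ij] := ltnP j i.
    apply: (@le_trans _ _ ((\sum_(j < i) q j + q i) * 1)).
      rewrite mulr1 (bigD1 (Ordinal ji))//= -addrA lerDl addr_ge0//.
      by rewrite sumr_ge0.
    by rewrite ler_wpM2l// addr_ge0.
  rewrite -(subnKC ij); set k := (j - i)%N.
  apply: (@le_trans _ _ (q i * mu ^+ k)).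
    elim: k => [|k IH]; first by rewrite addn0 mulr1.
    rewrite exprSr mulrA; apply: le_trans (ler_wpM2r (ltW mu0) IH).
    by have := rr_mu k; rewrite /rr ler_pdivrMr// mulrC /Q addnS.
  apply: ler_pM => //; first by rewrite exprn_ge0// ltW.
    by rewrite lerDr.
  by rewrite exprD ler_peMl// exprn_ge0// ltW.
(* The ratios eventually exceed every nu < mu, but perhaps not mu itself; left continuity passes to
   mu. *)
move=> j; apply: (@continuous_le_left (fun x => x ^+ j.+1) 1 mu) => //.
  exact: exprn_continuous.
move=> nu /andP[nu1 numu].
have nu0 : 0 < nu by exact: lt_trans nu1.
have [k0 k0nu] : exists k0, forall k, (k0 <= k)%N -> nu < rr k.
  have [k0 _ H] := cvgr_gt _ cvr _ numu.
  by exists k0 => k k0k; exact: H.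
rewrite leNgt; apply/negP => qjnu.
pose x := q j / nu ^+ j.+1.
have nuj0 n : 0 < nu ^+ n by rewrite exprn_gt0.
have x0 : 0 <= x by rewrite divr_ge0// ltW.
have x1 : `|x| < 1 by rewrite ger0_norm// ltr_pdivrMr// mul1r.
pose n0 := (i + k0)%N.
have low l : nu ^+ l * q n0 <= q (n0 + l)%N.
  elim: l => [|l IH]; first by rewrite mul1r addn0.
  rewrite exprS -mulrA; apply: le_trans (ler_wpM2l (ltW nu0) IH) _.
  have := k0nu (k0 + l)%N (leq_addr _ _); rewrite /rr ltr_pdivlMr//.
  by rewrite /Q !addnS addnA => /ltW.
have up n : q (n * j.+1 + j)%N <= q j ^+ n.+1.
  elim: n => [|n IH]; first by rewrite expr1.
  rewrite (index_step n j).
  apply: le_trans (q_submul _ _) _; rewrite exprSr; exact: ler_wpM2r.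
pose c := q n0 / nu ^+ n0.
have c0 : 0 < c by rewrite divr_gt0//; exact: Q0.
have H n : (n0 <= n)%N -> c / nu <= x ^+ n.+1.
  move=> n0n; have nn : (n0 <= n * j.+1 + j)%N.
    by rewrite (leq_trans n0n)// (leq_trans (leq_pmulr n (ltn0Sn j)))// leq_addr.
  have := low (n * j.+1 + j - n0)%N; rewrite subnKC// => /le_trans/(_ (up n)) K.
  rewrite /x expr_div_n -exprM ler_pdivlMr//; apply: le_trans K; apply: le_of_eq.
  rewrite (index_mul n j) -[in LHS](subnK nn) exprS exprD /c.
  by field; rewrite !lt0r_neq0.
have : x ^+ n @[n --> \oo] --> (0 : R) by exact: cvg_expr.
move=> /cvgr_lt /(_ (c / nu)); rewrite divr_gt0// => /(_ isT)[n1 _ Hn1].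
have := H (n0 + n1)%N (leq_addr _ _).
have /= := Hn1 (n0 + n1).+1.
by rewrite ltNge => /(_ _)/negP; apply; rewrite ltnW// ltnS leq_addl.
Qed.

End geometric_growth.

Section trace_bound.
Context {R : realType} d (T : measurableType d) (P : probability T R)
  (N : T -> nat).
Hypothesis mN : forall n, measurable [set w | N w = n].
Variables (e p : nat -> R).
Hypothesis iC : forall k, nint P N (fun n => 'C(n, k)%:R).
Hypothesis eC : forall k, nexp P N (fun n => 'C(n, k)%:R) = e k.
Hypothesis newton : forall k,
  k.+1%:R * e k.+1 = \sum_(j < k.+1) (-1) ^+ j * e (k - j)%N * p j.
Hypothesis p_ge0 : forall i, 0 <= p (i + i).+1.
Hypothesis p_cs : forall i j,
  p (i + j).+1 ^+ 2 <= p (i + i).+1 * p (j + j).+1.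
Hypothesis p_submul : forall i j,
  p ((i + j).+1 + (i + j).+1).+1 <= p (i + i).+1 * p (j + j).+1.

Let q i := p (i + i).+1.

Let odd_even j : (exists i, j.+1 = (i + i).+1) \/ (exists i, j.+1 = (i + i.+1).+1).
Proof.
have := odd_double_half j; rewrite -addnn; case: (odd j) => /= H; [right|left];
  exists j./2; lia.
Qed.

(** In the header's numbering these are the odd traces, p_(2i+3); Cauchy-Schwarz bounds each by its
    two even neighbours. *)
Let norm_odd_le i : `|p (i + i.+1).+1| <= Num.max (q i) (q i.+1).
Proof.
have m0 : 0 <= Num.max (q i) (q i.+1) by rewrite le_max p_ge0.
rewrite -ler_sqr ?nnegrE// real_normK ?num_real//; apply: le_trans (p_cs _ _) _.
by rewrite expr2; apply: ler_pM; rewrite ?p_ge0 ?le_max ?lexx ?orbT.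
Qed.

Lemma normr_trace_le j : `|p j.+1| <= p 1.
Proof.
suff H i : q i <= q 0.
  have [[i ->]|[i ->]] := odd_even j; first by rewrite ger0_norm ?p_ge0//; exact: H.
  by apply: le_trans (norm_odd_le i) _; rewrite ge_max !H.
rewrite leNgt; apply/negP => qi.
have qlc k : q k.+1 ^+ 2 <= q k * q k.+2.
  by have := p_cs k k.+2; rewrite /q !addnS !addSn.
have [mu [C [mu1 C0 qC qmu]]] := geometric_growth p_ge0 qlc p_submul qi.
have mu0 : 0 < mu by exact: lt_trans mu1.
(* One step of q is two steps of p, so rate mu for q is rate sqrt mu for p. *)
pose r := Num.sqrt mu; have r0 : 0 < r by rewrite sqrtr_gt0.
have r2 : r ^+ 2 = mu by rewrite sqr_sqrtr// ltW.
have r1 : 1 < r by rewrite -sqrtr1 ltr_sqrt.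
pose M := C + `|p 0| + 1.
have M0 : 0 < M by rewrite /M; have := normr_ge0 (p 0); lra.
have r1j k : 1 <= r ^+ k by rewrite exprn_ege1// ltW.
have CM : C <= M by rewrite /M; have := normr_ge0 (p 0); lra.
have pM k : `|p k| <= M * r ^+ k.
  case: k => [|k]; first by rewrite mulr1 /M; lra.
  apply: (@le_trans _ _ (C * r ^+ k.+1)); last by rewrite ler_wpM2r// exprn_ge0// ltW.
  have [[i' ->]|[i' ->]] := odd_even k.
    rewrite ger0_norm ?p_ge0//; apply: le_trans (qC i') _.
    apply: ler_wpM2l; first exact: ltW.
    by rewrite -r2 -exprM mul2n -addnn exprS ler_peMl ?exprn_ge0 ?(ltW r1)// ltW.
  have := p_cs i' i'.+1; rewrite -/(q _) -/(q i'.+1) => H.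
  have b0 : 0 <= C * r ^+ (i' + i'.+1).+1 by rewrite mulr_ge0 ?exprn_ge0// ltW.
  rewrite -ler_sqr ?nnegrE// real_normK ?num_real//; apply: le_trans H _.
  apply: le_trans (ler_pM _ _ (qC i') (qC i'.+1)) _; rewrite ?p_ge0//.
  have -> : (C * r ^+ (i' + i'.+1).+1) ^+ 2 = r ^+ 2 * (C ^+ 2 * mu ^+ (i' + i'.+1)).
    by rewrite exprMn exprAC r2 [mu ^+ (_ + _).+1]exprS mulrCA.
  rewrite exprD (_ : C * _ * _ = C ^+ 2 * (mu ^+ i' * mu ^+ i'.+1)); last by ring.
  by rewrite ler_peMl ?r1j// mulr_ge0 ?sqr_ge0 ?mulr_ge0 ?exprn_ge0// ltW.
(* The critical point: the series of traces blows up as w tends to w1, whereas (1 - w1)^N keeps a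
   positive expectation because w1 < 1. *)
pose w1 := r^-1; have w10 : 0 < w1 by rewrite invr_gt0.
have w11 : w1 < 1 by rewrite invf_lt1.
have w1mu : w1 ^+ 2 * mu = 1 by rewrite -r2 /w1 -exprMn mulVf ?expr1n// gt_eqF.
pose F1 := nexp P N (fun n => (1 - w1) ^+ n).
have x1 n (x : R) : 0 <= x <= 1 -> 0 <= x ^+ n <= 1.
  by move=> /andP[x0 x1]; rewrite exprn_ge0// exprn_ile1.
have int1 x : 0 <= x <= 1 -> nint P N (fun n => x ^+ n).
  move=> x01; apply: (nint_le mN (g := fun=> 1)); last exact: nint_cst.
  by move=> n; have /andP[x0 x1'] := x1 n x x01; rewrite ger0_norm.
have F10 : 0 < F1.
  apply: (nexp_gt0 mN); first by apply: int1; apply/andP; split; lra.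
  by move=> n; rewrite exprn_gt0// subr_gt0.
(* Stein for (1 - w)^n and (1 + w)^n gives sum w^j p_j = G / F and sum (-w)^j p_j = G' / F' in the
   code's indices. The difference keeps twice the odd j, that is the q_i, and - G' / F' <= 0 is
   dropped. *)
have bound w I : 0 < w < w1 ->
    2 * \sum_(i < I) q i * w ^+ (i + i).+1 <= e 1 / F1.
  move=> /andP[w0 ww1].
  pose t := (w + w1) / 2.
  have wt : w < t by rewrite /t; lra.
  have tw1 : t < w1 by rewrite /t; lra.
  have rt1 : r * t < 1 by rewrite -ltr_pdivlMl// mulr1.
  have st (z : R) : `|z| = w ->
      [/\ nint P N (fun n => (1 + z) ^+ n), nint P N (fun n => n%:R * (1 + z) ^+ n.-1) &
      (\sum_(j < K) (- z) ^+ j * p j) * nexp P N (fun n => (1 + z) ^+ n)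
        @[K --> \oo] --> nexp P N (fun n => n%:R * (1 + z) ^+ n.-1)].
    move=> zw; pose h n := (1 + z) ^+ n.
    have hk k : `|iter k fdiff h 0| <= 1 * w ^+ k.
      by rewrite iter_fdiff_exp mulr1 mul1r normrX zw.
    have [i1 i2 cv] := stein mN iC eC newton w0 wt (ltW r0) M0 rt1 pM hk.
    split; [exact: (i1 0)|exact: i2|].
    rewrite (_ : (fun K => _) = (fun K => \sum_(j < K) (-1) ^+ j * p j *
        nexp P N (iter j fdiff h))) //; apply/funext => K.
    rewrite mulr_suml; apply: eq_bigr => l _.
    have -> : nexp P N (iter l fdiff h) = z ^+ l * nexp P N h.
      rewrite -nexpZ ?(i1 0)//; congr nexp; apply/funext => n.
      exact: iter_fdiff_exp.
    by rewrite (exprNn z) -[LHS]mulrA mulrACA.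
  have [iF iE c1] := st (- w) (etrans (normrN w) (gtr0_norm w0)).
  have [iF' iE' c2] := st w (gtr0_norm w0).
  rewrite opprK in c1.
  set F := nexp P N _ in c1; set G := nexp P N _ in c1.
  set F' := nexp P N _ in c2; set G' := nexp P N _ in c2.
  have F1F : F1 <= F.
    apply: le_nexp => //; first by apply: int1; apply/andP; split; lra.
    by move=> n; apply: lerXn2r; rewrite ?nnegrE; lra.
  have F0 : 0 < F by exact: lt_le_trans F1F.
  have F'0 : 0 < F' by apply: (nexp_gt0 mN) => // n; rewrite exprn_gt0//; lra.
  have G'0 : 0 <= G' by apply: nexp_ge0 => n; rewrite mulr_ge0// exprn_ge0//; lra.
  have G0 : 0 <= G.
    by apply: nexp_ge0 => n; rewrite mulr_ge0// exprn_ge0//; lra.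
  have Ge : G <= e 1.
    rewrite -eC; apply: le_nexp => // n; rewrite bin1 -[leRHS]mulr1 ler_wpM2l//.
    have /andP[_ //] : 0 <= (1 - w) ^+ n.-1 <= 1.
    by apply: x1; apply/andP; split; lra.
  have e10 : 0 <= e 1 by rewrite -eC; apply: nexp_ge0.
  have cvU : \sum_(j < K) w ^+ j * p j @[K --> \oo] --> G / F.
    by apply: cvg_divr c1; rewrite gt_eqF.
  have cvV : \sum_(j < K) (- w) ^+ j * p j @[K --> \oo] --> G' / F'.
    by apply: cvg_divr c2; rewrite gt_eqF.
  have cvB := cvgB cvU cvV.
  have BE K : \sum_(j < K) w ^+ j * p j - \sum_(j < K) (- w) ^+ j * p j =
      \sum_(j < K) (if odd j then 2 * (w ^+ j * p j) else 0).
    rewrite -sumrB; apply: eq_bigr => l _; rewrite exprNn -signr_odd.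
    by case: (odd l); rewrite ?expr0 ?expr1; ring.
  apply: (@le_trans _ _ (G / F - G' / F')); last first.
    rewrite lerBlDr; apply: (@le_trans _ _ (e 1 / F1)).
      apply: ler_pM => //; first by rewrite invr_ge0 ltW.
      by rewrite lef_pV2 ?posrE.
    by rewrite lerDl divr_ge0// ltW.
  apply: cvgr_to_ge (cvB _) _; exists (2 * I)%N => // K /= IK.
  rewrite -[leRHS]/(\sum_(j < K) w ^+ j * p j - \sum_(j < K) (- w) ^+ j * p j) BE.
  have oddS L : 2 * \sum_(i < L) q i * w ^+ (i + i).+1 =
      \sum_(j < 2 * L) (if odd j then 2 * (w ^+ j * p j) else 0).
    elim: L => [|L IH]; first by rewrite muln0 !big_ord0 mulr0.
    rewrite big_ord_recr/= mulrDr IH mulnS !addSn add0n !big_ord_recr/=.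
    rewrite -![in RHS]addrA; congr (_ + _).
    by rewrite oddM/= add0r mul2n -addnn; rewrite /q; ring.
  rewrite oddS (big_ord_widen K (fun j => if odd j then 2 * (w ^+ j * p j) else 0) IK).
  rewrite big_mkcond; apply: ler_sum => l _; case: ifP => // _.
  case: ifPn => // oj; rewrite mulr_ge0// mulr_ge0 ?exprn_ge0 ?(ltW w0)//.
  move: oj; case: (nat_of_ord l) => // l'; have [[i' ->]|[i' ->]] := odd_even l'.
    by rewrite p_ge0.
  by rewrite -addSnnS /= oddD/=; case: (odd i').
have key I : 2 * I%:R <= e 1 / F1.
  (* As w^2 mu <= 1, the lower bounds mu^(i+1) w^(2i+1) on the terms decrease in i, so the first I
     of them sum to at least I times the one of index I. At w1 the latter is mu w1 = r > 1, and 2 I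
     would stay below e 1 / F1 for every I. *)
  pose f (x : R) := (2 * I%:R * mu ^+ I.+1) * x ^+ (I + I).+1.
  apply: (@le_trans _ _ (f w1)).
    rewrite /f -mulrA ler_peMr ?mulr_ge0//.
    have -> : mu ^+ I.+1 * w1 ^+ (I + I).+1 = (w1 ^+ 2 * mu) ^+ I * (mu * w1).
      by rewrite exprMn -exprM mul2n -addnn !exprS; ring.
    by rewrite w1mu expr1n mul1r -r2 expr2 /w1 mulfK ?gt_eqF// ltW.
  apply: (continuous_le_left w10); first by apply: cvgMr; exact: exprn_continuous.
  move=> w ww; apply: le_trans (bound w I ww); move/andP: ww => [w0 ww1].
  have w2 : w ^+ 2 * mu <= 1.
    by rewrite -w1mu ler_wpM2r ?(ltW mu0)//; apply: lerXn2r; rewrite ?nnegrE ltW.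
  have w20 : 0 <= w ^+ 2 * mu by rewrite mulr_ge0 ?sqr_ge0// ltW.
  rewrite /f -!mulrA ler_wpM2l// -[I%:R]mulr1 -[in X in X * _](card_ord I).
  rewrite mulr1 -sum1_card natr_sum mulr_suml; apply: ler_sum => i' _.
  rewrite mul1r; apply: le_trans (ler_wpM2r _ (qmu i')); last first.
    by rewrite exprn_ge0// ltW.
  have eqw k : mu ^+ k.+1 * w ^+ (k + k).+1 = (w ^+ 2 * mu) ^+ k * (mu * w).
    by rewrite exprMn -exprM mul2n -addnn !exprS; ring.
  rewrite !eqw ler_wpM2r// ?mulr_ge0 ?(ltW mu0) ?(ltW w0)//.
  by rewrite ler_wiXn2l// ltnW.
have := key (Num.truncn (e 1 / F1)).+1.
have := truncnS_gt (e 1 / F1).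
have := ler0n R (Num.truncn (e 1 / F1)).+1.
lra.
Qed.

End trace_bound.

(** * The characteristic function of the number of points *)

Section characteristic_ode.
Context {R : realType}.

Lemma is_derive_of_quadratic (f : R -> R) (x l C : R) :
  (forall h, `|f (x + h) - f x - h * l| <= C * h ^+ 2) -> is_derive x (1 : R) f l.
Proof.
move=> fC; have C0 : 0 <= C by have := le_trans (normr_ge0 _) (fC 1); rewrite expr1n mulr1.
have cv : h^-1 *: (f (h *: (1 : R) + x) - f x) @[h --> 0^'] --> l.
  apply/cvgrPdist_le => eps eps0; near=> h.
  have h0 : h != 0 by near: h; exact: nbhs_dnbhs_neq.
  have hn : 0 < `|h| by rewrite normr_gt0.
  rewrite (_ : l - _ = - h^-1 * (f (x + h) - f x - h * l)); last first.
    have -> : h *: (1 : R) + x = x + h by rewrite [h *: _]mulr1 addrC.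
    rewrite (_ : h^-1 *: _ = h^-1 * (f (x + h) - f x) :> R)//.
    by move: (f (x + h)) (f x) h0 => a b h0; field.
  rewrite normrM normrN normfV.
  apply: (@le_trans _ _ (`|h|^-1 * (C * h ^+ 2))).
    by rewrite ler_wpM2l ?invr_ge0.
  rewrite -(real_normK (num_real h)) expr2 mulrCA mulKf ?gt_eqF//.
  have : `|h| <= eps / (C + 1).
    near: h; apply: dnbhs0_le; rewrite divr_gt0//; lra.
  rewrite ler_pdivlMr; last by lra.
  have := normr_ge0 h; nra.
by split; [apply/cvg_ex; exists l|exact/cvg_lim].
Unshelve. all: end_near. Qed.

Context d (T : measurableType d) (P : probability T R) (Z : T -> R).
Hypothesis mZ : measurable_fun setT Z.
Hypothesis iZ2 : P.-integrable setT (fun w => (Z w ^+ 2)%:E).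

Lemma bounded_integrable (f : T -> R) (M : R) : measurable_fun setT f ->
  (forall w, `|f w| <= M) -> P.-integrable setT (EFin \o f).
Proof.
move=> mf fM; apply: measurable_bounded_integrable => //.
  by rewrite ltey_eq fin_num_measure.
exists M; split; first exact: num_real.
by move=> N MN x _; rewrite /= (le_trans (fM x))// ltW.
Qed.

Lemma integrable_of_sqr : P.-integrable setT (EFin \o Z).
Proof.
apply: (@le_integrable _ _ _ P _ measurableT _ (fun w => (1 + Z w ^+ 2)%:E)).
- exact/measurable_EFinP.
- move=> w _; rewrite /= lee_fin (@ger0_norm _ (1 + _)); last by rewrite addr_ge0// sqr_ge0.
  have := sqr_ge0 (`|Z w| - 1); rewrite -(real_normK (num_real (Z w))); nra.
- have := integrableD measurableT (finite_measure_integrable_cst P 1 measurableT) iZ2.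
  by [].
Qed.

Let msin u b : measurable_fun setT (fun w => sin (u * Z w + b)).
Proof.
have ms : measurable_fun setT (sin : R -> R).
  by apply: continuous_measurable_fun; exact: continuous_sin.
apply: (measurableT_comp ms).
by apply: measurable_funD => //; exact: measurable_funM.
Qed.

Let mcos u b : measurable_fun setT (fun w => cos (u * Z w + b)).
Proof.
have ms : measurable_fun setT (cos : R -> R).
  by apply: continuous_measurable_fun; exact: continuous_cos.
apply: (measurableT_comp ms).
by apply: measurable_funD => //; exact: measurable_funM.
Qed.

Let isin u b : P.-integrable setT (fun w => (sin (u * Z w + b))%:E).
Proof.
apply: (@bounded_integrable _ 1) => // w.
by rewrite ler_norml sin_geN1 sin_le1.
Qed.

Let iZcos u b : P.-integrable setT (fun w => (Z w * cos (u * Z w + b))%:E).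
Proof.
apply: (@le_integrable _ _ _ P _ measurableT _ (EFin \o Z)) integrable_of_sqr.
- by apply/measurable_EFinP; exact: measurable_funM.
- move=> w _; rewrite /= lee_fin normrM ler_piMr//.
  by rewrite ler_norml cos_geN1 cos_le1.
Qed.

(** The Taylor remainder of the sine is at most (h Z)^2, so the second moment of Z is the constant
    of the quadratic bound. *)
Lemma is_derive_charfun (u b : R) :
  is_derive u (1 : R) (fun u => \int[P]_w sin (u * Z w + b))
    (\int[P]_w (Z w * cos (u * Z w + b))).
Proof.
apply: (is_derive_of_quadratic (C := \int[P]_w Z w ^+ 2)) => h.
have -> : h * \int[P]_w (Z w * cos (u * Z w + b)) =
    \int[P]_w (h * (Z w * cos (u * Z w + b))).
  by rewrite RintegralZl//; exact: iZcos.
have -> : \int[P]_w sin ((u + h) * Z w + b) - \int[P]_w sin (u * Z w + b) =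
    \int[P]_w (sin ((u + h) * Z w + b) - sin (u * Z w + b)).
  by rewrite RintegralB//; exact: isin.
have iZh : P.-integrable setT (fun w => (h * (Z w * cos (u * Z w + b)))%:E).
  by have := integrableZl measurableT h (iZcos u b).
have iB : P.-integrable setT (fun w => (sin ((u + h) * Z w + b) - sin (u * Z w + b))%:E).
  by have := integrableB measurableT (isin (u + h) b) (isin u b).
have iBB : P.-integrable setT (fun w => (sin ((u + h) * Z w + b) - sin (u * Z w + b)
     - h * (Z w * cos (u * Z w + b)))%:E).
  by have := integrableB measurableT iB iZh.
rewrite -RintegralB//.
apply: le_trans (le_normr_Rintegral _ _) _ => //.
have -> : (\int[P]_w Z w ^+ 2) * h ^+ 2 = \int[P]_w (h ^+ 2 * Z w ^+ 2).
  by rewrite RintegralZl 1?mulrC//; exact: iZ2.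
apply: le_Rintegral => //.
- exact: integrable_norm iBB.
- by have := integrableZl measurableT (h ^+ 2) iZ2.
- move=> w _; rewrite -exprMn mulrA.
  rewrite (_ : (u + h) * Z w + b = u * Z w + b + h * Z w); last by ring.
  exact: sin_taylor.
Qed.

(** With g u = E sin (u Z + b), the exponential is the integrating factor of g' = - u v g, and the
    mean value bound on [0, U] compares with g 0 = sin b. The phase b makes real sines carry as much
    as the complex characteristic function. *)
Lemma charfun_ode (v U eps b : R) : 0 <= U ->
  (forall u, 0 <= u <= U ->
    `|\int[P]_w (Z w * cos (u * Z w + b)) + u * v * \int[P]_w sin (u * Z w + b)| <= eps) ->
  `|(\int[P]_w sin (U * Z w + b)) * expR (v * U ^+ 2 / 2) - sin b| <=
    U * eps * expR (`|v| * U ^+ 2 / 2).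
Proof.
move=> U0 H.
pose g u := \int[P]_w sin (u * Z w + b).
pose F u := g u * expR (v * u ^+ 2 / 2).
pose g' u := \int[P]_w (Z w * cos (u * Z w + b)).
have F0 : F 0 = sin b.
  rewrite /F /g expr0n/= mulr0 mul0r expR0 mulr1.
  under eq_Rintegral do rewrite mul0r add0r.
  rewrite Rintegral_cst//.
  by rewrite -[RHS]mulr1; congr (_ * _); exact: (congr1 fine (probability_setT P)).
have dF u : is_derive u (1 : R) F ((g' u + u * v * g u) * expR (v * u ^+ 2 / 2)).
  have dg : is_derive u (1 : R) g (g' u) := is_derive_charfun u b.
  have de : is_derive u (1 : R) (fun u => expR (v * u ^+ 2 / 2))
      (u * v * expR (v * u ^+ 2 / 2)).
    apply: is_derive_eq.
    by rewrite /GRing.scale/=; field.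
  apply: is_derive_eq.
  rewrite /GRing.scale/=; ring.
rewrite -F0 -[X in `|X - _|]/(F U).
apply: le_trans (derive_bound (M := eps * expR (`|v| * U ^+ 2 / 2)) dF _) _.
  rewrite (min_idPl U0) (max_idPr U0) => u u0U; rewrite normrM.
  apply: ler_pM => //; first exact: H.
  rewrite ger0_norm ?expR_ge0// ler_expR; move/andP: u0U => [u0 uU].
  rewrite ler_pM2r ?invr_gt0//.
  apply: le_trans (ler_wpM2r (sqr_ge0 u) (ler_norm v)) _.
  by rewrite ler_wpM2l//; apply: lerXn2r.
by rewrite subr0 (ger0_norm U0) mulrC mulrA.
Qed.

End characteristic_ode.

(** * The Stein identity for cosines and its rescaling *)

Section stein_cosine.
Context {R : realType} d (T : measurableType d) (P : probability T R)
  (N : T -> nat).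
Hypothesis mN : forall n, measurable [set w | N w = n].
Variables (e p : nat -> R).
Hypothesis iC : forall k, nint P N (fun n => 'C(n, k)%:R).
Hypothesis eC : forall k, nexp P N (fun n => 'C(n, k)%:R) = e k.
Hypothesis newton : forall k,
  k.+1%:R * e k.+1 = \sum_(j < k.+1) (-1) ^+ j * e (k - j)%N * p j.
Hypothesis p0_ge0 : 0 <= p 0.
Hypothesis p_le : forall j, `|p j.+1| <= p 1.

Let p1_ge0 : 0 <= p 1.
Proof. exact: le_trans (p_le 0). Qed.

Lemma cos_taylor (a h : R) : `|cos (a + h) - cos a + h * sin a| <= h ^+ 2.
Proof.
have := sin_taylor (a + pi / 2) h.
rewrite (_ : a + pi / 2 + h = a + h + pi / 2); last by ring.
rewrite !sinDpihalf cosDpihalf; by rewrite mulrN opprK.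
Qed.

Lemma nint_bounded (f : nat -> R) M : (forall n, `|f n| <= M) -> nint P N f.
Proof. by move=> fM; apply: (nint_le mN fM); exact: nint_cst. Qed.

Lemma nint_cos (s b : R) : nint P N (fun n => cos (s * n%:R + b)).
Proof. by apply: (@nint_bounded _ 1) => n; rewrite ler_norml cos_geN1 cos_le1. Qed.

Lemma nint_sin (s b : R) : nint P N (fun n => sin (s * n%:R + b)).
Proof. by apply: (@nint_bounded _ 1) => n; rewrite ler_norml sin_geN1 sin_le1. Qed.

(** Two terms of the Stein series are kept. For j >= 2, |p j| <= p 1 and |Delta^j h| <= s^j, and s
    <= 1/2 bounds the geometric tail by 2 p 1 s^2. *)
Lemma stein_cos_pred (s b : R) : 0 < s <= 1 / 2 ->
  nint P N (fun n => n%:R * cos (s * n.-1%:R + b)) /\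
  `|nexp P N (fun n => n%:R * cos (s * n.-1%:R + b)) -
    p 0 * nexp P N (fun n => cos (s * n%:R + b)) +
    p 1 * nexp P N (fdiff (fun n => cos (s * n%:R + b)))| <= 2 * p 1 * s ^+ 2.
Proof.
move=> /andP[s0 s12]; pose h n := cos (s * n%:R + b).
pose M := p 0 + p 1 + 1.
have M0 : 0 < M by rewrite /M; have := p0_ge0; have := p1_ge0; lra.
have pM j : `|p j| <= M * 1 ^+ j.
  rewrite expr1n mulr1; have := p0_ge0; have := p1_ge0.
  case: j => [|j]; first by rewrite ger0_norm// /M; lra.
  by have := p_le j; rewrite /M; lra.
have hle j n : `|iter j fdiff h n| <= s ^+ j.
  by apply: le_trans (iter_fdiff_cos_le _ _ _ _) _; rewrite gtr0_norm.
have hA k : `|iter k fdiff h 0| <= 1 * s ^+ k by rewrite mul1r.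
(* The traces are bounded, so r = 1; t = 3/4 fits strictly between s and 1. *)
have s34 : s < 3 / 4 by lra.
have rt1 : 1 * (3 / 4) < 1 :> R by lra.
have [ih iN cv] := stein mN iC eC newton s0 s34 ler01 M0 rt1 pM hA.
split=> //.
set X := nexp P N _ in cv *.
have nle j : `|nexp P N (iter j fdiff h)| <= s ^+ j.
  have := nexp_norm_le mN (nint_cst P N (s ^+ j)) (hle j).
  by rewrite nexp_cst.
have tail K : `|\sum_(j < K.+2) (-1) ^+ j * p j * nexp P N (iter j fdiff h) -
    p 0 * nexp P N h + p 1 * nexp P N (fdiff h)| <= 2 * p 1 * s ^+ 2.
  rewrite 2!big_ord_recl /= expr0 expr1 mul1r !mulN1r mulNr.
  set Y := \sum_(_ < K) _.
  rewrite (_ : _ + _ = Y); last by ring.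
  apply: le_trans (ler_norm_sum _ _ _) _.
  apply: (@le_trans _ _ (\sum_(i < K) p 1 * s ^+ 2 * s ^+ i)).
    apply: ler_sum => i _; rewrite -mulrA normrMsign normrM -mulrA -exprD.
    by apply: ler_pM => //; exact: (nle (2 + i)%N).
  rewrite -mulr_sumr; apply: (@le_trans _ _ (p 1 * s ^+ 2 * 2)).
    apply: ler_wpM2l; first by rewrite mulr_ge0 ?sqr_ge0.
    apply: le_trans (geometric_sum_le _ _) _; first by rewrite ltW//=; lra.
    by rewrite invf_ple ?posrE; lra.
  by apply: le_of_eq; ring.
have cv2 : (fun K => `|\sum_(j < K.+2) (-1) ^+ j * p j * nexp P N (iter j fdiff h) -
    p 0 * nexp P N h + p 1 * nexp P N (fdiff h)|) @ \oo -->
    `|X - p 0 * nexp P N h + p 1 * nexp P N (fdiff h)|.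
  apply: cvg_norm; apply: cvgD; last exact: cvg_cst.
  apply: cvgB; last exact: cvg_cst.
  by have := cv; rewrite -(cvg_shiftn 2); under eq_fun do rewrite addn2.
by apply: (cvgr_to_le cv2); apply: nearW.
Qed.

(** The phase c + s makes h (n - 1) = cos (s n + c). Taylor expansion of h and Delta h around s n +
    c turns the two kept terms into the drift of the differential equation. The constant 7 is 2 from
    the tail plus 5 from [d2]. *)
Lemma stein_cos (s c : R) : 0 < s <= 1 / 2 ->
  `|nexp P N (fun n => (n%:R - p 0) * cos (s * n%:R + c)) +
    s * (p 0 - p 1) * nexp P N (fun n => sin (s * n%:R + c))| <=
  (p 0 + 7 * p 1) * s ^+ 2.
Proof.
move=> s01; have [iN H] := stein_cos_pred (c + s) s01.
have NE : (fun n => n%:R * cos (s * n.-1%:R + (c + s))) =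
    (fun n => n%:R * cos (s * n%:R + c)).
  apply/funext => -[|n]; first by rewrite !mul0r.
  by congr (_ * cos _); rewrite -[n.+1%:R]natr1 /=; ring.
rewrite NE in iN H.
pose a n : R := s * n%:R + c.
pose d1 n : R := cos (a n + s) - cos (a n) + s * sin (a n).
(* This is the Taylor remainder for the increment 2 s, at most 4 s^2, minus the one for s, at most
   s^2. *)
pose d2 n : R := cos (a n + 2 * s) - cos (a n + s) + s * sin (a n).
have d1le n : `|d1 n| <= s ^+ 2 by exact: cos_taylor.
have d2le n : `|d2 n| <= 5 * s ^+ 2.
  have := cos_taylor (a n) (2 * s); have := d1le n.
  rewrite exprMn /d1 /d2 !ler_norml; lra.
have i1 : nint P N d1 := nint_bounded d1le.
have i2 : nint P N d2 := nint_bounded d2le.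
have ic : nint P N (fun n => cos (a n)) := nint_cos s c.
have is' : nint P N (fun n => sin (a n)) := nint_sin s c.
have E1 : nexp P N (fun n => cos (s * n%:R + (c + s))) =
    nexp P N (fun n => cos (a n)) - s * nexp P N (fun n => sin (a n)) + nexp P N d1.
  rewrite -nexpZ// -nexpB//; last exact: nintZ.
  rewrite -nexpD//; last first.
    have := nintD ic (nintZ (- s) is').
    by congr nint; apply/funext => n; rewrite mulNr.
  congr nexp; apply/funext => n; rewrite /d1 /a addrA; ring.
have E2 : nexp P N (fdiff (fun n => cos (s * n%:R + (c + s)))) =
    nexp P N d2 - s * nexp P N (fun n => sin (a n)).
  rewrite -nexpZ// -nexpB//; last exact: nintZ.
  congr nexp; apply/funext => n; rewrite /fdiff /d2.
  rewrite (_ : s * n.+1%:R + (c + s) = a n + 2 * s); last by rewrite /a -natr1; ring.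
  by rewrite (_ : s * n%:R + (c + s) = a n + s); [ring|rewrite /a; ring].
have E3 : nexp P N (fun n => (n%:R - p 0) * cos (s * n%:R + c)) =
    nexp P N (fun n => n%:R * cos (s * n%:R + c)) - p 0 * nexp P N (fun n => cos (a n)).
  rewrite -nexpZ// -nexpB//; last exact: nintZ.
  by congr nexp; apply/funext => n; rewrite /a; ring.
rewrite E1 E2 in H.
have b1 := nexp_norm_le mN (nint_cst P N (s ^+ 2)) d1le.
have b2 := nexp_norm_le mN (nint_cst P N (5 * s ^+ 2)) d2le.
rewrite !nexp_cst in b1 b2.
pose A := nexp P N (fun n => n%:R * cos (s * n%:R + c)).
pose Cc := nexp P N (fun n => cos (a n)).
pose S := nexp P N (fun n => sin (a n)).
rewrite E3 -/A -/Cc -[nexp P N (fun n => sin _)]/S.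
rewrite -/A -/Cc -/S in H.
move: (nexp P N d1) (nexp P N d2) b1 b2 H => D1 D2 b1 b2 H.
have b3 : `|p 0 * D1| <= p 0 * s ^+ 2 by rewrite normrM ger0_norm// ler_wpM2l.
have b4 : `|p 1 * D2| <= p 1 * (5 * s ^+ 2) by rewrite normrM ger0_norm// ler_wpM2l.
rewrite (_ : _ + _ = (A - p 0 * (Cc - s * S + D1) + p 1 * (D2 - s * S)) +
    (p 0 * D1 - p 1 * D2)); last by ring.
apply: le_trans (ler_normD _ _) _.
apply: (@le_trans _ _ (2 * p 1 * s ^+ 2 + (p 0 * s ^+ 2 + p 1 * (5 * s ^+ 2)))).
  by rewrite lerD//; apply: le_trans (ler_normB _ _) _; rewrite lerD.
by apply: le_of_eq; ring.
Qed.

Lemma measurable_count : measurable_fun setT (fun w => (N w)%:R : R).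
Proof. exact: (measurable_natcomp mN (fun n => n%:R)). Qed.

Lemma e0E : e 0 = 1.
Proof.
rewrite -eC -[RHS](nexp_cst P N); congr nexp; apply/funext => n.
by rewrite bin0.
Qed.

Lemma e1E : e 1 = p 0.
Proof. by have := newton 0; rewrite big_ord1 e0E expr0 !mul1r. Qed.

Let sqrE (x : R) n : (n%:R - x) ^+ 2 =
  2 * 'C(n, 2)%:R + ((1 - 2 * x) * 'C(n, 1)%:R + x ^+ 2).
Proof.
have : 2 * 'C(n, 2)%:R = n%:R * n.-1%:R :> R.
  by rewrite -!natrM -mul_bin_diag bin1.
rewrite bin1 => ->; case: n => [|n]; first by rewrite !mul0r mulr0; ring.
by rewrite -[n.+1%:R]natr1 /=; ring.
Qed.

Lemma nint_sqr (x : R) : nint P N (fun n => (n%:R - x) ^+ 2).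
Proof.
rewrite (funext (sqrE x)); apply: nintD; first exact: nintZ.
by apply: nintD; [exact: nintZ|exact: nint_cst].
Qed.

Lemma count_variance : nexp P N (fun n => (n%:R - p 0) ^+ 2) = p 0 - p 1.
Proof.
have i1 := nintZ (1 - 2 * p 0) (iC 1).
rewrite (funext (sqrE (p 0))) nexpD; [|exact: nintZ|exact: nintD i1 (nint_cst _ _ _)].
rewrite nexpD//; last exact: nint_cst.
rewrite nexp_cst (nexpZ 2 (iC 2)) (nexpZ _ (iC 1)) !eC e1E.
have := newton 1; rewrite 2!big_ord_recr big_ord0/= e1E e0E => ->.
by rewrite expr0 expr1; ring.
Qed.

(** Frequency u for the scaled variable is s = u / sqrt V for the count, whence U <= sqrt V / 2 to
    have s <= 1/2. The error is of order 1 / sqrt V once p 0 and p 1 are of order V. *)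
Lemma count_charfun (V U b : R) : 0 < V -> 0 <= U -> U <= Num.sqrt V / 2 ->
  `|(\int[P]_w sin (U * (((N w)%:R - p 0) / Num.sqrt V) + b)) *
    expR ((p 0 - p 1) / V * U ^+ 2 / 2) - sin b| <=
  U * ((p 0 + 7 * p 1) / V * U ^+ 2 / Num.sqrt V) *
    expR (`|(p 0 - p 1) / V| * U ^+ 2 / 2).
Proof.
move=> V0 U0 UV; pose Z w := ((N w)%:R - p 0) / Num.sqrt V.
pose v := (p 0 - p 1) / V.
have y0 : 0 < Num.sqrt V by rewrite sqrtr_gt0.
have yV : Num.sqrt V ^+ 2 = V by rewrite sqr_sqrtr// ltW.
set y := Num.sqrt V in Z y0 yV UV *.
have mZ : measurable_fun setT Z.
  apply: measurable_funM; last exact: measurable_cst.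
  by apply: measurable_funB; [exact: measurable_count|exact: measurable_cst].
have iZ2 : P.-integrable setT (fun w => (Z w ^+ 2)%:E).
  have := nintZ (y ^- 2) (nint_sqr (p 0)); rewrite /nint.
  by congr (_.-integrable _ _); apply/funext => w; rewrite /Z exprMn exprVn mulrC.
apply: (charfun_ode mZ iZ2 U0) => u /andP[u0 uU].
have p01 : 0 <= p 0 + 7 * p 1 by have := p0_ge0; have := p1_ge0; lra.
have RE s c : \int[P]_w (Z w * cos (s * y * Z w + c)) =
    y^-1 * nexp P N (fun n => (n%:R - p 0) * cos (s * n%:R + (c - s * p 0))).
  rewrite -nexpZ; last first.
    have : nint P N (fun n => 1 + (n%:R - p 0) ^+ 2).
      by apply: nintD; [exact: nint_cst|exact: nint_sqr].
    apply: (nint_le mN) => n; rewrite normrM.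
    apply: (@le_trans _ _ `|n%:R - p 0|).
      by rewrite ler_piMr// ler_norml cos_geN1 cos_le1.
    rewrite -(real_normK (num_real (n%:R - p 0))).
    by have := sqr_ge0 (`|n%:R - p 0| - 1); nra.
  apply: eq_Rintegral => w _; rewrite /Z.
  rewrite (_ : s * y * _ + c = s * (N w)%:R + (c - s * p 0)).
    by rewrite mulrAC mulrC.
  by field; rewrite gt_eqF.
have SE s c : \int[P]_w sin (s * y * Z w + c) =
    nexp P N (fun n => sin (s * n%:R + (c - s * p 0))).
  apply: eq_Rintegral => w _; rewrite /Z.
  by congr sin; field; rewrite gt_eqF.
rewrite -(mulfVK (lt0r_neq0 y0) u) RE SE; set s := u / y.
have s0 : 0 <= s by rewrite divr_ge0// ltW.
have s12 : s <= 1 / 2.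
  by rewrite /s ler_pdivrMr// mul1r mulrC; exact: le_trans UV.
have s2 : s ^+ 2 <= U ^+ 2 / V.
  rewrite /s exprMn exprVn yV ler_wpM2r ?invr_ge0 ?(ltW V0)//.
  by apply: lerXn2r.
set c := b - s * p 0.
rewrite (_ : _ + _ = y^-1 * (nexp P N (fun n => (n%:R - p 0) * cos (s * n%:R + c)) +
    s * (p 0 - p 1) * nexp P N (fun n => sin (s * n%:R + c)))); last first.
  by rewrite -yV; field; rewrite gt_eqF.
rewrite normrM gtr0_norm ?invr_gt0//.
rewrite (_ : _ / V * _ / y = y^-1 * ((p 0 + 7 * p 1) * (U ^+ 2 / V))); last by ring.
rewrite ler_pM2l ?invr_gt0//; apply: (@le_trans _ _ ((p 0 + 7 * p 1) * s ^+ 2)).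
  (* At s = 0 the claim is that p 0 is the mean of N. *)
  have [s0'|s0'] := eqVneq s 0; last by apply: stein_cos; rewrite lt0r s0' s0.
  rewrite s0' !mul0r expr0n/= mulr0 addr0.
  rewrite (_ : (fun n => _) = (fun n : nat => cos c * ('C(n, 1)%:R + - p 0))); last first.
    by apply/funext => n; rewrite bin1 mul0r add0r mulrC.
  rewrite nexpZ; last by apply: nintD; [exact: iC|exact: nint_cst].
  rewrite nexpD//; last exact: nint_cst.
  by rewrite eC e1E nexp_cst subrr mulr0 normr0.
by rewrite ler_wpM2l.
Qed.

End stein_cosine.

(** * Weak convergence from characteristic functions *)

Section bernstein.
Context {R : realType}.
Implicit Types (F G : nat -> R) (t : R).

(* [bern n F t] is the mean of F at a binomial variable with parameters n, t. *)
Fixpoint bern n F t : R :=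
  if n is n'.+1 then t * bern n' (F \o S) t + (1 - t) * bern n' F t else F 0.

Lemma bern_le n F G t : 0 <= t <= 1 -> (forall k, (k <= n)%N -> F k <= G k) ->
  bern n F t <= bern n G t.
Proof.
move=> /andP[t0 t1]; elim: n F G => [|n IH] F G FG /=; first exact: FG.
apply: lerD; apply: ler_wpM2l; rewrite ?subr_ge0//; apply: IH => k kn.
  exact: FG.
by apply: FG; rewrite (leq_trans kn).
Qed.

Lemma bern_cst n c t : bern n (fun _ => c) t = c.
Proof. by elim: n => //= n IH; rewrite [_ \o _](_ : _ = fun _ => c)// IH; ring. Qed.

Lemma bernD n F G t : bern n (fun k => F k + G k) t = bern n F t + bern n G t.
Proof.
elim: n F G => //= n IH F G.
by rewrite [_ \o _](_ : _ = fun k => F k.+1 + G k.+1)// !IH /comp; ring.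
Qed.

Lemma bernZ n c F t : bern n (fun k => c * F k) t = c * bern n F t.
Proof.
elim: n F => //= n IH F.
by rewrite [_ \o _](_ : _ = fun k => c * F k.+1)// !IH /comp; ring.
Qed.

(** Variance n t (1 - t) of the binomial law plus a squared bias; a = - n t gives the input for
    Chebyshev's inequality. *)
Lemma bern_sqr n a t :
  bern n (fun k => (k%:R + a) ^+ 2) t = n%:R * t * (1 - t) + (n%:R * t + a) ^+ 2.
Proof.
elim: n a => [|n IH] a /=; first by rewrite !mul0r !add0r.
rewrite [_ \o _](_ : _ = fun k => (k%:R + (1 + a)) ^+ 2); last first.
  by apply/funext => k /=; rewrite -natr1 addrA.
by rewrite !IH -natr1; ring.
Qed.

Lemma bern_dist_le n F G t : 0 <= t <= 1 ->
  (forall k, (k <= n)%N -> `|F k| <= G k) -> `|bern n F t| <= bern n G t.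
Proof.
move=> t01 FG; rewrite ler_norml -mulN1r -bernZ; apply/andP; split.
  apply: bern_le => // k /FG; rewrite ler_norml mulN1r => /andP[]//.
by apply: bern_le => // k /FG; rewrite ler_norml => /andP[].
Qed.

Lemma cos_antitone (x y : R) : 0 <= y -> y <= x -> x <= pi -> cos x <= cos y.
Proof.
move=> y0 yx xpi; rewrite leNgt ltr_cos ?in_itv/= -?leNgt//.
  by rewrite xpi (le_trans y0).
by rewrite y0 (le_trans yx).
Qed.

(** With midpoint A and half distance H, |A| + H <= pi / 2 gives cos A >= sin H, so the difference 2
    cos A sin H is at least 2 sin^2 H = 1 - cos (a - b). *)
Lemma sin_sub_ge (a b eta : R) : - (pi / 2) <= a <= pi / 2 -> - (pi / 2) <= b <= pi / 2 ->
  0 <= eta -> eta <= `|a - b| -> 1 - cos eta <= `|sin a - sin b|.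
Proof.
move=> ha hb eta0; wlog ab : a b ha hb / b <= a.
  move=> H; have [ab|/ltW ba] := leP b a; first exact: H.
  by rewrite distrC (distrC (sin a)); exact: H.
rewrite ger0_norm ?subr_ge0// => etaab.
pose A := (a + b) / 2; pose H := (a - b) / 2.
have sE : sin a - sin b = 2 * cos A * sin H.
  rewrite (_ : a = A + H); last by rewrite /A /H; field.
  rewrite [in sin b](_ : b = A - H); last by rewrite /A /H; field.
  by rewrite sinD sinB; ring.
have pi0 := pi_gt0 R.
have H0 : 0 <= H <= pi / 2 by rewrite /H; apply/andP; split; lra.
have sH : 0 <= sin H.
  by apply: sin_ge0_pi; move: H0; lra.
have cA : sin H <= cos A.
  have -> : cos A = cos `|A| by case: (ger0P A) => _; rewrite ?cosN.
  rewrite -cosBpihalf -cosN opprB; apply: cos_antitone; rewrite ?normr_ge0//.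
    by rewrite ler_norml /A /H; apply/andP; split; lra.
  by rewrite /H; lra.
apply: le_trans (ler_norm _); rewrite sE.
apply: (@le_trans _ _ (2 * sin H * sin H)); last first.
  by rewrite ler_wpM2r// ler_wpM2l.
have cE : cos (a - b) = 1 - 2 * sin H * sin H.
  rewrite (_ : a - b = H + H); last by rewrite /H; field.
  by rewrite cosD -!expr2 cos2sin2 -mulrA -expr2; ring.
have : cos (a - b) <= cos eta.
  by apply: cos_antitone => //; lra.
by rewrite cE; lra.
Qed.

Lemma uniform_continuity_segment (f : R -> R) (a b eps : R) : continuous f -> 0 < eps ->
  exists2 eta, 0 < eta & forall x y, a <= x <= b -> `|x - y| < eta -> `|f x - f y| <= eps.
Proof.
move=> cf eps0.
have := @segment_compact R a b; rewrite compact_near_coveringP.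
move=> /(_ _ (0 : R)^'+ (fun eta x => forall y, `|x - y| < eta -> `|f x - f y| <= eps)).
case.
  move=> x _.
  have e2 : 0 < eps / 2 by rewrite divr_gt0.
  have /cvgrPdist_lt /(_ _ e2) [r /= r0 Hr] := cf x.
  exists (ball x (r / 2), [set e | e < r / 2]).
    split => /=; first by apply: nbhsx_ballx; rewrite divr_gt0.
    by apply: nbhs_right_lt; rewrite divr_gt0.
  move=> [x' e] [/= xx' er] y x'y.
  rewrite /ball/= in xx'.
  rewrite (_ : f x' - f y = (f x - f y) - (f x - f x')); last by ring.
  apply: le_trans (ler_normB _ _) _; rewrite (splitr eps) lerD// ltW//.
    apply: Hr => /=; rewrite (_ : x - y = (x - x') + (x' - y)); last by ring.
    by apply: le_lt_trans (ler_normD _ _) _; lra.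
  by apply: Hr => /=; lra.
move=> r /= r0 Hr; exists (r / 2); first by rewrite divr_gt0.
move=> x y xab; apply: (Hr (r / 2)); rewrite ?divr_gt0//=.
by rewrite sub0r normrN gtr0_norm ?divr_gt0//; lra.
Qed.

(* The frequency c = pi / (2 L) makes x |-> sin (c x) a homeomorphism from [-L, L]
   onto [-1, 1], through which Bernstein's approximation theorem is transported;
   the approximant is a trigonometric polynomial bounded by M on the whole line. *)
Lemma sine_approximation (f : R -> R) (M L eps : R) : continuous f ->
  (forall x, `|f x| <= M) -> 0 < L -> 0 < eps ->
  exists c n F, (forall k, `|F k| <= M) /\
    forall x, - L <= x <= L -> `|bern n F ((1 + sin (c * x)) / 2) - f x| <= eps.
Proof.
move=> cf fM L0 eps0; have e2 : 0 < eps / 2 by rewrite divr_gt0.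
have M0 : 0 <= M by exact: le_trans (fM 0).
have pi0 := pi_gt0 R.
have [eta eta0 Heta] := uniform_continuity_segment (- L) L cf e2.
pose c := pi / 2 / L; have c0 : 0 < c by rewrite !divr_gt0.
have cL x : - L <= x <= L -> - (pi / 2) <= c * x <= pi / 2.
  move=> /andP[xl xr]; rewrite -(mulfVK (lt0r_neq0 L0) (pi / 2)) -/c -mulrN.
  by rewrite !ler_pM2l// xl xr.
(* Points of [-L, L] at distance eta have angles at distance c eta, capped at pi to stay where the
   cosine is monotone; [del] is the gap forced between their sines. *)
pose th := Num.min pi (c * eta).
have th0 : 0 < th by rewrite lt_min pi0 mulr_gt0.
pose del := 1 - cos th.
have del0 : 0 < del.
  have thpi : 0 <= th <= pi by rewrite (ltW th0)/= ge_min lexx.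
  by rewrite subr_gt0 -[X in _ < X]cos0 ltr_cos ?in_itv/= ?lexx ?(ltW pi0).
pose n := (Num.truncn (8 * M / (del ^+ 2 * (eps / 2)))).+1.
have n0 : (0 : R) < n%:R by rewrite ltr0n.
have nP : 8 * M / (del ^+ 2 * (eps / 2)) < n%:R := truncnS_gt _.
clearbody n.
have c8 : 0 <= 8 * M / (del ^+ 2 * n%:R ^+ 2).
  by apply: divr_ge0; apply: mulr_ge0 => //; exact: sqr_ge0.
pose sk k : R := 2 * k%:R / n%:R - 1.
pose F k := f (asin (sk k) / c).
exists c, n, F; split=> [k|x xL]; first exact: fM.
pose t := (1 + sin (c * x)) / 2.
have t01 : 0 <= t <= 1.
  by rewrite /t; have := sin_geN1 (c * x); have := sin_le1 (c * x); move=> *; apply/andP; split; lra.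
have -> : bern n F t - f x = bern n (fun k => F k + - f x) t.
  by rewrite bernD bern_cst.
(* For a node far from x, |F k - f x| <= 2 M <= 2 M (gap / del)^2, where the gap between the sines
   is 2 (k - n t) / n. Hence the 8 M, and n large enough to beat the binomial variance. *)
have FB k : (k <= n)%N -> `|F k + - f x| <=
    eps / 2 + 8 * M / (del ^+ 2 * n%:R ^+ 2) * (k%:R + - (n%:R * t)) ^+ 2.
  move=> kn.
  have sk1 : -1 <= sk k <= 1.
    rewrite /sk lerDr lerBlDr -mulrA mulr_ge0 ?divr_ge0//= mulrA ler_pdivrMr//.
    have : k%:R <= n%:R :> R by rewrite ler_nat.
    by lra.
  have ask : - (pi / 2) <= asin (sk k) <= pi / 2 by rewrite asin_geNpi2// asin_lepi2.
  have sE : (k%:R + - (n%:R * t)) ^+ 2 = n%:R ^+ 2 / 4 * (sk k - sin (c * x)) ^+ 2.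
    by rewrite /t /sk; field; rewrite gt_eqF.
  have [close|far] := ltP `|x - asin (sk k) / c| eta.
    rewrite -[leLHS]normrN opprB; apply: le_trans (Heta _ _ xL close) _.
    by rewrite lerDl mulr_ge0// sqr_ge0.
  have dle : del <= `|sk k - sin (c * x)|.
    rewrite -[sk k in X in _ <= X]asinK ?in_itv//.
    apply: sin_sub_ge => //; [exact: cL|exact: ltW|].
    rewrite ge_min; apply/orP; right; rewrite distrC.
    rewrite -(ler_pM2l c0) in far; apply: le_trans far _.
    rewrite -[X in X * _]gtr0_norm// -normrM mulrBr mulrCA mulfV ?mulr1//.
    by rewrite gt_eqF.
  have d2 : del ^+ 2 <= (sk k - sin (c * x)) ^+ 2.
    by rewrite -[leRHS]real_normK ?num_real//; apply: lerXn2r; rewrite ?nnegrE ?(ltW del0).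
  apply: (@le_trans _ _ (2 * M)).
    by apply: le_trans (ler_normB _ _) _; have := fM (asin (sk k) / c); have := fM x; rewrite /F; lra.
  apply: (@le_trans _ _ (2 * M / del ^+ 2 * (sk k - sin (c * x)) ^+ 2)).
    by rewrite mulrAC ler_pdivlMr ?exprn_gt0// ler_wpM2l// mulr_ge0.
  rewrite sE; apply: (@le_trans _ _ (0 + 2 * M / del ^+ 2 * (sk k - sin (c * x)) ^+ 2)).
    by rewrite add0r.
  apply: lerD; first exact: ltW.
  by apply: le_of_eq; field; rewrite !gt_eqF.
apply: le_trans (bern_dist_le t01 FB) _.
rewrite bernD bern_cst bernZ bern_sqr addrN expr0n addr0.
have n1 : 8 * M / (del ^+ 2 * n%:R) <= eps / 2.
  rewrite ler_pdivrMr ?mulr_gt0 ?exprn_gt0//.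
  move: nP; rewrite ltr_pdivrMr ?mulr_gt0 ?exprn_gt0// => /ltW.
  by move=> H; apply: le_trans H _; apply: le_of_eq; ring.
have t1 : t * (1 - t) <= 1 by move/andP: t01 => [t0 t1]; nra.
have -> : 8 * M / (del ^+ 2 * n%:R ^+ 2) * (n%:R * t * (1 - t)) =
    8 * M / (del ^+ 2 * n%:R) * (t * (1 - t)).
  by field; rewrite !gt_eqF.
rewrite [leRHS](splitr eps) lerD2l; apply: le_trans n1.
rewrite ler_piMr//; apply: divr_ge0; apply: mulr_ge0 => //; exact: sqr_ge0.
Qed.

End bernstein.

(** * Weak convergence from sines and bounded second moments *)

Section weak_convergence.
Context {R : realType} d (T : measurableType d) (P : probability T R).
Variables (Z : nat -> T -> R) (nu : probability (measurableTypeR R) R).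
Hypothesis mZ : forall m, (0 < m)%N -> measurable_fun setT (Z m).
Variable B : R.
Hypothesis iZ2 : forall m, (0 < m)%N -> P.-integrable setT (fun w => (Z m w ^+ 2)%:E).
Hypothesis Z2B : forall m, (0 < m)%N -> \int[P]_w Z m w ^+ 2 <= B.
Hypothesis inu2 : nu.-integrable setT (fun x => (x ^+ 2)%:E).
Hypothesis nu2B : \int[nu]_x (x ^+ 2) <= B.
Hypothesis Zsin : forall u b, 0 <= u ->
  \int[P]_w sin (u * Z m w + b) @[m --> \oo] --> \int[nu]_x sin (u * x + b).

Let cvE (h : R -> R) := [/\ measurable_fun setT h, exists M, forall x, `|h x| <= M &
  \int[P]_w h (Z m w) @[m --> \oo] --> \int[nu]_x h x].

Let cvE_int h : cvE h ->
  (forall m, (0 < m)%N -> P.-integrable setT (EFin \o (fun w => h (Z m w)))) /\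
  nu.-integrable setT (EFin \o h).
Proof.
move=> [mh [M hM] _]; split=> [m m0|].
  apply: (@bounded_integrable _ _ _ _ _ M) => //.
  exact: (measurableT_comp mh (mZ m0)).
exact: (@bounded_integrable _ _ _ _ _ M).
Qed.

Let cvED h k : cvE h -> cvE k -> cvE (fun x => h x + k x).
Proof.
move=> ch ck; have [ih jh] := cvE_int ch; have [ik jk] := cvE_int ck.
move: ch ck => [mh [M hM] ch] [mk [M' kM'] ck]; split.
- exact: measurable_funD.
- by exists (M + M') => x; rewrite (le_trans (ler_normD _ _))// lerD.
rewrite RintegralD//; apply: cvg_trans (cvgD ch ck).
apply: near_eq_cvg; exists 1%N => // m /= m0; rewrite RintegralD//.
  exact: ih.
exact: ik.
Qed.

Let cvEZ c h : cvE h -> cvE (fun x => c * h x).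
Proof.
move=> ch; have [ih jh] := cvE_int ch.
move: ch => [mh [M hM] ch]; split.
- exact: measurable_funM.
- by exists (`|c| * M) => x; rewrite normrM ler_wpM2l.
rewrite RintegralZl//; apply: cvg_trans (cvgM (cvg_cst c) ch).
apply: near_eq_cvg; exists 1%N => // m /= m0; rewrite RintegralZl//.
exact: ih.
Qed.

Let cvE_sin u b : cvE (fun x => sin (u * x + b)).
Proof.
wlog u0 : u b / 0 <= u.
  move=> H; have [u0|/ltW u0] := leP 0 u; first exact: H.
  rewrite (_ : (fun x => _) = (fun x : R => sin ((- u) * x + (pi - b)))).
    by apply: H; rewrite oppr_ge0.
  apply/funext => x; rewrite (_ : - u * x + (pi - b) = - (u * x + b) + pi).
    by rewrite sinDpi sinN opprK.
  by ring.
split; last exact: Zsin.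
  have ms : measurable_fun setT (sin : R -> R).
    by apply: continuous_measurable_fun; exact: continuous_sin.
  apply: (measurableT_comp ms).
  by apply: measurable_funD => //; exact: measurable_funM.
by exists 1 => x; rewrite ler_norml sin_geN1 sin_le1.
Qed.

(** The factor sin (u x + b) with free u and b makes the property stable under multiplication by sin
    (c x), by the product-to-sum formula; polynomials in sin (c x) are then reached by induction. *)
Let good (g : R -> R) := forall u b, cvE (fun x => g x * sin (u * x + b)).

Let goodD g h : good g -> good h -> good (fun x => g x + h x).
Proof.
move=> gg gh u b; have := cvED (gg u b) (gh u b).
by congr cvE; apply/funext => x; rewrite mulrDl.
Qed.

Let goodZ c g : good g -> good (fun x => c * g x).
Proof.
move=> gg u b; have := cvEZ c (gg u b).
by congr cvE; apply/funext => x; rewrite mulrA.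
Qed.

Let good_sin c g : good g -> good (fun x => sin (c * x) * g x).
Proof.
move=> gg u b; have := cvEZ (1 / 2) (cvED (gg (u - c) (b + pi / 2))
  (cvEZ (-1) (gg (u + c) (b + pi / 2)))).
congr cvE; apply/funext => x.
rewrite (_ : (u - c) * x + (b + pi / 2) = (u * x + b - c * x) + pi / 2); last by ring.
rewrite (_ : (u + c) * x + (b + pi / 2) = (u * x + b + c * x) + pi / 2); last by ring.
by rewrite !sinDpihalf; move: (u * x + b) => y; rewrite cosB cosD; field.
Qed.

Let good_bern c n F : good (fun x => bern n F ((1 + sin (c * x)) / 2)).
Proof.
elim: n F => [|n IH] F /=.
  by move=> u b; exact: cvEZ (cvE_sin u b).
have gt G : good (fun x => (1 / 2) * bern n G ((1 + sin (c * x)) / 2) +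
    (1 / 2) * (sin (c * x) * bern n G ((1 + sin (c * x)) / 2))).
  by apply: goodD; apply: goodZ => //; exact: good_sin.
have := goodD (gt (F \o S)) (goodD (IH F) (goodZ (-1) (gt F))).
by congr good; apply/funext => x; field.
Qed.

Let cvE_bern c n F : cvE (fun x => bern n F ((1 + sin (c * x)) / 2)).
Proof.
have := good_bern c n F 0 (pi / 2).
by congr cvE; apply/funext => x; rewrite mul0r add0r sin_pihalf mulr1.
Qed.

Lemma weak_convergence_of_trig : cvg_in_distribution P Z nu.
Proof.
move=> f cf [M0 [_ fM0]].
have fM x : `|f x| <= `|M0| + 1.
  by apply: fM0 => //; have := ler_norm M0; lra.
set M := `|M0| + 1 in fM.
have M_gt0 : 0 < M by rewrite /M; have := normr_ge0 M0; lra.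
have B0 : 0 <= B by apply: le_trans nu2B; apply: Rintegral_ge0 => x _; exact: sqr_ge0.
have mf : measurable_fun setT f by exact: continuous_measurable_fun.
have inf : nu.-integrable setT (EFin \o f) by exact: (@bounded_integrable _ _ _ _ _ M).
have ifZ m : (0 < m)%N -> P.-integrable setT (EFin \o (fun w => f (Z m w))).
  move=> m0; apply: (@bounded_integrable _ _ _ _ _ M) => //.
  exact: (measurableT_comp mf (mZ m0)).
suff cv : \int[P]_w f (Z m w) @[m --> \oo] --> \int[nu]_x f x.
  have -> : (\int[nu]_x (f x)%:E = (\int[nu]_x f x)%:E)%E.
    by rewrite fineK// integrable_fin_num.
  have cv' : (\int[P]_w f (Z m w))%:E @[m --> \oo] --> (\int[nu]_x f x)%:E.
    by apply: cvg_EFin; [exact: nearW|exact: cv].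
  apply: cvg_trans cv'; apply: near_eq_cvg; exists 1%N => // m /= m0.
  rewrite fineK ?integrable_fin_num//; last exact: ifZ.
  by rewrite unlock.
apply/cvgrPdist_le => eps eps0.
(* Replacing f by its approximant g costs 2 e under each of the two laws, and e remains for the
   convergence of the integrals of g. Outside [-L, L] the error 2 M is at most 2 M x^2 / L^2, and
   [L] is chosen so that the second moments make this at most e. *)
pose e := eps / 5; have e0 : 0 < e by rewrite divr_gt0.
pose L := Num.sqrt (2 * M * B / e + 1).
have L2 : L ^+ 2 = 2 * M * B / e + 1.
  by rewrite sqr_sqrtr// addr_ge0// divr_ge0 ?(ltW e0)// !mulr_ge0// ltW.
have L0 : 0 < L.
  by rewrite sqrtr_gt0 ltr_wpDl// divr_ge0 ?(ltW e0)// !mulr_ge0// ltW.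
have [c [n [F [FM approx]]]] := sine_approximation cf fM L0 e0.
pose g x := bern n F ((1 + sin (c * x)) / 2).
have cg : cvE g := cvE_bern c n F.
have [igZ ing] := cvE_int cg.
have gM x : `|g x| <= M.
  rewrite -[leRHS](bern_cst n M ((1 + sin (c * x)) / 2)).
  apply: bern_dist_le => // ; have := sin_geN1 (c * x); have := sin_le1 (c * x).
  by move=> *; apply/andP; split; lra.
have ptw x : `|f x - g x| <= e + 2 * M / L ^+ 2 * x ^+ 2.
  have x2 : 0 <= 2 * M / L ^+ 2 * x ^+ 2.
    by rewrite mulr_ge0 ?sqr_ge0// divr_ge0 ?sqr_ge0// mulr_ge0// ltW.
  have [xL|xL] := boolP (- L <= x <= L).
    by rewrite distrC; apply: le_trans (approx x xL) _; rewrite lerDl.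
  have Lx : L ^+ 2 <= x ^+ 2.
    rewrite -[x ^+ 2]real_normK ?num_real//; apply: lerXn2r; rewrite ?nnegrE ?(ltW L0)//.
    by move: xL; rewrite -ler_norml -ltNge => /ltW.
  apply: (@le_trans _ _ (2 * M)).
    by apply: le_trans (ler_normB _ _) _; have := fM x; have := gM x; lra.
  rewrite mulrAC; apply: (@le_trans _ _ (0 + 2 * M * x ^+ 2 / L ^+ 2)).
    by rewrite add0r ler_pdivlMr ?exprn_gt0// ler_wpM2l// mulr_ge0// ltW.
  by rewrite lerD2r ltW.
have bnd : e + 2 * M / L ^+ 2 * B <= 2 * e.
  have : 2 * M / L ^+ 2 * B <= e.
    rewrite mulrAC ler_pdivrMr ?exprn_gt0// L2.
    rewrite (_ : e * _ = 2 * M * B + e); last by field; rewrite gt_eqF.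
    by rewrite lerDl ltW.
  by lra.
have [_ _ cgE] := cg.
have /cvgrPdist_le /(_ _ e0) := cgE; apply: filter_app.
have close d' (T' : measurableType d') (Q : probability T' R) (Y : T' -> R) :
    Q.-integrable setT (fun w => (Y w ^+ 2)%:E) -> \int[Q]_w Y w ^+ 2 <= B ->
    Q.-integrable setT (EFin \o (fun w => f (Y w))) ->
    Q.-integrable setT (EFin \o (fun w => g (Y w))) ->
    `|\int[Q]_w f (Y w) - \int[Q]_w g (Y w)| <= 2 * e.
  move=> iY2 YB ifY igY; rewrite -RintegralB//.
  have iB := integrableB measurableT ifY igY.
  have iZ := integrableZl measurableT (2 * M / L ^+ 2) iY2.
  have ic := finite_measure_integrable_cst Q e measurableT.
  have iD := integrableD measurableT ic iZ.
  apply: le_trans (le_normr_Rintegral _ iB) _ => //.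
  apply: (@le_trans _ _ (\int[Q]_w (e + 2 * M / L ^+ 2 * Y w ^+ 2))).
    by apply: le_Rintegral => [//|||w _]; [exact: integrable_norm iB| |exact: ptw].
  rewrite RintegralD//.
  have -> : \int[Q]_w (2 * M / L ^+ 2 * Y w ^+ 2) = 2 * M / L ^+ 2 * \int[Q]_w Y w ^+ 2.
    by rewrite RintegralZl.
  rewrite Rintegral_cst// (_ : fine _ = 1); last exact: (congr1 fine (probability_setT Q)).
  rewrite mulr1; apply: le_trans bnd; rewrite lerD2l ler_wpM2l//.
  by rewrite divr_ge0 ?sqr_ge0// mulr_ge0// ltW.
exists 1%N => // m /= m0 gm.
have H1 := close _ _ nu id inu2 nu2B inf ing.
have H2 := close _ _ P (Z m) (iZ2 m0) (Z2B m0) (ifZ m m0) (igZ m m0).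
move: H1 H2 gm; rewrite !ler_norml /e.
set a1 := \int[nu]_x f x; set a2 := \int[nu]_x g x.
set a3 := \int[P]_w f _; set a4 := \int[P]_w g _; lra.
Qed.

End weak_convergence.

(** * The normal law solves the same differential equation exactly *)

Section normal_characteristic.
Context {R : realType} (s : R).
Hypothesis s0 : 0 < s.
Local Notation mu := (@lebesgue_measure R).
Local Notation nu := (normal_prob 0 s : probability (measurableTypeR R) R).

Let g (x : R) := normal_pdf 0 s x.

Let gE x : g x = normal_peak s * expR (- x ^+ 2 / (2 * s ^+ 2)).
Proof. by rewrite /g normal_pdfE ?gt_eqF// /normal_fun subr0 [2 * _]mulr_natl. Qed.

Lemma ge0_integral_normal (f : R -> \bar R) : (forall x, 0 <= f x)%E ->
  measurable_fun setT f ->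
  (\int[nu]_x f x = \int[mu]_x (f x * (g x)%:E))%E.
Proof.
move=> f0 mf; have dom := normal_prob_dominates (0 : R) s.
have numu : nu `<< mu := dom.
rewrite -(Radon_Nikodym_SigmaFinite.change_of_variables numu)//.
have iRN := Radon_Nikodym_SigmaFinite.f_integrable numu.
apply: ae_eq_integral => //.
- by apply: emeasurable_funM => //; exact: measurable_int iRN.
- apply: emeasurable_funM => //; apply/measurable_EFinP.
  exact: measurable_normal_pdf.
apply: ae_eqe_mul2l; apply: integral_ae_eq => //.
  by apply/measurable_EFinP; exact: measurable_normal_pdf.
by move=> E _ mE; rewrite -(Radon_Nikodym_SigmaFinite.f_integral numu).
Qed.

(** Doubling the standard deviation absorbs the factor x^2: with y = x^2 / (8 s^2) the exponent is -
    4 y, against - y for the wider density, and y exp (- 3 y) <= 1. *)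
Let sq_g_le x : x ^+ 2 * g x <= 8 * s ^+ 2 * normal_peak s / normal_peak (2 * s) *
  normal_pdf 0 (2 * s) x.
Proof.
have s2 : 2 * s != 0 by rewrite mulf_neq0// gt_eqF.
rewrite gE (normal_pdfE _ s2) /normal_fun subr0.
have pk := normal_peak_gt0 s2.
set y := x ^+ 2 / (8 * s ^+ 2).
have e1 : - x ^+ 2 / (2 * s ^+ 2) = - y + - (3 * y) by rewrite /y; field; rewrite gt_eqF.
have e2 : - x ^+ 2 / ((2 * s) ^+ 2 *+ 2) = - y by rewrite /y; field; rewrite gt_eqF.
have e3 : x ^+ 2 = 8 * s ^+ 2 * y by rewrite /y; field; rewrite gt_eqF.
have y0 : 0 <= y by rewrite divr_ge0 ?sqr_ge0// mulr_ge0 ?sqr_ge0.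
rewrite e1 e2 expRD e3.
have ye : y * expR (- (3 * y)) <= 1.
  rewrite expRN ler_pdivrMr ?expR_gt0// mul1r.
  by apply: le_trans (expR_ge1Dx _); lra.
rewrite (_ : _ / normal_peak (2 * s) * _ =
    8 * s ^+ 2 * normal_peak s * expR (- y)); last by field; rewrite gt_eqF.
rewrite (_ : 8 * s ^+ 2 * y * _ = 8 * s ^+ 2 * normal_peak s * expR (- y) * (y * expR (- (3 * y))));
  last by ring.
rewrite ler_piMr// mulr_ge0 ?expR_ge0// mulr_ge0 ?normal_peak_ge0//.
by rewrite mulr_ge0 ?sqr_ge0.
Qed.

Let isq : mu.-integrable setT (fun x : R => (x ^+ 2 * g x)%:E).
Proof.
have i2 := integrableZl measurableT (8 * s ^+ 2 * normal_peak s / normal_peak (2 * s))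
  (integrable_normal_pdf 0 (2 * s)).
apply: (le_integrable measurableT _ _ i2) => [|x _].
  apply/measurable_EFinP/measurable_funM; last exact: measurable_normal_pdf.
  exact: exprn_measurable.
rewrite -EFinM /= lee_fin ger0_norm; last by rewrite mulr_ge0 ?sqr_ge0 ?normal_pdf_ge0.
by apply: le_trans (sq_g_le x) _; exact: ler_norm.
Qed.

Lemma integrable_sqr_normal : nu.-integrable setT (fun x => (x ^+ 2)%:E).
Proof.
apply/integrableP; split; first by apply/measurable_EFinP; exact: exprn_measurable.
rewrite ge0_integral_normal//; last first.
  by apply: measurableT_comp => //; apply/measurable_EFinP; exact: exprn_measurable.
have /integrableP[_] := isq; congr (_ < _)%E.
apply: eq_integral => x _; rewrite /= (ger0_norm (sqr_ge0 x)) ger0_norm//.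
by apply: mulr_ge0; [exact: sqr_ge0|exact: normal_pdf_ge0].
Qed.

Lemma integral_normal (f : R -> R) : measurable_fun setT f ->
  \int[nu]_x f x = \int[mu]_x (f x * g x).
Proof.
move=> mf; congr fine; have mfE : measurable_fun setT (EFin \o f).
  exact/measurable_EFinP.
rewrite integralE ge0_integral_normal//; last exact: measurable_funepos.
rewrite ge0_integral_normal//; last exact: measurable_funeneg.
rewrite [RHS]integralE.
congr (_ - _)%E; apply: eq_integral => x _.
  have := congr1 (fun h => h x) (ge0_funeposM (EFin \o f) (normal_pdf_ge0 0 s x)).
  rewrite muleC => <-; rewrite !funeposE /=; congr (maxe _ _).
  by rewrite -EFinM mulrC.
have := congr1 (fun h => h x) (ge0_funenegM (EFin \o f) (normal_pdf_ge0 0 s x)).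
rewrite muleC => <-; rewrite !funenegE /=; congr (maxe _ _).
by rewrite mulrC.
Qed.

Let is_derive_g (x : R) : is_derive x (1 : R) g (- (x / s ^+ 2) * g x).
Proof.
rewrite (_ : g = fun x => normal_peak s * expR (- x ^+ 2 / (2 * s ^+ 2))); last first.
  by apply/funext => y; exact: gE.
apply: is_derive_eq; rewrite /GRing.scale/=; field; rewrite gt_eqF//.
Qed.

(** Integration by parts: the derivative [h] of cos (u x + b) g x, where g' = - (x / s^2) g, has
    integral 0 over the line. *)
Lemma normal_stein (u b : R) :
  \int[nu]_x (x * cos (u * x + b)) + u * s ^+ 2 * \int[nu]_x sin (u * x + b) = 0.
Proof.
pose F x := cos (u * x + b) * g x.
pose h x := - (u * sin (u * x + b) * g x) - x / s ^+ 2 * cos (u * x + b) * g x.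
have dF (x : R) : is_derive x (1 : R) F (h x).
  have dg := is_derive_g x.
  by apply: is_derive_eq; rewrite /GRing.scale/= /h; ring.
have cg : continuous g by apply: continuous_normal_pdf; rewrite gt_eqF.
have clin : continuous (fun x : R => u * x + b).
  by move=> x; apply: cvgD; [apply: cvgMr; exact: cvg_id|exact: cvg_cst].
have ccos : continuous (fun x : R => cos (u * x + b)).
  by move=> x; apply: (continuous_comp (clin x)); exact: continuous_cos.
have csin : continuous (fun x : R => sin (u * x + b)).
  by move=> x; apply: (continuous_comp (clin x)); exact: continuous_sin.
have ch : continuous h.
  move=> x; apply: cvgB.
    apply: cvgN; apply: cvgM; last exact: cg.
    by apply: cvgM; [exact: cvg_cst|exact: csin].
  apply: cvgM; last exact: cg.
  apply: cvgM; last exact: ccos.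
  by apply: cvgM; [exact: cvg_id|exact: cvg_cst].
have mcos : measurable_fun setT (fun x : R => cos (u * x + b)).
  exact: continuous_measurable_fun.
have msin : measurable_fun setT (fun x : R => sin (u * x + b)).
  exact: continuous_measurable_fun.
have mg : measurable_fun setT g by exact: measurable_normal_pdf.
have ig : mu.-integrable setT (fun x : R => (g x)%:E) by exact: integrable_normal_pdf.
have ixc : mu.-integrable setT (fun x : R => (x * cos (u * x + b) * g x)%:E).
  have i2 := integrableD measurableT ig isq.
  apply: (le_integrable measurableT _ _ i2) => [|x _].
    by apply/measurable_EFinP/measurable_funM => //; exact: measurable_funM.
  rewrite -EFinD /= lee_fin.
  have g0 := normal_pdf_ge0 0 s x; rewrite -/(g x) in g0.
  rewrite [leRHS]ger0_norm; last by rewrite addr_ge0// mulr_ge0// sqr_ge0.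
  rewrite !normrM (ger0_norm g0) -{2}[g x]mul1r -mulrDl ler_wpM2r//.
  have c1 : `|cos (u * x + b)| <= 1 by rewrite ler_norml cos_geN1 cos_le1.
  apply: le_trans (ler_wpM2l (normr_ge0 x) c1) _.
  rewrite -(real_normK (num_real x)); have := sqr_ge0 (`|x| - 1); nra.
have isn : mu.-integrable setT (fun x : R => (sin (u * x + b) * g x)%:E).
  apply: (le_integrable measurableT _ _ ig) => [|x _].
    by apply/measurable_EFinP/measurable_funM.
  rewrite /= lee_fin normrM ler_piMl//.
  by rewrite ler_norml sin_geN1 sin_le1.
have hE : h = (fun x => (- u) * (sin (u * x + b) * g x) +
    (- s ^- 2) * (x * cos (u * x + b) * g x)).
  by apply/funext => x; rewrite /h; field; rewrite gt_eqF.
have i1 := integrableZl measurableT (- u) isn.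
have i2 := integrableZl measurableT (- s ^- 2) ixc.
have ih : mu.-integrable setT (EFin \o h).
  by rewrite hE; have := integrableD measurableT i1 i2.
have cF : continuous F.
  by move=> x; apply: cvgM; [exact: ccos|exact: cg].
pose I (n : nat) : set R := [set` `[- n%:R : R, n%:R]].
have FT n : (0 < n)%N ->
    (\int[mu]_(x in I n) (h x)%:E = (F n%:R%R - F (- n%:R)%R)%:E)%E.
  move=> n0; rewrite EFinB; apply: continuous_FTC2 => //.
  - by rewrite gtrN// ltr0n.
  - exact: continuous_subspaceT.
  - split.
    + by move=> x _; exact: ex_derive.
    + exact: cvg_at_right_filter (cF _).
    + exact: cvg_at_left_filter (cF _).
  - by move=> x _; rewrite derive1E; exact: derive_val.
pose hn (n : nat) := ((EFin \o h) \_ (I n))%E.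
have [_ _ cvh] : [/\ mu.-integrable setT (EFin \o h),
    [sequence \int[mu]_x (`|hn n x - (EFin \o h) x|)]_n @ \oo --> 0%E &
    [sequence \int[mu]_x (hn n x)]_n @ \oo --> \int[mu]_x ((EFin \o h) x)]%E.
  apply: (@dominated_convergence _ _ _ mu setT measurableT hn (EFin \o h)
    (fun x => `|(h x)%:E|%E)).
  - move=> n; apply/(measurable_restrictT _ _).1 => //.
      exact: measurable_itv.
    by apply: measurable_funTS; apply/measurable_EFinP; exact: continuous_measurable_fun.
  - by apply/measurable_EFinP; exact: continuous_measurable_fun.
  - apply: aeW => x _; apply: cvg_near_cst.
    exists (Num.truncn `|x|).+1 => // n /= xn; rewrite /hn patchE ifT// inE /I /= in_itv /=.
    rewrite -ler_norml; apply: ltW; apply: lt_le_trans (truncnS_gt _) _.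
    by rewrite ler_nat.
  - exact: integrable_abse.
  - apply: aeW => x n _; rewrite /hn patchE; case: ifP => // _.
    by rewrite abse0.
have cF0 : (F n%:R - F (- n%:R))%:E @[n --> \oo] --> 0%:E.
  pose c := normal_peak s + 8 * s ^+ 2 * normal_peak s.
  (* Since (1 + x^2) g is bounded, the boundary terms at n and - n are O(1 / n). *)
  have gb x : (1 + x ^+ 2) * g x <= c.
    rewrite mulrDl mul1r lerD//; first by rewrite normal_pdf_ub// gt_eqF.
    apply: le_trans (sq_g_le x) _.
    have pk : 0 < normal_peak (2 * s) by rewrite normal_peak_gt0// mulf_neq0// gt_eqF.
    rewrite mulrAC ler_pdivrMr// ler_wpM2l ?normal_pdf_ub ?mulf_neq0 ?gt_eqF//.
    by apply: mulr_ge0; [apply: mulr_ge0 => //; exact: sqr_ge0|exact: normal_peak_ge0].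
  have Fb x (n : nat) : x ^+ 2 = n%:R ^+ 2 -> `|F x| <= 2 * c * harmonic n.
    move=> xn; have g0 := normal_pdf_ge0 0 s x; rewrite -/(g x) in g0.
    apply: (@le_trans _ _ (g x)).
      by rewrite /F normrM (ger0_norm g0) ler_piMl// ler_norml cos_geN1 cos_le1.
    rewrite /harmonic/= ler_pdivlMr; last by rewrite ltr0n.
    have n2 : n.+1%:R <= 2 * (1 + x ^+ 2).
      by rewrite xn -natr1; have := ler0n R n; have := sqr_ge0 (n%:R - 1 : R); nra.
    apply: le_trans (ler_wpM2l g0 n2) _.
    by have := gb x; lra.
  apply: cvg_EFin; first exact: nearW.
  apply: (@cvg_of_dist_le _ _ (fun n => 4 * c * harmonic n)).
    move=> n; rewrite /= subr0; apply: le_trans (ler_normB _ _) _.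
    rewrite (_ : 4 * c / _ = 2 * c * harmonic n + 2 * c * harmonic n); last first.
      by rewrite /harmonic/=; ring.
    by apply: lerD; apply: Fb => //; rewrite sqrrN.
  by rewrite -(mulr0 (4 * c)); apply: cvgMr; exact: cvg_harmonic.
have h0 : \int[mu]_x h x = 0.
  suff E : (\int[mu]_x (EFin \o h) x = 0%:E)%E by rewrite /Rintegral [X in fine X]E.
  apply: (cvg_unique _ cvh) => //.
  apply: cvg_trans cF0; apply: near_eq_cvg; exists 1%N => // n /= n0.
  by rewrite -FT// /hn integral_mkcond.
have int1 : \int[nu]_x (x * cos (u * x + b)) = \int[mu]_x (x * cos (u * x + b) * g x).
  by rewrite integral_normal//; exact: measurable_funM.
have int2 : \int[nu]_x sin (u * x + b) = \int[mu]_x (sin (u * x + b) * g x).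
  by rewrite integral_normal.
move: h0; rewrite hE RintegralD// RintegralZl// RintegralZl// int1 int2 => h0.
have s2 : - s ^- 2 != 0 by rewrite oppr_eq0 invr_eq0 expf_neq0// gt_eqF.
apply: (mulfI s2); rewrite mulr0 -[RHS]h0; field; rewrite gt_eqF//.
Qed.

(** The case eps = 0 of [charfun_ode], for the identity under the normal law. *)
Lemma normal_charfun (U b : R) : 0 <= U ->
  (\int[nu]_x sin (U * x + b)) * expR (s ^+ 2 * U ^+ 2 / 2) = sin b.
Proof.
move=> U0; apply/eqP; rewrite -subr_eq0 -normr_le0.
have mid : measurable_fun setT (id : R -> R) by [].
have := @charfun_ode _ _ _ nu id mid integrable_sqr_normal (s ^+ 2) U 0 b U0.
rewrite mulr0 mul0r; apply => u _.
by rewrite normal_stein normr0.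
Qed.

End normal_characteristic.

Section centered_normal_facts.
Context {R : realType} (v : R).
Hypothesis v0 : 0 <= v.

Lemma integrable_sqr_centered_normal :
  (centered_normal v).-integrable setT (fun x => (x ^+ 2)%:E).
Proof.
rewrite /centered_normal; have [_|vn0] := eqVneq v 0; last first.
  by apply: integrable_sqr_normal; rewrite sqrtr_gt0 lt_neqAle eq_sym vn0.
apply/integrableP; split.
  by apply/measurable_EFinP; exact: exprn_measurable.
rewrite integral_dirac//; first by rewrite diracT mul1e ltry.
by apply: measurableT_comp => //; apply/measurable_EFinP; exact: exprn_measurable.
Qed.

Lemma centered_normal_charfun (U b : R) : 0 <= U ->
  (\int[centered_normal v]_x sin (U * x + b)) * expR (v * U ^+ 2 / 2) = sin b.
Proof.
move=> U0; rewrite /centered_normal; have [->|vn0] := eqVneq v 0; last first.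
  have s0 : 0 < Num.sqrt v by rewrite sqrtr_gt0 lt_neqAle eq_sym vn0.
  by have := normal_charfun s0 b U0; rewrite sqr_sqrtr.
rewrite !mul0r expR0 mulr1 /Rintegral integral_dirac//; last first.
  have ms : measurable_fun setT (sin : R -> R).
    by apply: continuous_measurable_fun; exact: continuous_sin.
  apply/measurable_EFinP; apply: (measurableT_comp ms).
  by apply: measurable_funD => //; exact: measurable_funM.
by rewrite diracT mul1e/= mulr0 add0r.
Qed.

End centered_normal_facts.

(** * Lebesgue measure on row vectors *)

Section rowvec_measure.
Context {R : realType}.
Local Notation leb n := (@lebesgue_rV R n).

Definition box n (a : 'rV[R]_n) (r : R) : set 'rV[R]_n :=
  [set x | forall i, `|x 0 i - a 0 i| <= r].

Lemma normr_rV_le n (x : 'rV[R]_n) (r : R) : 0 <= r ->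
  (`|x| <= r) <-> forall i, `|x 0 i| <= r.
Proof.
move=> r0; split=> [xr i|xr].
  apply: le_trans xr; rewrite [leRHS]mx_normrE.
  exact: (le_bigmax _ (fun ij : 'I_1 * 'I_n => `|x ij.1 ij.2|) (0, i)).
by rewrite [leLHS]mx_normrE; apply: bigmax_le => // -[i j] _ /=; rewrite ord1.
Qed.

Lemma boxE n (a : 'rV[R]_n) (r : R) : 0 <= r ->
  box a r = [set x | `|x - a| <= r].
Proof.
move=> r0; apply/seteqP; split=> x /=.
  by move=> h; apply/normr_rV_le => // i; rewrite !mxE.
by move/(normr_rV_le _ r0) => h i; have := h i; rewrite !mxE.
Qed.

Lemma measurable_box n (a : 'rV[R]_n) (r : R) : measurable (box a r).
Proof.
rewrite (_ : box a r = \bigcap_(i in [set: 'I_n])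
    (fun x : 'rV[R]_n => x 0 i) @^-1` `[a 0 i - r, a 0 i + r]).
  apply: fin_bigcap_measurable; first exact: finite_finset.
  move=> i _; rewrite -[X in measurable X]setTI.
  exact: measurable_rowvec_coord.
apply/seteqP; split=> x h i.
  by move=> _ /=; rewrite in_itv/= -ler_distl; exact: h.
by have := h i I; rewrite /= in_itv/= -ler_distl.
Qed.

Lemma rowvec_cons_head n t (x : 'rV[R]_n) : rowvec_cons (t, x) 0 0 = t.
Proof.
rewrite /rowvec_cons /= (_ : 0 = lshift n (0 : 'I_1)); last exact/val_inj.
by apply: etrans (row_mxEl _ _ _ _) _; rewrite mxE mulr1n.
Qed.

Lemma rowvec_cons_tail n t (x : 'rV[R]_n) (i : 'I_n) :
  rowvec_cons (t, x) 0 (rshift 1 i) = x 0 i.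
Proof. exact: row_mxEr. Qed.

Lemma ord_cons n (Q : 'I_n.+1 -> Prop) :
  Q 0 -> (forall i : 'I_n, Q (rshift 1 i)) -> forall i, Q i.
Proof.
move=> Q0 QS i; case: (@split_ordP 1 n i) => j -> //.
by rewrite ord1 (_ : lshift n 0 = 0)//; exact/val_inj.
Qed.

Lemma lebesgue_box n (a : 'rV[R]_n) (r : R) : 0 <= r ->
  leb n (box a r) = ((2 * r) ^+ n)%:E.
Proof.
move=> r0; elim: n a => [|n IH] a.
  rewrite expr0 /= diracE mem_set// => i; by case: i.
have {}IH := IH (rsubmx (a : 'rV[R]_(1 + n))).
rewrite /= /lebesgue_succ /pushforward.
rewrite (_ : _ @^-1` _ = `[a 0 0 - r, a 0 0 + r]%classic `*`
    box (rsubmx (a : 'rV[R]_(1 + n))) r); last first.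
  apply/seteqP; split=> -[t x] /=.
    move=> h; split.
      by have := h 0; rewrite in_itv/= -ler_distl rowvec_cons_head.
    by move=> i; have := h (rshift 1 i); rewrite rowvec_cons_tail !mxE.
  rewrite in_itv/= -ler_distl => -[t1 h]; apply: ord_cons.
    by rewrite rowvec_cons_head.
  by move=> i; have := h i; rewrite rowvec_cons_tail !mxE.
have := product_measure1E (@lebesgue_measure R) (leb n) 
   (measurable_itv `[a 0 0 - r, a 0 0 + r]) (measurable_box (rsubmx (a : 'rV[R]_(1 + n))) r).
move=> /= ->; rewrite IH lebesgue_measure_itv/= lte_fin.
case: ifPn => [_|].
  rewrite -EFinD -EFinM exprS; congr (_ * _)%:E; ring.
rewrite -leNgt => rr; rewrite mul0e (_ : r = 0); last by lra.
by rewrite mulr0 expr0n.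
Qed.

(** K is the intersection over m of finite unions of closed boxes of radius 1 / (m + 1) centred in
    K, and boxes are measurable coordinate by coordinate. *)
Lemma compact_rV_measurable n (K : set 'rV[R]_n) : compact K -> measurable K.
Proof.
move=> cK.
have clK : closed K by apply: compact_closed => //; exact: norm_hausdorff.
pose r (m : nat) : R := m.+1%:R^-1.
have r0 m : 0 < r m by rewrite invr_gt0.
have cov m : exists s : seq 'rV[R]_n, {subset s <= K} /\
    K `<=` \big[setU/set0]_(a <- s) box a (r m).
  have := cK; rewrite compact_cover => /(_ _ K (fun a => ball a (r m))) [].
  - by move=> a _; exact: ball_open.
  - by move=> a Ka; exists a => //; exact: ballxx.
  move=> D' sD' cD'; exists (finmap.enum_fset D'); split => // x Kx.
  have [a aD'] := cD' x Kx; rewrite -ball_normE /= => xa.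
  rewrite -bigcup_seq; exists a => //.
  rewrite boxE ?(ltW (r0 m))//= distrC; exact: ltW.
have [s sP] := choice cov.
rewrite (_ : K = \bigcap_m \big[setU/set0]_(a <- s m) box a (r m)).
  apply: bigcap_measurable; first by exists 0%N.
  by move=> m _; apply: bigsetU_measurable => a _; exact: measurable_box.
apply/seteqP; split=> [x Kx m _|x h]; first exact: (sP m).2.
apply: clK => U /nbhs_ballP[e /= e0 eU].
have [m me] : exists m, r m < e.
  by have [m] := ltr_add_invr e0; rewrite add0r => ?; exists m.
have := h m I; rewrite -bigcup_seq => -[a /= am].
rewrite boxE ?(ltW (r0 m))//= => xa.
exists a; split; first by have /set_mem := (sP m).1 _ am.
by apply: eU; rewrite -ball_normE /=; exact: le_lt_trans me.
Qed.

Lemma closed_rV_measurable n (F : set 'rV[R]_n) : closed F -> measurable F.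
Proof.
move=> cF.
rewrite (_ : F = \bigcup_m (F `&` closed_ball_ Num.Def.normr 0 m%:R)).
  apply: bigcup_measurable => m _; apply: compact_rV_measurable.
  apply: bounded_closed_compact.
    exists m%:R; split; first exact: num_real.
    move=> M mM x [_] /=; rewrite /closed_ball_ /= sub0r normrN => xm.
    exact: le_trans (ltW mM).
  by apply: closedI => //; exact: closed_closed_ball_.
rewrite -setI_bigcupr; apply/seteqP; split=> [x Fx|x []//]; split => //.
exists (Num.truncn `|x|).+1 => //.
by rewrite /closed_ball_ /= sub0r normrN ltW// truncnS_gt.
Qed.

Lemma continuous_rV_measurable n (f : 'rV[R]_n -> R) :
  continuous f -> measurable_fun setT f.
Proof.
move=> cf; apply: (measurability _ (RGenCInfty.measurableE R)).
move=> _ [_ [x ->] <-]; rewrite setTI; apply: closed_rV_measurable.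
rewrite (_ : _ @^-1` _ = f @^-1` [set y | x <= y]); last first.
  by apply/seteqP; split=> y /=; rewrite in_itv/= andbT.
by apply: closed_comp; [move=> ? _; exact: cf|exact: closed_ge].
Qed.

Lemma compact_rV_fin n (K : set 'rV[R]_n) : compact K -> (leb n K < +oo)%E.
Proof.
move=> cK; have [M [_ hM]] := compact_bounded cK.
have M1 : M < `|M| + 1 by rewrite (le_lt_trans (ler_norm M))// ltrDl.
apply: le_lt_trans (_ : (leb n (box 0 (`|M| + 1)) < +oo)%E); last first.
  by rewrite lebesgue_box ?ltry// addr_ge0.
apply: le_measure; rewrite ?inE; [exact: compact_rV_measurable|exact: measurable_box|].
by move=> x Kx; rewrite boxE ?addr_ge0//= subr0; exact: hM M1 x Kx.
Qed.

End rowvec_measure.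

(** * Tonelli and translation invariance on row vectors *)

Section rowvec_integral.
Context {R : realType}.
Local Notation leb n := (@lebesgue_rV R n).
Local Open Scope ereal_scope.

Lemma integral_rV_succ n (f : 'rV[R]_n.+1 -> \bar R) :
  measurable_fun setT f -> (forall x, 0 <= f x) ->
  \int[leb n.+1]_x f x =
  \int[@lebesgue_measure R]_t \int[leb n]_x f (rowvec_cons (t, x)).
Proof.
move=> mf f0.
have := ge0_integral_pushforward (@measurable_rowvec_cons R n)
  (@lebesgue_measure R \x leb n) measurableT mf (fun x _ => f0 x).
rewrite preimage_setT => h; apply: etrans h _.
rewrite fubini_tonelli1//; last by move=> x; exact: f0.
exact: measurableT_comp mf (@measurable_rowvec_cons R n).
Qed.

Lemma measurable_rowvec_cons_pair n (f : 'rV[R]_n.+1 -> \bar R) :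
  measurable_fun setT f ->
  measurable_fun setT (fun p : measurableTypeR R * 'rV[R]_n => f (rowvec_cons p)).
Proof. by move=> mf; apply: measurableT_comp => //; exact: measurable_rowvec_cons. Qed.

Lemma measurable_row_mx m n :
  measurable_fun setT (fun p : 'rV[R]_m * 'rV[R]_n => row_mx p.1 p.2).
Proof.
apply: measurable_rowvecP => i; case: (split_ordP i) => j ->.
  under eq_fun do rewrite row_mxEl.
  apply: (measurableT_comp (measurable_rowvec_coord j)); exact: measurable_fst.
under eq_fun do rewrite row_mxEr.
apply: (measurableT_comp (measurable_rowvec_coord j)); exact: measurable_snd.
Qed.

Lemma row_mx_rowvec_cons m n t (x : 'rV[R]_m) (y : 'rV[R]_n) :
  rowvec_cons (t, row_mx x y) = row_mx (rowvec_cons (t, x)) y.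
Proof.
apply/rowP; apply: ord_cons.
  rewrite rowvec_cons_head [in RHS](_ : (0%R : 'I_(m + n).+1) = lshift n (0%R : 'I_m.+1)); last exact/val_inj.
  exact/esym/(etrans (row_mxEl (rowvec_cons (t, x)) y 0%R 0%R))/rowvec_cons_head.
move=> i; rewrite rowvec_cons_tail; case: (split_ordP i) => j ->.
  rewrite row_mxEl (_ : rshift 1 _ = lshift n (rshift 1 j : 'I_m.+1)); last exact/val_inj.
  exact/esym/(etrans (row_mxEl (rowvec_cons (t, x)) y 0%R _))/rowvec_cons_tail.
rewrite row_mxEr (_ : rshift 1 _ = rshift m.+1 j); last exact/val_inj.
exact/esym/row_mxEr.
Qed.

Lemma integral_rV_split m n (f : 'rV[R]_(m + n) -> \bar R) :
  measurable_fun setT f -> (forall x, 0 <= f x) ->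
  \int[leb (m + n)]_z f z = \int[leb m]_x \int[leb n]_y f (row_mx x y).
Proof.
move=> mf f0; elim: m f mf f0 => [|m IH] f mf f0.
  have mg : measurable_fun setT (fun x : 'rV[R]_0 => \int[leb n]_y f (row_mx x y)).
    apply: (@measurable_fun_fubini_tonelli_F _ _ _ _ _ (leb n) (fun p => f (row_mx p.1 p.2))) => //.
    by apply: measurableT_comp => //; exact: measurable_row_mx.
  rewrite [RHS](integral_dirac _ measurableT mg) diracT mul1e.
  apply: eq_integral => x _; congr f; apply/rowP => i.
  by rewrite [in RHS](_ : i = rshift 0 i) ?row_mxEr//; exact/val_inj.
rewrite (integral_rV_succ (n := m + n))//.
rewrite integral_rV_succ; last 2 first.
- apply: (@measurable_fun_fubini_tonelli_F _ _ _ _ _ (leb n) (fun p => f (row_mx p.1 p.2))) => //.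
  by apply: measurableT_comp => //; exact: measurable_row_mx.
- by move=> x; apply: integral_ge0.
apply: eq_integral => t _.
have mft : measurable_fun setT (fun z => f (rowvec_cons (t, z))).
  apply: (measurableT_comp (measurable_rowvec_cons_pair mf)).
  exact: measurable_pair1.
apply: etrans (IH _ mft (fun z => f0 _)) _.
apply: eq_integral => x _; apply: eq_integral => y _.
by rewrite row_mx_rowvec_cons.
Qed.

(** Uniqueness of Lebesgue measure: the translated measure agrees with it on half-open intervals. *)
Lemma ge0_integral_translation (f : R -> \bar R) (a : R) :
  measurable_fun [set: measurableTypeR R] f -> (forall x, 0 <= f x) ->
  \int[@lebesgue_measure R]_t f (t + a)%R = \int[@lebesgue_measure R]_t f t.
Proof.
move=> mf f0.
have ms : measurable_fun [set: measurableTypeR R] (fun t : measurableTypeR R => (t + a)%R : measurableTypeR R).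
  exact: measurable_funD.
have := ge0_integral_pushforward ms (@lebesgue_measure R) measurableT mf (fun x _ => f0 x).
rewrite preimage_setT => <-.
apply: eq_measure_integral => A mA _.
apply: esym; apply: (lebesgue_measure_unique (mu := pushforward (@lebesgue_measure R) _)) => // X [[x y] /= _ <-].
rewrite /pushforward (_ : _ @^-1` _ = `](x - a)%R, (y - a)%R]%classic); last first.
  by apply/seteqP; split=> t /=; rewrite !in_itv/= ltrBlDr lerBrDr.
rewrite !lebesgue_measure_itv/= !lte_fin ltrD2r; case: ifP => // _.
by rewrite -!EFinD; congr EFin; ring.
Qed.

Lemma rowvec_consD n t (x : 'rV[R]_n) (a : 'rV[R]_n.+1) :
  (rowvec_cons (t, x) + a)%R =
  rowvec_cons ((t + a 0 0)%R, (x + rsubmx (a : 'rV[R]_(1 + n)))%R).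
Proof.
apply/rowP; apply: ord_cons; first by rewrite mxE !rowvec_cons_head.
by move=> i; rewrite mxE !rowvec_cons_tail !mxE.
Qed.

Lemma measurable_rVD n (a : 'rV[R]_n) : measurable_fun setT (fun x : 'rV[R]_n => (x + a)%R).
Proof.
apply: measurable_rowvecP => i; under eq_fun do rewrite mxE.
by apply: measurable_funD => //; exact: measurable_rowvec_coord.
Qed.

Lemma ge0_integral_rV_translation n (f : 'rV[R]_n -> \bar R) (a : 'rV[R]_n) :
  measurable_fun setT f -> (forall x, 0 <= f x) ->
  \int[leb n]_x f (x + a)%R = \int[leb n]_x f x.
Proof.
move=> mf f0; elim: n a f mf f0 => [|n IH] a f mf f0.
  by apply: eq_integral => x _; congr f; apply/rowP => -[].
have mfa : measurable_fun setT (fun x : 'rV[R]_n.+1 => f (x + a)%R).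
  by apply: measurableT_comp => //; exact: measurable_rVD.
rewrite (integral_rV_succ mfa (fun x => f0 _)) (integral_rV_succ mf f0).
pose g t := \int[leb n]_x f (rowvec_cons (t, x)).
transitivity (\int[@lebesgue_measure R]_t g (t + a 0 0)%R).
  apply: eq_integral => t _; under eq_integral do rewrite rowvec_consD.
  apply: (IH (rsubmx (a : 'rV[R]_(1 + n))) (fun x => f (rowvec_cons ((t + a 0 0)%R, x)))) => //.
  apply: (measurableT_comp (measurable_rowvec_cons_pair mf)).
  exact: measurable_pair1.
rewrite ge0_integral_translation//; last by move=> t; exact: integral_ge0.
apply: (@measurable_fun_fubini_tonelli_F _ _ _ _ _ (leb n) (fun p => f (rowvec_cons p))) => //.
exact: measurable_rowvec_cons_pair.
Qed.

Lemma integral_mfrestr d (E : measurableType d) (mu : {measure set E -> \bar R})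
    (D : set E) (mD : measurable D) (moo : mu D < +oo) (f : E -> \bar R) :
  measurable_fun setT f -> (forall x, 0 <= f x) ->
  \int[mfrestr mD moo]_x f x = \int[mu]_(x in D) f x.
Proof.
move=> mf f0.
rewrite [LHS](ge0_negligible_integral (N := ~` D))//; last 2 first.
- exact: measurableC.
- by rewrite -[LHS]/(mu (~` D `&` D)) setICl measure0.
rewrite setDE setCK setTI; apply: eq_measure_integral => A mA AD.
by rewrite -[LHS]/(mu (A `&` D)) (setIidl AD).
Qed.

End rowvec_integral.

Lemma nth_allpairs (S T U : Type) (f : S -> T -> U) (s : seq S) (t : seq T) x0 y0 z0 i j :
  (i < size s)%N -> (j < size t)%N ->
  nth z0 [seq f x y | x <- s, y <- t] (i * size t + j) = f (nth x0 s i) (nth y0 t j).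
Proof.
elim: s i => [//|x s IH] [|i] /= si tj.
  by rewrite nth_cat size_map tj (nth_map y0).
rewrite nth_cat size_map mulSn -addnA ltnNge leq_addr /= addKn.
exact: IH.
Qed.

(** Entries are enumerated row by row, so the first row of a (k + 1) by d matrix occupies the first
    d coordinates of the vector; this lets Tonelli peel off one point at a time. *)
Lemma val_mxvec_index m n (i : 'I_m) (j : 'I_n) :
  mxvec_index i j = (i * n + j)%N :> nat.
Proof.
have lt_ij : (i * n + j < #|{: 'I_m * 'I_n}|)%N.
  rewrite card_prod !card_ord.
  apply: (@leq_trans (i.+1 * n)); first by rewrite mulSn addnC ltn_add2r.
  by rewrite leq_mul2r ltn_ord orbT.
have e : enum_val (Ordinal lt_ij) = (i, j).
  rewrite (enum_val_nth (i, j)) /= enumT unlock /= /prod_enum.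
  have := @nth_allpairs _ _ _ (fun (x : 'I_m) (y : 'I_n) => (x, y)) (enum 'I_m) (enum 'I_n) i j (i, j) i j.
  rewrite !size_enum_ord => -> //.
  by rewrite !nth_ord_enum.
by rewrite /mxvec_index /= -e enum_valK.
Qed.

(** * Integrals over R^(dk) as iterated integrals *)

Section rows_integral.
Context {R : realType} (d : nat).
Local Notation leb n := (@lebesgue_rV R n).

Definition rows k (z : 'rV[R]_(k * d)) : 'I_k -> 'rV[R]_d :=
  fun i => row i (vec_mx z).

Lemma rowsE k (z : 'rV[R]_(k * d)) i j : rows z i 0 j = z 0 (mxvec_index i j).
Proof. by rewrite !mxE. Qed.

Lemma rows_row_mx k (x : 'rV[R]_d) (y : 'rV[R]_(k * d)) :
  @rows k.+1 (row_mx x y : 'rV[R]_(d + k * d)) = consf x (rows y).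
Proof.
apply: consfP => [|i]; rewrite ?consf0 ?consf_lift; apply/rowP => j.
  rewrite !rowsE (_ : mxvec_index ord0 j = lshift (k * d) j).
    exact: row_mxEl.
  exact/val_inj/(etrans (val_mxvec_index _ _)).
rewrite !rowsE (_ : mxvec_index (lift ord0 i) j = rshift d (mxvec_index i j)).
  exact: row_mxEr.
apply/val_inj/(etrans (val_mxvec_index _ _)).
by rewrite lift0 mulSn -addnA -val_mxvec_index.
Qed.

Lemma measurable_rows k i : measurable_fun setT (fun z : 'rV[R]_(k * d) => rows z i).
Proof.
apply: measurable_rowvecP => j; under eq_fun do rewrite !mxE.
exact: measurable_rowvec_coord.
Qed.

Definition rows_in k (D : set 'rV[R]_d) : set 'rV[R]_(k * d) :=
  [set z | forall i, D (rows z i)].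

Lemma measurable_rows_in k D : measurable D -> measurable (@rows_in k D).
Proof.
move=> mD.
rewrite (_ : rows_in D = \bigcap_(i in [set: 'I_k]) (fun z => rows z i) @^-1` D).
  apply: fin_bigcap_measurable; first exact: finite_finset.
  move=> i _; rewrite -[X in measurable X]setTI.
  exact: measurable_rows.
by apply/seteqP; split=> z h i; [move=> _|]; exact: h.
Qed.

Lemma nice_rows k (f : ('I_k -> 'rV[R]_d) -> R) :
  nice1 f -> bmeas (fun z : 'rV[R]_(k * d) => f (rows z)).
Proof. by move=> nf; apply: (nf _ _ (fun=> tt)) => // i; exact: measurable_rows. Qed.

Variables (D : set 'rV[R]_d) (mD : measurable D) (moo : (leb d D < +oo)%E).
Local Notation muD := (mfrestr mD moo).

Lemma integral_rows_ge0 k (f : ('I_k -> 'rV[R]_d) -> R) :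
  nice1 f -> (forall g, 0 <= f g) ->
  (\int[leb (k * d)]_(z in rows_in D) (f (rows z))%:E)%E = (iint muD f)%:E.
Proof.
elim: k f => [|k IH] f nf f0.
  rewrite (_ : rows_in D = setT); last by apply/seteqP; split => // z _ [].
  have [mf _] := nice_rows nf.
  rewrite [LHS](integral_dirac _ measurableT); last exact/measurable_EFinP.
  by rewrite diracT mul1e /=; congr (f _)%:E; apply/funext => -[].
have [mf _] := nice_rows nf.
have mG : measurable_fun [set: 'rV[R]_(k.+1 * d)]
    ((fun z => (f (rows z))%:E) \_ (rows_in D)).
  apply/(measurable_restrictT _ (@measurable_rows_in k.+1 D mD)).
  by apply: measurable_funTS; exact/measurable_EFinP.
rewrite integral_mkcond (integral_rV_split (m := d) (n := k * d) mG); last first.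
  by move=> x; rewrite patchE; case: ifP => // _; rewrite lee_fin.
have bi := bmeas_iint_cons muD nf.
transitivity (\int[leb d]_(x in D) (iint muD (fun g => f (consf x g)))%:E)%E; last first.
  rewrite -(integral_mfrestr mD moo); last 2 first.
  - by apply/measurable_EFinP; exact: bi.1.
  - move=> x; rewrite -IH//; last exact: nice1_cons.
    by apply: integral_ge0 => z _; rewrite lee_fin.
  by rewrite /= fineK//; apply: integrable_fin_num => //; exact: bmeas_integrable.
rewrite [RHS]integral_mkcond; apply: eq_integral => x _.
rewrite patchE; case: ifPn => [xD|xD].
  rewrite -IH//; last exact: nice1_cons.
  rewrite [RHS]integral_mkcond; apply: eq_integral => y _.
  rewrite !patchE rows_row_mx (_ : (_ \in _) = (y \in rows_in D))//.
  apply/idP/idP => /set_mem h; apply/mem_set => i.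
    by have := h (lift ord0 i); rewrite rows_row_mx consf_lift.
  rewrite rows_row_mx; case: (unliftP ord0 i) => [j|] ->.
    by rewrite consf_lift; exact: h.
  by rewrite consf0; exact: set_mem.
rewrite integral0_eq// => y _; rewrite patchE ifF//.
apply/negbTE; apply: contra xD => /set_mem /(_ ord0).
by rewrite rows_row_mx consf0 => /mem_set.
Qed.

(** Determinants may be negative: with M a bound, f is written as (f + M) - M, two nonnegative
    functions that are integrable over the window. *)
Lemma integral_rows k (f : ('I_k -> 'rV[R]_d) -> R) : nice1 f ->
  (\int[leb (k * d)]_(z in rows_in D) (f (rows z))%:E)%E = (iint muD f)%:E.
Proof.
move=> nf; have [_ [M fM]] := nice_rows nf.
have fgM g : `|f g| <= M.
  have := fM (mxvec (\matrix_i g i)); congr (`|f _| <= M); apply/funext => i.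
  by rewrite /rows mxvecK rowK.
have M0 : 0 <= M by exact: le_trans (fgM (fun=> 0)).
have nM : nice1 (fun _ : 'I_k -> 'rV[R]_d => M).
  by move=> d'' O' p h mp mh; exact: bmeas_cst.
have nfM : nice1 (fun g => f g + M).
  move=> d'' O' p h mp mh; apply: bmeasD; last exact: bmeas_cst.
  exact: (nf _ _ p h).
have fM0 g : 0 <= f g + M by have := fgM g; rewrite ler_norml => /andP[]; lra.
have mA := @measurable_rows_in k D mD.
have int h : nice1 h -> (forall g, 0 <= h g) ->
    (leb (k * d)).-integrable (rows_in D) (fun z => (h (rows z))%:E).
  move=> nh h0; apply/integrableP; split.
    by apply: measurable_funTS; apply/measurable_EFinP; case: (nice_rows nh).
  under eq_integral do rewrite gee0_abs ?lee_fin//.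
  by rewrite integral_rows_ge0// ltry.
have := integralB_EFin mA (int _ nfM fM0) (int _ nM (fun=> M0)).
rewrite (integral_rows_ge0 nfM fM0) (integral_rows_ge0 nM (fun=> M0)) => H.
under eq_integral do rewrite -(addrK M (f _)) EFinB.
by rewrite H -EFinB (iintD _ nf nM) addrK.
Qed.

End rows_integral.

(** * Points of a determinantal process in a window *)

Section distinct_tuples.
Context {R : realType} {d : nat}.

Lemma distinct_tuples_finset k (B : set 'rV[R]_d) : finite_set B ->
  exists r : seq 'M[R]_(k, d), [/\ uniq r, size r = (#|` fset_set B|%fset ^_ k)%N
    & @distinct_tuples R d k B = [set` r]].
Proof.
move=> fB; set F := fset_set B.
pose phi (f : {ffun 'I_k -> F}) : 'M[R]_(k, d) := \matrix_(i < k) val (f i).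
have row_phi f i : row i (phi f) = val (f i) by rewrite rowK.
have phi_inj : injective phi.
  by move=> f g fg; apply/ffunP => i; apply/val_inj; rewrite -!row_phi fg.
exists [seq phi f | f <- enum [set f : {ffun 'I_k -> F} | injectiveb f]%SET]; split.
- by rewrite map_inj_uniq ?enum_uniq.
- by rewrite size_map -cardE card_inj_ffuns card_ord cardfE.
apply/seteqP; split=> x /=.
  move=> [xB inj].
  have xF i : row i x \in F by rewrite in_fset_set// inE; exact: xB.
  apply/mapP; exists [ffun i => [` xF i]%fset].
    rewrite mem_enum inE; apply/injectiveP => i j; rewrite !ffunE => /(congr1 val).
    exact: inj.
  by apply/row_matrixP => i; rewrite row_phi ffunE.
move=> /mapP[f]; rewrite mem_enum inE => /injectiveP finj ->; split=> [i|i j].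
  by rewrite row_phi; have := valP (f i); rewrite in_fset_set// inE.
by rewrite !row_phi => /val_inj /finj.
Qed.

(** Only tuples with all rows in D contribute, each with weight 1; they are the injections of k
    indices into the points of A in D. *)
Lemma esum_distinct_tuples k (A D : set 'rV[R]_d) : finite_set (A `&` D) ->
  (\esum_(x in @distinct_tuples R d k A) (\prod_(i < k) \1_D (row i x))%:E =
    (#|` fset_set (A `&` D)|%fset ^_ k)%:R%:E :> \bar R)%E.
Proof.
move=> fAD; have [r [ur sr rE]] := distinct_tuples_finset k fAD.
rewrite -sr.
transitivity (\esum_(x in @distinct_tuples R d k (A `&` D)) (1 : \bar R))%E.
  rewrite (_ : @distinct_tuples R d k (A `&` D) =
      @distinct_tuples R d k A `&` [set x | forall i, D (row i x)]); last first.
    by apply/seteqP; split=> x [h1 h2]; [split; [split=> // i|move=> i]|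
      case: h1 => h1 inj; split => // i]; have [] := h1 i.
  rewrite [RHS]esum_mkcondr; apply: eq_esum => x _.
  case: ifPn => [/set_mem xD|].
    by rewrite big1// => i _; rewrite indicE mem_set//; exact: xD.
  move=> /negP h; congr EFin; apply/eqP.
  have /existsNP[i nDi] : ~ forall i, D (row i x) by move=> h'; apply/h/mem_set.
  by rewrite (bigD1 i)//= indicE memNset// mul0r.
rewrite rE esum_fset//; last exact: finite_seq.
rewrite -fsbig_seq// big_const_seq count_predT.
elim: (size r) => [//|n IH] /=.
by rewrite -[n.+1]add1n natrD EFinD -IH.
Qed.

End distinct_tuples.

(** * Factorial moments, traces and characteristic function in one window *)

Section dpp_counting.
Context {R : realType} {d : nat} {disp : measure_display}
  {T : measurableType disp} (P : probability T R) (X : T -> set 'rV[R]_d).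
Variable C : 'rV[R]_d -> R.
Hypothesis C_sym : forall x, C (- x) = C x.
Hypothesis C_cont : continuous C.
Hypothesis X_dpp : stationary_dpp P X C.
Variable D : set 'rV[R]_d.
Hypothesis cD : compact D.
Local Notation leb n := (@lebesgue_rV R n).

Let mD : measurable D := compact_rV_measurable cD.
Let moo : (leb d D < +oo)%E := compact_rV_fin cD.

Definition window_measure : {finite_measure set 'rV[R]_d -> \bar R} :=
  mfrestr mD moo.

(** The indicators confine x - y to differences of points of D, a bounded set on which the
    continuous C is bounded, so that the kernel is bounded on the whole space. *)
Definition window_kernel (x y : 'rV[R]_d) : R := C (x - y) * \1_D x * \1_D y.

Definition window_count (w : T) : nat := #|` fset_set (X w `&` D)|%fset.

Lemma finite_window w : finite_set (X w `&` D).
Proof. by have [[fin _] _] := X_dpp; apply: fin; exact: compact_bounded. Qed.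

Lemma measurable_window_count n : measurable [set w | window_count w = n].
Proof.
have [[_ mc] _] := X_dpp.
have /(_ measurableT [set n%:R%:E] (emeasurable_set1 _)) := mc D mD (compact_bounded cD).
rewrite setTI; congr measurable; apply/seteqP; split=> w /=;
  rewrite /counting asboolT//; try exact: finite_window.
  by move=> [] /eqP; rewrite eqr_nat => /eqP.
by rewrite -/(window_count w) => ->.
Qed.

Lemma bmeas_window_kernel : bmeas (fun z : 'rV[R]_d * 'rV[R]_d => window_kernel z.1 z.2).
Proof.
have mC := continuous_rV_measurable C_cont.
have m1 : measurable_fun setT (fun x : 'rV[R]_d => \1_D x : R).
  exact: measurable_indic.
split.
  apply: measurable_funM; [apply: measurable_funM|].
  - apply: (measurableT_comp mC); apply: measurable_rowvecP => i.
    under eq_fun do rewrite !mxE.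
    apply: measurable_funB.
      exact: (measurableT_comp (measurable_rowvec_coord i) measurable_fst).
    exact: (measurableT_comp (measurable_rowvec_coord i) measurable_snd).
  - exact: (measurableT_comp m1 measurable_fst).
  - exact: (measurableT_comp m1 measurable_snd).
have [M [_ hM]] := compact_bounded cD.
have DM x : D x -> `|x| <= `|M| + 1.
  by apply: hM; rewrite (le_lt_trans (ler_norm M))// ltrDl.
pose B := box (0 : 'rV[R]_d) (2 * (`|M| + 1)).
have B0 : 0 <= 2 * (`|M| + 1) by rewrite mulr_ge0// addr_ge0.
have cB : compact B.
  rewrite /B boxE//; apply: bounded_closed_compact.
    exists (2 * (`|M| + 1)); split; first exact: num_real.
    by move=> N MN x /=; rewrite subr0 => xM; exact: le_trans (ltW MN).
  under eq_set => x do rewrite distrC; exact: closed_closed_ball_.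
have /compact_bounded[N [_ hN]] : compact (C @` B).
  by apply: continuous_compact => //; exact: continuous_subspaceT.
exists (`|N| + 1) => -[x y] /=; rewrite /window_kernel !indicE.
have N0 : 0 <= `|N| + 1 by rewrite addr_ge0.
have [/set_mem xD|] := boolP (x \in D); last by rewrite mulr0 mul0r normr0.
have [/set_mem yD|] := boolP (y \in D); last by rewrite mulr0 normr0.
rewrite !mulr1; apply: hN; first by rewrite (le_lt_trans (ler_norm N))// ltrDl.
exists (x - y) => //; rewrite /B boxE//= subr0.
apply: le_trans (ler_normB _ _) _.
by have := DM _ xD; have := DM _ yD; lra.
Qed.

Lemma window_kernel_sym x y : window_kernel x y = window_kernel y x.
Proof. by rewrite /window_kernel -C_sym opprB -!mulrA (mulrC (\1_D x)). Qed.

(** The joint intensity tested on D x ... x D: one side counts ordered k-tuples of distinct points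
    in the window, the other is an integral in which the determinant formula is required only almost
    everywhere. *)
Lemma window_factorial_moment k : (0 < k)%N ->
  (\int[P]_w (window_count w ^_ k)%:R%:E =
    (kdet window_measure window_kernel k)%:E)%E.
Proof.
move=> k0; have [_ /(_ k k0)[rhok [[r0 mr rE] ae]]] := X_dpp.
under eq_integral => w _ do rewrite -(esum_distinct_tuples k (finite_window w)).
rewrite (rE (fun=> D) (fun=> mD)).
have nd : nice1 (fun g => \det (kmx window_kernel (g : 'I_k -> 'rV[R]_d) g)).
  apply: (nice_kmx bmeas_window_kernel (O := unit) (x := fun _ g => g) (y := fun _ g => g)).
  by move=> d'' O' p h mp mh i.
have mA := @measurable_rows_in R d k D mD.
rewrite /kdet -(integral_rows mD moo nd).
apply: ae_eq_integral => //.
- by apply: measurable_funTS; exact/measurable_EFinP.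
- by apply: measurable_funTS; apply/measurable_EFinP; case: (nice_rows nd).
apply: filterS ae => z /= rz Dz; rewrite rz; congr (\det _)%:E.
apply/matrixP => i j; rewrite !mxE /window_kernel.
by rewrite !indicE !mem_set ?mulr1//; exact: Dz.
Qed.

Definition window_trace (j : nat) : R := ktrace window_measure window_kernel j.

Lemma window_binomial k :
  nint P window_count (fun n => 'C(n, k)%:R) /\
  nexp P window_count (fun n => 'C(n, k)%:R) = kdetf window_measure window_kernel k.
Proof.
(* Intensities are given for k > 0; for k = 0 both sides are 1. *)
have [->|k0] := posnP k.
  under eq_fun do rewrite bin0; rewrite nexp_cst; split; first exact: nint_cst.
  by rewrite /kdetf /kdet /= det_mx00 fact0 divr1.
have H := window_factorial_moment k0.
have mB := measurable_natcomp measurable_window_count (fun n => 'C(n, k)%:R : R).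
have f0 : k`!%:R != 0 :> R by rewrite pnatr_eq0 -lt0n fact_gt0.
have E : (\int[P]_w ('C(window_count w, k)%:R)%:E =
    (kdetf window_measure window_kernel k)%:E)%E.
  rewrite /kdetf EFinM muleC -H -ge0_integralZl_EFin ?invr_ge0//; last first.
    apply/measurable_EFinP.
    exact: (measurable_natcomp measurable_window_count (fun n => (n ^_ k)%:R : R)).
  by apply: eq_integral => w _; rewrite -EFinM -bin_ffact natrM mulrC mulfK.
split.
  apply/integrableP; split; first exact/measurable_EFinP.
  under eq_integral do rewrite gee0_abs ?lee_fin//.
  by rewrite E ltry.
by rewrite /nexp /Rintegral E.
Qed.

Lemma Rintegral_window (f : 'rV[R]_d -> R) : bmeas f -> (forall x, 0 <= f x) ->
  (\int[window_measure]_x f x)%:E = (\int[leb d]_(x in D) (f x)%:E)%E.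
Proof.
move=> bf f0; rewrite -(integral_mfrestr mD moo); last 2 first.
- by apply/measurable_EFinP; case: bf.
- by move=> x; rewrite lee_fin.
rewrite /Rintegral fineK//; apply: integrable_fin_num => //; exact: bmeas_integrable.
Qed.

Hypothesis C0_ge0 : 0 <= C 0.

Lemma window_trace0 : window_trace 0 = C 0 * fine (leb d D).
Proof.
have bd : bmeas (fun x : 'rV[R]_d => C 0 * \1_D x * \1_D x).
  have b1 : bmeas (fun x : 'rV[R]_d => \1_D x : R).
    split; first exact: measurable_indic.
    by exists 1 => x; rewrite indicE; case: (_ \in _); rewrite ?normr1 ?normr0.
  by apply: bmeasM => //; exact: bmeasZ.
apply: EFin_inj; rewrite /window_trace /ktrace /= /window_kernel.
under eq_Rintegral do rewrite subrr.
rewrite (Rintegral_window bd); last by move=> x; rewrite !mulr_ge0.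
rewrite EFinM fineK; last by rewrite ge0_fin_numE.
rewrite -integral_cst//; apply: eq_integral => x xD.
by rewrite indicE xD !mulr1.
Qed.

Lemma window_trace0_ge0 : 0 <= window_trace 0.
Proof. by rewrite window_trace0 mulr_ge0// fine_ge0. Qed.

Lemma window_trace_newton k :
  k.+1%:R * kdetf window_measure window_kernel k.+1 =
  \sum_(j < k.+1) (-1) ^+ j * kdetf window_measure window_kernel (k - j) * window_trace j.
Proof. exact: kdetf_newton bmeas_window_kernel k. Qed.

Lemma window_trace_le j : `|window_trace j.+1| <= window_trace 1.
Proof.
apply: (normr_trace_le measurable_window_count (fun k => (window_binomial k).1)
  (fun k => (window_binomial k).2) window_trace_newton).
- exact: ktrace_ge0 bmeas_window_kernel window_kernel_sym.
- exact: ktrace_cauchy_schwarz bmeas_window_kernel window_kernel_sym.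
- exact: ktrace_submul bmeas_window_kernel window_kernel_sym.
Qed.

(** Substitute y = x + v in the double integral of C (x - y)^2 over D x D and exchange the
    integrals: for fixed v the admissible x are those with x and x + v in D, and C is even. *)
Lemma window_trace1 :
  (window_trace 1)%:E =
  (\int[leb d]_v ((C v ^+ 2)%:E * leb d (D `&` [set x | D (x + v)%R])))%E.
Proof.
have bK := bmeas_window_kernel.
have m1 : measurable_fun setT (fun x : 'rV[R]_d => \1_D x : R).
  exact: measurable_indic.
have mC := continuous_rV_measurable C_cont.
pose F (z : 'rV[R]_d * 'rV[R]_d) := (\1_D z.1 * \1_D (z.1 + z.2) * C z.2 ^+ 2)%:E.
have mF : measurable_fun setT F.
  apply/measurable_EFinP; apply: measurable_funM; [apply: measurable_funM|].
  - exact: (measurableT_comp m1 measurable_fst).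
  - apply: (measurableT_comp m1); apply: measurable_rowvecP => i.
    under eq_fun do rewrite !mxE; apply: measurable_funD.
      exact: (measurableT_comp (measurable_rowvec_coord i) measurable_fst).
    exact: (measurableT_comp (measurable_rowvec_coord i) measurable_snd).
  - apply: measurable_funX; exact: (measurableT_comp mC measurable_snd).
have nn a b c : 0 <= \1_D a * \1_D b * C c ^+ 2.
  by apply: mulr_ge0; [exact: mulr_ge0|exact: sqr_ge0].
have F0 z : (0 <= F z)%E by rewrite lee_fin; exact: nn.
transitivity (\int[leb d]_x \int[leb d]_v F (x, v))%E.
  rewrite /window_trace /ktrace Rintegral_window; last 2 first.
  - have := bmeas_int_param window_measure (F := fun z : 'rV[R]_d * 'rV[R]_d =>
      window_kernel z.1 z.2 * window_kernel z.2 z.1).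
    apply; apply: bmeasM => //; under eq_fun do rewrite window_kernel_sym; exact: bK.
  - move=> x /=; apply: Rintegral_ge0 => t _.
    by rewrite (window_kernel_sym t) -expr2 sqr_ge0.
  rewrite integral_mkcond; apply: eq_integral => x _; rewrite patchE /=.
  rewrite Rintegral_window; last 2 first.
  - apply: bmeasM; first by apply: (bmeas_comp bK (measurable_pair1 x)).
    exact: (bmeas_comp bK (measurable_pair2 x)).
  - by move=> t; rewrite (window_kernel_sym t) -expr2 sqr_ge0.
  pose f y := (\1_D x * \1_D y * C (x - y) ^+ 2)%:E.
  transitivity (\int[leb d]_y f y)%E.
    rewrite [in LHS]integral_mkcond /f indicE; case: ifPn => xD; last first.
      by rewrite integral0_eq// => y _; rewrite !mul0r.
    apply: eq_integral => y _; rewrite patchE (window_kernel_sym y) /window_kernel.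
    rewrite !indicE xD; case: (y \in D); rewrite /=; first by rewrite !mulr1 mul1r expr2.
    by rewrite mulr0 mul0r.
  have mf : measurable_fun setT f.
    apply/measurable_EFinP; apply: measurable_funM.
      by apply: measurable_funM => //; exact: measurable_cst.
    apply: measurable_funX; apply: (measurableT_comp mC).
    apply: measurable_rowvecP => i; under eq_fun do rewrite !mxE.
    by apply: measurable_funB => //; exact: measurable_rowvec_coord.
  rewrite -(ge0_integral_rV_translation x mf); last first.
    by move=> y; rewrite lee_fin; exact: nn.
  apply: eq_integral => v _; rewrite /f /F /= (addrC v x) opprD addNKr.
  by rewrite C_sym.
rewrite (fubini_tonelli F mF F0).
apply: eq_integral => v _; rewrite /F /=.
have mDv : measurable [set x | D (x + v)].
  have := measurable_rVD v measurableT mD; rewrite setTI; exact.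
rewrite -[X in (_ * leb d X)%E]setIT -integral_indic//; last exact: measurableI.
rewrite -ge0_integralZl_EFin ?sqr_ge0//; last 1 first.
- by apply/measurable_EFinP; apply: measurable_indic; exact: measurableI.
apply: eq_integral => x _; rewrite -EFinM indicI /= mulrC; congr (_ * (_ * _))%:E.
Qed.

Local Notation V := (fine (leb d D)).
Hypothesis V_gt0 : 0 < V.

Lemma intensity_estimatorE w :
  intensity_estimator X D w = (window_count w)%:R / V.
Proof.
rewrite /intensity_estimator mulrC; congr (_ / _).
rewrite -(@fsbig_widen _ _ _ _ (X w `&` D) (X w)); last 2 first.
- exact: subIsetl.
- by move=> x [Xx nXD] /=; rewrite indicE memNset// => Dx; exact: nXD.
rewrite fsbig_finite; last exact: finite_window.
rewrite /window_count -sum1_size natr_sum; apply: eq_big_seq => x.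
by rewrite in_fset_set ?inE//; [case=> _ Dx; rewrite indicE mem_set|exact: finite_window].
Qed.

Lemma standardized_estimatorE w :
  Num.sqrt V * (intensity_estimator X D w - C 0) =
  ((window_count w)%:R - window_trace 0) / Num.sqrt V.
Proof.
have s0 : Num.sqrt V != 0 by rewrite gt_eqF// sqrtr_gt0.
rewrite intensity_estimatorE window_trace0 -[in LHS](sqr_sqrtr (ltW V_gt0)).
rewrite -[in RHS](sqr_sqrtr (ltW V_gt0)) [Num.sqrt (_ ^+ 2)]sqrtr_sqr ger0_norm ?sqrtr_ge0//.
by field.
Qed.

Let nint_count2 := nint_sqr (fun k => (window_binomial k).1).

Lemma integrable_standardized_sqr :
  P.-integrable setT (fun w =>
    ((Num.sqrt V * (intensity_estimator X D w - C 0)) ^+ 2)%:E).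
Proof.
have := nintZ V^-1 (nint_count2 (window_trace 0)).
congr (P.-integrable setT _); apply/funext => w; congr EFin.
by rewrite standardized_estimatorE expr_div_n sqr_sqrtr ?(ltW V_gt0)// mulrC.
Qed.

Lemma standardized_variance :
  \int[P]_w (Num.sqrt V * (intensity_estimator X D w - C 0)) ^+ 2 =
  (window_trace 0 - window_trace 1) / V.
Proof.
rewrite -(count_variance (fun k => (window_binomial k).1)
  (fun k => (window_binomial k).2) window_trace_newton) mulrC.
rewrite -nexpZ//; apply: eq_Rintegral => w _.
by rewrite standardized_estimatorE expr_div_n sqr_sqrtr ?(ltW V_gt0)// mulrC.
Qed.

Lemma measurable_estimator : measurable_fun setT (intensity_estimator X D).
Proof.
rewrite (funext intensity_estimatorE).
exact: (measurable_natcomp measurable_window_count (fun n => n%:R / V)).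
Qed.

Lemma estimator_variance :
  ('V_P[(fun w => Num.sqrt V * intensity_estimator X D w)%R] =
    ((window_trace 0 - window_trace 1) / V)%:E)%E.
Proof.
have mean : fine ('E_P[(fun w => Num.sqrt V * intensity_estimator X D w)%R])%E =
    Num.sqrt V * C 0.
  rewrite unlock -[LHS]/(\int[P]_w _)%R.
  transitivity (nexp P window_count (fun n => (Num.sqrt V / V) * n%:R)).
    by apply: eq_Rintegral => w _; rewrite intensity_estimatorE mulrCA mulrC.
  rewrite nexpZ; last 1 first.
  - have := (window_binomial 1).1; congr nint; apply/funext => n; by rewrite bin1.
  have -> : nexp P window_count (fun n => n%:R) = window_trace 0.
    rewrite -(e1E (fun k => (window_binomial k).2) window_trace_newton).
    rewrite -(window_binomial 1).2; congr nexp; apply/funext => n; by rewrite bin1.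
  by rewrite window_trace0; field; rewrite gt_eqF.
rewrite /variance covariance.unlock mean expectation.unlock -standardized_variance.
rewrite /Rintegral fineK; last exact: integrable_fin_num integrable_standardized_sqr.
apply: eq_integral => w _; congr EFin.
by rewrite -[LHS]/((_ - Num.sqrt V * C 0) * (_ - Num.sqrt V * C 0)) -mulrBr -expr2.
Qed.

Lemma estimator_charfun (U b : R) : 0 <= U -> U <= Num.sqrt V / 2 ->
  `|(\int[P]_w sin (U * (Num.sqrt V * (intensity_estimator X D w - C 0)) + b)) *
      expR ((window_trace 0 - window_trace 1) / V * U ^+ 2 / 2) - sin b| <=
  U * ((window_trace 0 + 7 * window_trace 1) / V * U ^+ 2 / Num.sqrt V) *
    expR (`|(window_trace 0 - window_trace 1) / V| * U ^+ 2 / 2).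
Proof.
move=> U0 UV.
have := count_charfun measurable_window_count (fun k => (window_binomial k).1)
  (fun k => (window_binomial k).2) window_trace_newton window_trace0_ge0
  window_trace_le b V_gt0 U0 UV.
by under eq_Rintegral do rewrite -standardized_estimatorE.
Qed.

End dpp_counting.

(** * Boundary layers of the windows *)

Section boundary_layer.
Context {R : realType} {d : nat}.
Implicit Types (x u v : 'rV[R]_d) (D U : set 'rV[R]_d).
Local Notation leb n := (@lebesgue_rV R n).

Lemma normr_le_enorm x : `|x| <= enorm x.
Proof.
apply/normr_rV_le; first exact: sqrtr_ge0.
move=> i; rewrite -sqrtr_sqr ler_wsqrtr// /dotv (bigD1 i)//= expr2 lerDl.
by apply: sumr_ge0 => j _; rewrite -expr2 sqr_ge0.
Qed.

(** Rounding t down to a multiple of 1 / J moves the point by at most |v| / J <= r, so the J + 1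
    grid points with radius 2 r suffice. *)
Lemma segment_near_box u v x (r t : R) (J : nat) : 0 <= t <= 1 -> 0 < r ->
  (0 < J)%N -> `|v| <= r * J%:R -> `|x + t *: v - u| <= r ->
  exists2 j : 'I_J.+1, True & box (u - (j%:R / J%:R) *: v) (2 * r) x.
Proof.
move=> /andP[t0 t1] r0 J0 vJ xu.
have J0' : 0 < J%:R :> R by rewrite ltr0n.
have tJ0 : 0 <= t * J%:R by rewrite mulr_ge0// ltW.
have /andP[jt tj] := truncn_itv tJ0.
have jJ : (Num.truncn (t * J%:R) < J.+1)%N.
  by rewrite ltnS -(ler_nat R) (le_trans jt)// ler_piMl// ltW.
exists (Ordinal jJ) => //; rewrite boxE ?mulr_ge0 ?(ltW r0)//=.
set j := Num.truncn _ in jt tj *.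
rewrite (_ : x - _ = (x + t *: v - u) - (t - j%:R / J%:R) *: v); last first.
  by apply/rowP => i; rewrite !mxE; ring.
apply: le_trans (ler_normB _ _) _.
rewrite (_ : 2 * r = r + r); last by ring.
apply: lerD => //; rewrite normrZ ger0_norm; last first.
  by rewrite subr_ge0 ler_pdivrMr.
apply: (@le_trans _ _ (J%:R^-1 * (r * J%:R))).
  apply: ler_pM => //; first by rewrite subr_ge0 ler_pdivrMr.
  rewrite lerBlDr -[X in _ <= X + _]mul1r -mulrDl ler_pdivlMr// addrC natr1.
  exact: ltW.
by rewrite mulrCA mulVf ?mulr1// gt_eqF.
Qed.

Lemma exprn_max_le (s : nat) (a e : R) : 0 <= a -> 0 < e <= 1 ->
  Num.max a e ^+ s <= a ^+ s + e.
Proof.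
move=> a0 /andP[e0 e1].
have [ea|ae] := leP e a; first by rewrite lerDl ltW.
case: s => [|s]; first by rewrite !expr0 lerDl ltW.
apply: (@le_trans _ _ e); last by rewrite lerDr exprn_ge0.
by rewrite exprS ler_piMr ?(ltW e0)// exprn_ile1 ?(ltW e0).
Qed.

(* If U has diameter r <= 1, the points x whose segment [x, x + v] meets U are
   covered by |v| / r + 2 boxes of radius 2 r, of total volume O(r^(d - 1)); the
   slack e takes care of the sets of diameter 0. *)
Lemma swept_cover U v (e : R) : (0 < d)%N -> (diameter U <= 1%:E)%E -> 0 < e <= 1 ->
  exists2 F : set 'rV[R]_d, measurable F /\
    (forall x t, 0 <= t <= 1 -> U (x + t *: v) -> F x)
  & (leb d F <= (4 ^+ d * (`|v| + 2))%:E * (diameter_pow d.-1 U + e%:E))%E.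
Proof.
move=> d0 dU e01; have /andP[e0 e1] := e01; have [U0|/set0P[u Uu]] := eqVneq U set0.
  exists set0; last first.
    rewrite measure0 U0 /diameter_pow asboolT// add0e -EFinM lee_fin.
    by rewrite mulr_ge0 ?(ltW e0)// mulr_ge0 ?exprn_ge0// addr_ge0.
  by split=> // x t _; rewrite U0.
have dU0 : (0 <= diameter U)%E.
  apply: ereal_sup_ubound; exists (u, u) => //=.
  by rewrite subrr /enorm /dotv big1 ?sqrtr0// => i _; rewrite mxE mul0r.
have fU : diameter U \is a fin_num.
  by rewrite ge0_fin_numE//; apply: le_lt_trans dU _; rewrite ltry.
pose a := fine (diameter U).
have a0 : 0 <= a by rewrite fine_ge0.
have a1 : a <= 1 by rewrite -lee_fin fineK.
pose r := Num.max a e.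
have r0 : 0 < r by rewrite lt_max e0 orbT.
have r1 : r <= 1 by rewrite ge_max a1.
pose J := (Num.truncn (`|v| / r)).+1.
have vJ : `|v| <= r * J%:R.
  by rewrite mulrC -ler_pdivrMr// ltW// truncnS_gt.
have JJ : J.+1%:R <= `|v| / r + 2.
  rewrite /J -natr1 -[X in X + 1]natr1 -addrA lerD//.
  by have /andP[] := truncn_itv (divr_ge0 (normr_ge0 v) (ltW r0)).
exists (\big[setU/set0]_(j < J.+1) box (u - (j%:R / J%:R) *: v) (2 * r)).
  split; first by apply: bigsetU_measurable => j _; exact: measurable_box.
  move=> x t t01 Ux.
  have xu : `|x + t *: v - u| <= r.
    apply: le_trans (normr_le_enorm _) _; rewrite /r le_max; apply/orP; left.
    rewrite -lee_fin fineK//; apply: ereal_sup_ubound.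
    by exists (x + t *: v, u).
  have [j _ xj] := @segment_near_box u v x r t J t01 r0 isT vJ xu.
  by rewrite -bigcup_seq; exists j => //=; rewrite mem_index_enum.
have -> : diameter_pow d.-1 U = (a ^+ d.-1)%:E.
  by rewrite /diameter_pow asboolF// => U0; rewrite U0 in Uu.
apply: (@le_trans _ _ (\sum_(j < J.+1) leb d (box (u - (j%:R / J%:R) *: v) (2 * r)))%E).
  apply: (@content_subadditive _ _ _ (leb d) _ (fun j : nat => box (u - (j%:R / J%:R) *: v) (2 * r))) => //.
    by move=> j _; exact: measurable_box.
  by apply: bigsetU_measurable => j _; exact: measurable_box.
have b j : leb d (box (u - (j%:R / J%:R) *: v) (2 * r)) = ((4 * r) ^+ d)%:E.
  rewrite lebesgue_box ?mulr_ge0 ?(ltW r0)//; congr (_ ^+ _)%:E; ring.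
under eq_bigr do rewrite b.
rewrite sumEFin sumr_const card_ord -EFinD -EFinM lee_fin.
apply: (@le_trans _ _ (4 ^+ d * (`|v| + 2) * r ^+ d.-1)); last first.
  apply: ler_wpM2l; last exact: exprn_max_le.
  by rewrite mulr_ge0 ?exprn_ge0// addr_ge0.
have rE : (4 * r) ^+ d = 4 ^+ d * (r * r ^+ d.-1).
  by rewrite exprMn -exprS prednK.
rewrite [leLHS](_ : _ = J.+1%:R * (4 ^+ d * (r * r ^+ d.-1))); last first.
  by rewrite -rE [RHS]mulr_natl.
apply: (@le_trans _ _ ((`|v| / r + 2) * (4 ^+ d * (r * r ^+ d.-1)))).
  apply: ler_wpM2r JJ; rewrite !mulr_ge0 ?exprn_ge0 ?(ltW r0)//.
have rs : 0 <= 4 ^+ d * r ^+ d.-1 by rewrite mulr_ge0 ?exprn_ge0 ?(ltW r0).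
rewrite [leLHS](_ : _ = 4 ^+ d * r ^+ d.-1 * (`|v| + 2 * r)); last first.
  by field; rewrite gt_eqF.
rewrite [leRHS]mulrAC; apply: ler_wpM2l => //; rewrite lerD2l; lra.
Qed.

(** Take the last parameter s at which the segment is in D. Closedness puts that point in D; were it
    interior, s < 1 could be increased. *)
Lemma segment_meets_boundary D x v : closed D -> D x -> ~ D (x + v) ->
  exists2 t : R, 0 <= t <= 1 & boundary D (x + t *: v).
Proof.
move=> clD Dx nDxv; pose A := [set t : R | 0 <= t <= 1 /\ D (x + t *: v)].
have A0 : A 0 by split; rewrite ?lexx ?ler01// scale0r addr0.
have hA : has_sup A by split; [exists 0|exists 1 => t [/andP[]]].
pose s := sup A.
have s0 : 0 <= s by apply: ub_le_sup A0; case: hA.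
have s1 : s <= 1 by apply: ge_sup => [|t [/andP[]]//]; exists 0.
have v1 : 0 < `|v| + 1 by rewrite ltr_wpDl.
have near t e : 0 < e -> `|t - s| < e / (`|v| + 1) -> ball (x + s *: v) e (x + t *: v).
  move=> e0 ts; rewrite -ball_normE /= opprD addrACA subrr add0r -scalerBl normrZ distrC.
  apply: (@le_lt_trans _ _ (`|t - s| * (`|v| + 1))).
    by rewrite ler_wpM2l// lerDl.
  by rewrite -ltr_pdivlMr.
have Ds : D (x + s *: v).
  apply: contrapT => nD.
  have /nbhs_ballP[e /= e0 eD] : nbhs (x + s *: v) (~` D).
    by apply: open_nbhs_nbhs; split => //; exact: closed_openC.
  have [t [t01 Dt] st] := sup_adherent (divr_gt0 e0 v1) hA.
  have ts : t <= s by apply: ub_le_sup; [case: hA|split].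
  apply: (eD _ _ Dt); apply: near => //.
  by rewrite distrC ger0_norm ?subr_ge0// ltrBlDr addrC -ltrBlDr.
exists s; first by rewrite s0.
split; first exact: subset_closure.
rewrite /interior => /nbhs_ballP[e /= e0 eD].
have {}s1 : s < 1.
  rewrite lt_neqAle s1 andbT; apply/eqP => s1'; apply: nDxv.
  by have := Ds; rewrite s1' scale1r.
pose w := e / (`|v| + 1).
have w0 : 0 < w by rewrite divr_gt0.
pose t := Num.min 1 (s + w / 2).
have st : s < t by rewrite lt_min s1 ltrDl divr_gt0.
have tw : t <= s + w / 2 by rewrite ge_min lexx orbT.
have : t <= s.
  apply: ub_le_sup; first by case: hA.
  split; first by rewrite (le_trans s0 (ltW st))/= ge_min lexx.
  by apply: eD; apply: near => //; rewrite gtr0_norm ?subr_gt0// -/w; lra.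
by rewrite leNgt st.
Qed.

(** A point that v moves out of D has a segment crossing the boundary. So the layer lies in the
    union of the regions swept by a cover of the boundary by sets of diameter at most 1 whose
    diameter powers sum to less than h + 1. *)
Lemma boundary_layer_le D v (h : R) : (0 < d)%N -> compact D ->
  (hausdorff_measure d.-1 (boundary D) <= h%:E)%E ->
  (leb d (D `&` [set x | ~ D (x + v)%R]) <= (4 ^+ d * (`|v| + 2) * (h + 2))%:E)%E.
Proof.
move=> d0 cD hD.
have clD : closed D by apply: compact_closed => //; exact: norm_hausdorff.
have mD := compact_rV_measurable cD.
have : (hausdorff_pre d.-1 1 (boundary D) < (h + 1)%:E)%E.
  apply: (@le_lt_trans _ _ h%:E); last by rewrite lte_fin ltrDl.
  by apply: le_trans hD; apply: ereal_sup_ubound; exists 1 => /=.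
move=> /ereal_inf_lt[_ [U [cU dU] <-] sU].
(* The slacks 1 / 2^(i+1) sum to 1, which turns h + 1 into h + 2. *)
have e01 i : 0 < (1 / (2 ^ i.+1)%:R : R) <= 1.
  rewrite divr_gt0 ?ltr0n ?expn_gt0//= ler_pdivrMr ?ltr0n ?expn_gt0//.
  by rewrite mul1r ler1n expn_gt0.
have cov i : exists F : set 'rV[R]_d, (measurable F /\
    (forall x t, 0 <= t <= 1 -> U i (x + t *: v) -> F x)) /\
    (leb d F <= (4 ^+ d * (`|v| + 2))%:E * (diameter_pow d.-1 (U i) + (1 / (2 ^ i.+1)%:R)%:E))%E.
  by have [F] := swept_cover v d0 (dU i) (e01 i); exists F.
have [F FP] := choice cov.
have K0 : 0 <= 4 ^+ d * (`|v| + 2) by rewrite mulr_ge0 ?exprn_ge0// addr_ge0.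
have dp0 i : (0 <= diameter_pow d.-1 (U i))%E.
  rewrite /diameter_pow; case: ifP => [//|/asboolPn/eqP/set0P[u Uu]].
  rewrite lee_fin exprn_ge0// fine_ge0//; apply: ereal_sup_ubound; exists (u, u) => //=.
  by rewrite subrr /enorm /dotv big1 ?sqrtr0// => j _; rewrite mxE mul0r.
apply: (@le_trans _ _ (\sum_(0 <= i <oo) leb d (F i))%E).
  apply: measure_sigma_subadditive.
  - by move=> i; case: (FP i) => -[].
  - apply: measurableI => //; apply: measurableC.
    by have := measurable_rVD v measurableT mD; rewrite setTI; exact.
  - move=> x [Dx nDx]; have [t t01 /cU[i _ Ui]] := segment_meets_boundary clD Dx nDx.
    by exists i => //; have [[_ h'] _] := FP i; exact: h' t01 Ui.
apply: (@le_trans _ _ (\sum_(0 <= i <oo) ((4 ^+ d * (`|v| + 2))%:E *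
    (diameter_pow d.-1 (U i) + (1 / (2 ^ i.+1)%:R)%:E)))%E).
  by apply: lee_nneseries => // i _; case: (FP i).
rewrite nneseriesZl; last first.
  by move=> i _; rewrite adde_ge0// lee_fin ltW//; case/andP: (e01 i).
rewrite [leRHS]EFinM; apply: lee_wpmul2l; first by rewrite lee_fin.
apply: le_trans (epsilon_trick (fun=> true) dp0 ler01) _.
rewrite (_ : h + 2 = h + 1 + 1); last by ring.
by rewrite EFinD leeD2r// ltW.
Qed.

End boundary_layer.

(** * Asymptotic overlap of a window with its translates *)

Section window_overlap.
Context {R : realType} {d : nat}.
Variables (D : nat -> set 'rV[R]_d) (a1 a2 : R).
Hypotheses (d_gt0 : (0 < d)%N) (cD : forall n, compact (D n)).
Hypotheses (a1_gt0 : 0 < a1) (a2_gt0 : 0 < a2).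
Hypothesis volD : forall n, ((a1 * n.+1%:R ^+ d)%:E <= lebesgue_rV d (D n))%E.
Hypothesis surfD : forall n,
  (hausdorff_measure d.-1 (boundary (D n)) <= (a2 * n.+1%:R ^+ d.-1)%:E)%E.
Local Notation leb := (@lebesgue_rV R d).

Let vol n : R := fine (leb (D n)).

Definition overlap n (v : 'rV[R]_d) : R :=
  fine (leb (D n `&` [set x | D n (x + v)])) / vol n.

Let fvol n : leb (D n) \is a fin_num.
Proof. by rewrite ge0_fin_numE// compact_rV_fin. Qed.

Lemma volume_ge n : a1 * n.+1%:R ^+ d <= vol n.
Proof. by rewrite -lee_fin fineK. Qed.

Lemma volume_gt0 n : 0 < vol n.
Proof.
by apply: lt_le_trans (volume_ge n); rewrite mulr_gt0// exprn_gt0// ltr0n.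
Qed.

Lemma volume_cvg_pinfty : vol n @[n --> \oo] --> +oo.
Proof.
apply/cvgryPge => A; near=> n; apply: le_trans (volume_ge n).
rewrite -ler_pdivrMl// mulrC.
apply: (@le_trans _ _ n.+1%:R); last first.
  by rewrite -[leLHS]expr1; apply: ler_weXn2l => //; rewrite ler1n.
rewrite -natr1; apply: (@le_trans _ _ n%:R); last by rewrite lerDl.
by near: n; exact: nbhs_infty_ger.
Unshelve. all: end_near. Qed.

Let measurable_shift n v : measurable [set x | D n (x + v)].
Proof.
have := measurable_rVD v measurableT (compact_rV_measurable (@cD n)).
by rewrite setTI; exact.
Qed.

Let foverlap n v : leb (D n `&` [set x | D n (x + v)]) \is a fin_num.
Proof.
rewrite ge0_fin_numE//; apply: le_lt_trans (compact_rV_fin (@cD n)).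
apply: le_measure; rewrite ?inE; last exact: subIsetl.
  by apply: measurableI => //; exact: compact_rV_measurable.
exact: compact_rV_measurable.
Qed.

Lemma volume_overlap n v :
  (vol n * overlap n v)%:E = leb (D n `&` [set x | D n (x + v)]).
Proof. by rewrite /overlap mulrC divfK ?fineK// gt_eqF// volume_gt0. Qed.

Lemma overlap_ge0 n v : 0 <= overlap n v.
Proof. by rewrite /overlap divr_ge0// ?fine_ge0// ltW// volume_gt0. Qed.

(** The defect is the relative volume of the boundary layer: a surface of order n^(d-1) over a
    volume of order n^d. The additive 2 of the layer bound is absorbed into a2 + 2. *)
Lemma overlap_defect_le n v :
  0 <= 1 - overlap n v <= 4 ^+ d * (`|v| + 2) * (a2 + 2) / a1 / n.+1%:R.
Proof.
have V0 := volume_gt0 n.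
have mD := compact_rV_measurable (@cD n).
have L := boundary_layer_le v d_gt0 (@cD n) (surfD n).
have S := measureDI leb mD (measurable_shift n v).
rewrite setDE in S.
have fL : leb (D n `&` ~` [set x | D n (x + v)]) \is a fin_num.
  by rewrite ge0_fin_numE//; apply: le_lt_trans L _; rewrite ltry.
have {}L : fine (leb (D n `&` ~` [set x | D n (x + v)])) <=
    4 ^+ d * (`|v| + 2) * (a2 * n.+1%:R ^+ d.-1 + 2) by rewrite -lee_fin fineK.
have {}S : vol n = fine (leb (D n `&` ~` [set x | D n (x + v)])) +
    fine (leb (D n `&` [set x | D n (x + v)])) by rewrite /vol S fineD //; exact: foverlap.
have -> : 1 - overlap n v = fine (leb (D n `&` ~` [set x | D n (x + v)])) / vol n.
  apply: (mulIf (lt0r_neq0 V0)); rewrite mulrBl /overlap !divfK ?lt0r_neq0//.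
  by rewrite mul1r {1}S addrK.
have L0 : 0 <= fine (leb (D n `&` ~` [set x | D n (x + v)])) by rewrite fine_ge0.
rewrite divr_ge0//= ?(ltW V0)//.
have K0 : 0 <= 4 ^+ d * (`|v| + 2) by rewrite mulr_ge0 ?exprn_ge0// addr_ge0.
have n0 : 0 < n.+1%:R :> R by rewrite ltr0n.
rewrite ler_pdivrMr//; apply: le_trans L _.
rewrite [leRHS](_ : _ = 4 ^+ d * (`|v| + 2) * ((a2 + 2) * (a1^-1 * n.+1%:R^-1 * vol n))); last first.
  by rewrite !mulrA.
apply: ler_wpM2l => //.
apply: (@le_trans _ _ ((a2 + 2) * n.+1%:R ^+ d.-1)).
  rewrite mulrDl lerD2l ler_peMr//; apply: exprn_ege1.
  by rewrite ler1n.
apply: ler_wpM2l; first by rewrite addr_ge0// ltW.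
rewrite -invfM ler_pdivlMl ?mulr_gt0//.
apply: le_trans (volume_ge n).
by rewrite -mulrA -exprS prednK.
Qed.

Lemma overlap_cvg1 v : overlap n v @[n --> \oo] --> (1 : R).
Proof.
have : (1 - (1 - overlap n v)) @[n --> \oo] --> (1 - 0 : R).
  apply: cvgB; first exact: cvg_cst.
  have h : 4 ^+ d * (`|v| + 2) * (a2 + 2) / a1 / n.+1%:R @[n --> \oo] --> (0 : R).
    rewrite -[X in _ --> X](mulr0 (4 ^+ d * (`|v| + 2) * (a2 + 2) / a1)).
    by apply: cvgM; [exact: cvg_cst|exact: cvg_harmonic].
  apply: (squeeze_cvgr _ (cvg_cst 0) h).
  by apply: nearW => n; exact: overlap_defect_le.
by rewrite subr0; under eq_cvg do rewrite subKr.
Qed.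

Lemma overlap_le1 n v : overlap n v <= 1.
Proof. by have /andP[] := overlap_defect_le n v; rewrite subr_ge0. Qed.

Lemma measurable_overlap n : measurable_fun setT (overlap n).
Proof.
have mD := compact_rV_measurable (@cD n).
have m1 : measurable_fun setT (fun x : 'rV[R]_d => \1_(D n) x : R).
  exact: measurable_indic.
pose F (z : 'rV[R]_d * 'rV[R]_d) : \bar R := (\1_(D n) z.2 * \1_(D n) (z.2 + z.1))%:E.
have mF : measurable_fun setT F.
  apply/measurable_EFinP; apply: measurable_funM.
    exact: (measurableT_comp m1 measurable_snd).
  apply: (measurableT_comp m1); apply: measurable_rowvecP => i.
  under eq_fun do rewrite !mxE; apply: measurable_funD.
    exact: (measurableT_comp (measurable_rowvec_coord i) measurable_snd).
  exact: (measurableT_comp (measurable_rowvec_coord i) measurable_fst).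
have F0 z : (0 <= F z)%E by rewrite lee_fin mulr_ge0.
have mG := measurable_fun_fubini_tonelli_F (m2 := leb) F mF F0.
rewrite (_ : overlap n = fun v => fine (\int[leb]_x F (v, x))%E * (vol n)^-1).
  apply: measurable_funM => //; apply: measurableT_comp => //.
apply/funext => v; congr (fine _ / _).
rewrite -[X in leb X]setIT -integral_indic//; last exact: measurableI.
by apply: eq_integral => x _; rewrite indicI.
Qed.

(** Dominated convergence with f itself as majorant, the overlap being between 0 and 1. *)
Lemma overlap_integral_cvg (f : 'rV[R]_d -> R) :
  leb.-integrable setT (EFin \o f) -> (forall x, 0 <= f x) ->
  (\int[leb]_v (f v * overlap n v)) @[n --> \oo] --> \int[leb]_v f v.
Proof.
move=> intf f0.
have mf : measurable_fun setT f by move/measurable_int: intf => /measurable_EFinP.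
have [] := @dominated_convergence _ _ _ leb setT measurableT
  (fun n v => (f v * overlap n v)%:E) (EFin \o f) (EFin \o f).
- by move=> n; apply/measurable_EFinP/measurable_funM => //; exact: measurable_overlap.
- exact/measurable_EFinP.
- apply: aeW => v _; apply: cvg_EFin; first exact: nearW.
  rewrite -[X in _ --> X]/(f v) -[X in _ --> X]mulr1.
  by apply: cvgM; [exact: cvg_cst|exact: overlap_cvg1].
- exact: intf.
- apply: aeW => v n _; rewrite /= lee_fin (ger0_norm (mulr_ge0 (f0 v) (overlap_ge0 n v))).
  by rewrite ler_piMr// overlap_le1.
move=> _ _ cv; apply: fine_cvg.
rewrite /Rintegral fineK; last exact: integrable_fin_num.
exact: cv.
Qed.

End window_overlap.

(** * Assembly of the variance limit and the central limit theorem *)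

Theorem corollary4p3 (R : realType) (d : nat) (hd : (0 < d)%N)
    (rho : R) (hrho : 0 < rho)
    (C : 'rV[R]_d -> R)
    (C_sym : forall x, C (- x) = C x)
    (C_cont : continuous C)
    (C_L2 : C \in Lfun (lebesgue_rV d) 2%:E)
    (C_0 : C 0 = rho)
    (FC : 'rV[R]_d -> R[i])
    (FC_fourier : is_fourier_L2 C FC)
    (FC_bounds : {ae lebesgue_rV d, forall t, 0 <= FC t <= 1})
    (disp : measure_display) (T : measurableType disp) (P : probability T R)
    (X : T -> set 'rV[R]_d) (X_dpp : stationary_dpp P X C)
    (D : nat -> set 'rV[R]_d) (D_regular : regular_sequence D) :
  let vol n : R := fine (lebesgue_rV d (D n)) in
  let rho_hat n : T -> R := intensity_estimator X (D n) in
  let sigma2 : R := rho - \int[lebesgue_rV d]_x (C x ^+ 2) in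
  ('V_P[(fun w => Num.sqrt (vol n) * rho_hat n w)%R])%E @[n --> \oo]
    --> sigma2%:E /\
  cvg_in_distribution P (fun n w => Num.sqrt (vol n) * (rho_hat n w - rho))
    (centered_normal sigma2).
Proof.
move=> vol rho_hat sigma2.
have [geom [a1 [a2 [a1_gt0 a2_gt0 bnd]]]] := D_regular.
(* Everything is indexed by n + 1, since regularity says nothing about the window of index 0. *)
have cD n : compact (D n.+1) by have [] := geom n.+1 isT.
have volD n : ((a1 * n.+1%:R ^+ d)%:E <= lebesgue_rV d (D n.+1))%E.
  by have [/andP[]] := bnd n.+1 isT.
have surfD n : (hausdorff_measure d.-1 (boundary (D n.+1)) <=
    (a2 * n.+1%:R ^+ d.-1)%:E)%E by have [_ /andP[]] := bnd n.+1 isT.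
have V0 n : 0 < vol n.+1 := volume_gt0 cD a1_gt0 volD n.
have C0 : 0 <= C 0 by rewrite C_0 ltW.
pose p n := @window_trace R d C (D n.+1) (@cD n).
pose I2 := \int[lebesgue_rV d]_x (C x ^+ 2).
have p0 n : p n 0 / vol n.+1 = rho.
  rewrite /p window_trace0 // C_0; apply: mulfK.
  by rewrite gt_eqF//; exact: V0.
have intC2 := Lfun2_integrable_sqr C_L2.
have p1 n : p n 1 / vol n.+1 =
    \int[lebesgue_rV d]_v (C v ^+ 2 * overlap (fun n => D n.+1) n v).
  have := window_trace1 C_sym C_cont (@cD n).
  rewrite (_ : \int[_]_v _ = ((vol n.+1)%:E *
      \int[lebesgue_rV d]_v (C v ^+ 2 * overlap (fun n => D n.+1) n v)%:E)%E)%E; last first.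
    rewrite -ge0_integralZl_EFin//; last 3 first.
    - by move=> v _; rewrite lee_fin mulr_ge0 ?sqr_ge0// overlap_ge0.
    - apply/measurable_EFinP/measurable_funM; last exact: measurable_overlap.
      by apply: measurable_funX; exact: continuous_rV_measurable.
    - exact: ltW.
    apply: eq_integral => v _.
    rewrite -(volume_overlap cD a1_gt0 volD) -!EFinM; congr EFin.
    by rewrite mulrCA.
  move=> pE; rewrite /Rintegral.
  rewrite -[X in fine X]mul1e -[in X in fine X](@mulVf _ (vol n.+1)) ?gt_eqF//.
  by rewrite EFinM -muleA -pE -EFinM /= mulrC.
have p1cvg : p n 1 / vol n.+1 @[n --> \oo] --> I2.
  under eq_cvg do rewrite p1.
  apply: (overlap_integral_cvg hd cD a1_gt0 a2_gt0 volD surfD intC2).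
  by move=> x; exact: sqr_ge0.
have p1_ge0 n : 0 <= p n 1.
  exact: le_trans (normr_ge0 _) (window_trace_le C_sym C_cont X_dpp (@cD n) 0).
pose s n := (p n 0 - p n 1) / vol n.+1.
have sE n : s n = rho - p n 1 / vol n.+1 by rewrite /s mulrBl p0.
have scvg : s n @[n --> \oo] --> sigma2.
  by under eq_cvg do rewrite sE; apply: cvgB => //; exact: cvg_cst.
pose Z n w := Num.sqrt (vol n) * (rho_hat n w - rho).
have ZE n : Z n.+1 = fun w => Num.sqrt (vol n.+1) * (intensity_estimator X (D n.+1) w - C 0).
  by rewrite C_0.
have Z2 n : \int[P]_w (Z n.+1 w) ^+ 2 = s n.
  by rewrite ZE; exact: (standardized_variance C_cont X_dpp (@cD n) C0 (V0 n)).
have s_ge0 n : 0 <= s n by rewrite -Z2; apply: Rintegral_ge0 => w _; exact: sqr_ge0.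
(* A limit of variances; the limit law takes the square root of sigma2. *)
have sigma2_ge0 : 0 <= sigma2 by apply: (cvgr_to_ge scvg); exact: nearW.
have volcvg : Num.sqrt (vol n.+1) @[n --> \oo] --> +oo.
  apply/cvgryPge => A.
  have /cvgryPge /(_ (A ^+ 2)) := volume_cvg_pinfty hd cD a1_gt0 volD.
  apply: filterS => n /ler_wsqrtr; apply: le_trans.
  by rewrite sqrtr_sqr ler_norm.
split.
  rewrite -(cvg_shiftS _ _).
  have scvgE : (s n)%:E @[n --> \oo] --> sigma2%:E.
    by apply: cvg_EFin; [exact: nearW|exact: scvg].
  rewrite (_ : (fun n => _) = (fun n => (s n)%:E))//.
  by apply/funext => n; exact: (estimator_variance C_cont X_dpp (@cD n) C0 (V0 n)).
(* One constant must bound both second moments: that of [Z n.+1] is s n <= rho because p n 1 >= 0,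
   and that of the limit law is put into the maximum. *)
apply: (@weak_convergence_of_trig _ _ _ P Z (centered_normal sigma2) _
   (Num.max rho (\int[centered_normal sigma2]_x x ^+ 2))).
- move=> [//|n] _; apply: measurable_funM => //; apply: measurable_funB => //.
  exact: (measurable_estimator X_dpp (@cD n)).
- move=> [//|n] _; rewrite ZE.
  exact: (integrable_standardized_sqr C_cont X_dpp (@cD n) C0 (V0 n)).
- move=> [//|n] _; rewrite Z2 sE le_max; apply/orP; left.
  by rewrite gerBl divr_ge0// ltW.
- exact: integrable_sqr_centered_normal.
- by rewrite le_max lexx orbT.
move=> u b u0.
rewrite -(cvg_shiftS _ _).
pose E n := expR (s n * u ^+ 2 / 2).
pose I n := \int[P]_w sin (u * Z n.+1 w + b).
have expcvg (g : nat -> R) (l : R) :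
    g n @[n --> \oo] --> l -> expR (g n) @[n --> \oo] --> expR l.
  by move=> gl; apply: continuous_cvg => //; exact: continuous_expR.
have Ecvg : E n @[n --> \oo] --> expR (sigma2 * u ^+ 2 / 2).
  apply: expcvg.
  by apply: cvgM; [apply: cvgM => //; exact: cvg_cst|exact: cvg_cst].
(* The differential equation controls the product with the integrating factor; since [E n] has a
   positive limit, dividing by it recovers the characteristic function, also when sigma2 = 0. *)
have Ipcvg : I n * E n @[n --> \oo] --> sin b.
  pose err n := u * ((p n 0 + 7 * p n 1) / vol n.+1 * u ^+ 2 / Num.sqrt (vol n.+1)) *
    expR (`|s n| * u ^+ 2 / 2).
  have errcvg : err n @[n --> \oo] --> (0 : R).
    rewrite -[X in _ --> X](_ : u * ((rho + 7 * I2) * u ^+ 2 * 0) *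
      expR (`|sigma2| * u ^+ 2 / 2) = _); last by ring.
    apply: cvgM; last first.
      apply: expcvg.
      by apply: cvgM; [apply: cvgM; [exact: cvg_norm|exact: cvg_cst]|exact: cvg_cst].
    apply: cvgM; first exact: cvg_cst.
    apply: cvgM; last first.
      by apply/gtr0_cvgV0 => //; apply: nearW => n; rewrite sqrtr_gt0.
    apply: cvgM; last exact: cvg_cst.
    under eq_cvg do rewrite mulrDl p0 -mulrA.
    by apply: cvgD; [exact: cvg_cst|apply: cvgM => //; exact: cvg_cst].
  have dist : \forall n \near \oo, `|I n * E n - sin b| <= err n.
    (* The restriction u <= sqrt (vol) / 2 of [estimator_charfun] holds for large n. *)
    move/cvgryPge : volcvg => /(_ (2 * u)); apply: filterS => n un.
    rewrite /I ZE; apply: (estimator_charfun C_sym C_cont X_dpp (@cD n) C0 (V0 n)) => //.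
    by rewrite ler_pdivlMr// mulrC.
  apply/cvgrPdist_le => eps eps0.
  move/cvgrPdist_le : errcvg => /(_ _ eps0); move: dist; apply: filterS2 => n h1.
  rewrite sub0r normrN distrC => h2.
  exact: le_trans h1 (le_trans (ler_norm _) h2).
have -> : \int[centered_normal sigma2]_x sin (u * x + b) =
    sin b / expR (sigma2 * u ^+ 2 / 2).
  by rewrite -(centered_normal_charfun sigma2_ge0 b u0) mulfK// gt_eqF ?expR_gt0.
have : I n * E n / E n @[n --> \oo] --> sin b / expR (sigma2 * u ^+ 2 / 2).
  by apply: cvgM => //; apply: cvgV => //; rewrite gt_eqF ?expR_gt0.
rewrite (_ : (fun n => I n * E n / E n) = I)//.
by apply/funext => n; rewrite mulfK// gt_eqF ?expR_gt0.
Qed.
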